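(* Let $\omega$ be a Veech surface with Veech group $\Gamma_\omega$, and suppose that $h_{\alpha}\in \Gamma_\omega$ for some $\alpha>0$. Let $P$ be the uniform probability measure on $[0,\alpha]$. Then for every $T>0$, as $\delta\to 0$ (with $\delta>0$), $$P\left(\left\{s\in [0,\alpha]:\sqrt{\delta}\,\Psi(h_s\omega,\delta)\leq T\right\}\right)\longrightarrow \frac{\mu_{\omega}\left(\left\{ g\Gamma_\omega\in Y_\omega: \Psi(g\omega,1)\leq T\right\}\right)}{\mu_\omega\left(Y_\omega\right)}.$$
   Context: A compact translation surface is a pair $(X,\omega)$, written $\omega$, with $X$ a compact Riemann surface and $\omega$ a non-zero holomorphic 1-form on $X$. Equivalently, it is a surface obtained from finitely many polygons in $\mathbb{C}$ by identifying, by Euclidean translations, sides that are grouped in parallel pairs of equal length, with $\omega$ induced by $dz$. The form $\omega$ induces a flat metric away from its zeros. A saddle connection is a geodesic $\gamma$ for this metric starting and ending at (possibly equal) zeros of $\omega$ and passing through no other zeros. Its holonomy vector is $z_\gamma=\int_\gamma\omega\in\mathbb{C}$, and $\Lambda_\omega\subset\mathbb{C}$ is the set of all holonomy vectors of saddle connections of $\omega$. $SL(2,\mathbb{R})$ acts on (isomorphism classes of) translation surfaces by acting linearly on the defining polygons in $\mathbb{C}\cong\mathbb{R}^2$, with $x+iy$ identified with $[x,y]^T$; one has $\Lambda_{g\omega}=g\Lambda_\omega$. The Veech group $\Gamma_\omega$ is the stabilizer of $\omega$ under this action. $\omega$ is a Veech surface if $\Gamma_\omega$ is a discrete subgroup of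 $SL(2,\mathbb{R})$ and $Y_\omega=SL(2,\mathbb{R})/\Gamma_\omega$ has finite volume. $\mu_\omega$ is the measure on $Y_\omega$ induced by Haar measure on $SL(2,\mathbb{R})$. For $s\in\mathbb{R}$, $h_s=\begin{bmatrix}1&0\\-s&1\end{bmatrix}$. For a translation surface $\omega$ and $\delta>0$, $$\Psi(\omega,\delta)=\min\left\{\operatorname{Re}(z): z\in\Lambda_\omega\cap C_\delta\right\},\qquad C_\delta=\{x+iy\in\mathbb{C}: x>0,\ |y|<\delta x\},$$ with the convention that the minimum of the empty set is $+\infty$. *)

(* Defs.v *)
(* The complex plane is 'cV[R]_2: x + iy is the column [x, y]^T. *)
From HB Require Import structures.
From Stdlib Require Import Relation_Operators.
From mathcomp Require Import all_boot all_order all_algebra.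
From mathcomp Require Import generic_quotient.
From mathcomp Require Import all_classical all_reals all_analysis.
From mathcomp Require Import ring.

Set Implicit Arguments.
Unset Strict Implicit.
Unset Printing Implicit Defensive.

Import Order.TTheory GRing.Theory Num.Theory.
Import numFieldNormedType.Exports.

Local Open Scope classical_set_scope.
Local Open Scope ring_scope.
Local Open Scope quotient_scope.

Lemma det2E (R : comNzRingType) (g : 'M[R]_2) :
  \det g = g 0 0 * g 1 1 - g 0 1 * g 1 0.
Proof.
rewrite (expand_det_row _ 0) !big_ord_recl big_ord0 addr0 /cofactor.
rewrite !det_mx11 !mxE /= expr0 expr1 mul1r mulN1r mulrN.
by congr (g _ _ * g _ _ - g _ _ * g _ _); exact: val_inj.
Qed.

Section SL2.
Context {R : realType}.

Definition SL2 : Type := set_type [set g : 'M[R]_2 | \det g = 1].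

HB.instance Definition _ :=
  SubType.copy SL2 (set_type [set g : 'M[R]_2 | \det g = 1]).
HB.instance Definition _ :=
  Topological.copy SL2 (set_type [set g : 'M[R]_2 | \det g = 1]).

Lemma SL2_det (g : SL2) : \det (\val g) = 1.
Proof. by case: g => g /= /set_mem. Qed.

Definition SL2_of (g : 'M[R]_2) (dg : \det g = 1) : SL2 := exist _ g (mem_set dg).

Lemma SL2_det1 : \det (1%:M : 'M[R]_2) = 1.
Proof. exact: det1. Qed.

Lemma SL2_detM (g h : SL2) : \det (\val g *m \val h) = 1.
Proof. by rewrite det_mulmx !SL2_det mulr1. Qed.

Lemma SL2_detV (g : SL2) : \det (invmx (\val g)) = 1.
Proof. by rewrite det_inv SL2_det invr1. Qed.

Lemma SL2_unit (g : SL2) : \val g \in unitmx.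
Proof. by rewrite unitmxE SL2_det unitr1. Qed.

Let one := SL2_of SL2_det1.
Let inv g := SL2_of (SL2_detV g).
Let mul g h := SL2_of (SL2_detM g h).

Let SL2_mulA : associative mul.
Proof. by move=> f g h; apply: val_inj; rewrite /= mulmxA. Qed.

Let SL2_mul1 : left_id one mul.
Proof. by move=> g; apply: val_inj; rewrite /= mul1mx. Qed.

Let SL2_mulr1 : right_id one mul.
Proof. by move=> g; apply: val_inj; rewrite /= mulmx1. Qed.

Let SL2_mulV : left_inverse one inv mul.
Proof. by move=> g; apply: val_inj; rewrite /= mulVmx ?SL2_unit. Qed.

Let SL2_mulVr : right_inverse one inv mul.
Proof. by move=> g; apply: val_inj; rewrite /= mulmxV ?SL2_unit. Qed.

HB.instance Definition _ := isGroup.Build SL2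
  SL2_mulA SL2_mul1 SL2_mulr1 SL2_mulV SL2_mulVr.
HB.instance Definition _ := isPointed.Build SL2 one.

Definition hmx (s : R) : 'M[R]_2 :=
  \matrix_(i, j) (if i == j then 1
                  else if (i == 1) && (j == 0) then - s else 0).

Lemma det_hmx s : \det (hmx s) = 1.
Proof. by rewrite det2E !mxE /= mul0r subr0 mulr1. Qed.

Definition h_ (s : R) : SL2 := SL2_of (det_hmx s).

End SL2.
Arguments SL2 : clear implicits.

Section Polygon.
Context {R : realType}.

Definition cross (u v : 'cV[R]_2) : R := u 0 0 * v 1 0 - u 1 0 * v 0 0.

Section OnePolygon.
Variables (n : nat) (v : 'I_n -> 'cV[R]_2).

Definition edge_vec (k : 'I_n) : 'cV[R]_2 := v (ordS k) - v k.

Definition edge_pt (k : 'I_n) (t : R) : 'cV[R]_2 := v k + t *: edge_vec k.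

Definition boundary : set 'cV[R]_2 :=
  [set z | exists k t, 0 <= t <= 1 /\ z = edge_pt k t].

(* The closed polygon bounded by a simple closed polygonal curve: the curve
   together with the bounded component of its complement. *)
Definition polygon : set 'cV[R]_2 :=
  boundary `|`
  [set z | (~` boundary) z /\
           bounded_set (connected_component (~` boundary) z)].

Definition simple_polygon : Prop :=
  forall k l s t, 0 <= s < 1 -> 0 <= t < 1 ->
    edge_pt k s = edge_pt l t -> k = l /\ s = t.

(* Counterclockwise orientation: the polygon lies to the left of each edge. *)
Definition positively_oriented : Prop :=
  forall k t, 0 < t < 1 ->
    \forall z \near edge_pt k t,
      polygon z <-> 0 <= cross (edge_vec k) (z - edge_pt k t).

End OnePolygon.

Lemma cross_mul (g : 'M[R]_2) (u v : 'cV[R]_2) :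
  cross (g *m u) (g *m v) = \det g * cross u v.
Proof.
rewrite det2E /cross !mxE !big_ord_recl !big_ord0.
have -> : lift ord0 ord0 = 1 :> 'I_2 by exact: val_inj.
have -> : ord0 = 0 :> 'I_2 by exact: val_inj.
by ring.
Qed.

Lemma mulmx_bounded (g : 'M[R]_2) :
  exists2 M : R, 0 <= M & forall x : 'cV[R]_2, `|g *m x| <= M * `|x|.
Proof.
have entry_le (x : 'cV[R]_2) j : `|x j 0| <= `|x|.
  rewrite [leRHS]/Num.Def.normr /= mx_normrE.
  exact: (le_bigmax _ (fun ij : 'I_2 * 'I_1 => `|x ij.1 ij.2|) (j, 0)).
exists (\sum_i \sum_j `|g i j|).
  by apply: sumr_ge0 => i _; exact: sumr_ge0.
move=> x; rewrite [leLHS]/Num.Def.normr /= mx_normrE; apply/bigmax_leP; split.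
  by rewrite mulr_ge0// sumr_ge0// => i _; exact: sumr_ge0.
move=> [i j] _ /=; rewrite mxE ord1; apply: (le_trans (ler_norm_sum _ _ _)).
apply: (@le_trans _ _ ((\sum_j `|g i j|) * `|x|)).
  by rewrite mulr_suml; apply: ler_sum => k _; rewrite normrM ler_wpM2l.
rewrite ler_wpM2r// [leRHS](bigD1 i)//= lerDl.
by apply: sumr_ge0 => k _; exact: sumr_ge0.
Qed.

Lemma mulmx_continuous (g : 'M[R]_2) :
  continuous (fun x : 'cV[R]_2 => g *m x).
Proof.
have [M M0 gM] := mulmx_bounded g.
apply: (@bounded_linear_continuous R _ _ (mulmx g)).
apply/linear_boundedP; near=> r => x; apply: (le_trans (gM x)).
by apply: ler_wpM2r => //; near: r; exact: nbhs_pinfty_ge.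
Unshelve. all: by end_near. Qed.

Section Mul.
Variables (g : SL2 R) (n : nat).
Implicit Types v : 'I_n -> 'cV[R]_2.
Local Notation "g .* v" := (fun k => \val g *m v k) (at level 40).

Lemma edge_vec_mul v k : edge_vec (g .* v) k = \val g *m edge_vec v k.
Proof. by rewrite /edge_vec mulmxBr. Qed.

Lemma edge_pt_mul v k t : edge_pt (g .* v) k t = \val g *m edge_pt v k t.
Proof. by rewrite /edge_pt edge_vec_mul scalemxAr -mulmxDr. Qed.

Lemma SL2_mulKmx (x : 'cV[R]_2) : invmx (\val g) *m (\val g *m x) = x.
Proof. by rewrite mulmxA mulVmx ?SL2_unit// mul1mx. Qed.

Lemma SL2_mulVKmx (x : 'cV[R]_2) : \val g *m (invmx (\val g) *m x) = x.
Proof. by rewrite mulmxA mulmxV ?SL2_unit// mul1mx. Qed.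

Lemma boundary_mul v z : boundary (g .* v) (\val g *m z) <-> boundary v z.
Proof.
split=> -[k [t [t01 zE]]]; exists k, t; split=> //.
  by rewrite -[LHS]SL2_mulKmx zE edge_pt_mul SL2_mulKmx.
by rewrite edge_pt_mul zE.
Qed.

Lemma polygon_mul v z : polygon (g .* v) (\val g *m z) <-> polygon v z.
Proof.
have [M M0 gM] := mulmx_bounded (\val g).
have [N N0 gN] := mulmx_bounded (invmx (\val g)).
have image_component (h h' : 'M[R]_2) (A B : set 'cV[R]_2) x y :
    (forall z, A (h' *m z) -> B z) ->
    cancel (mulmx h : 'cV_2 -> 'cV_2) (mulmx h') -> h *m x = y ->
    [set h *m z | z in connected_component A x]
      `<=` connected_component B y.
  move=> AB hK <- _ [u [C [Cx CA cC] Cu] <-].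
  exists [set h *m z | z in C]; last by exists u.
  split; first by exists x.
    by move=> _ [c Cc <-]; apply: AB; rewrite hK; exact: CA.
  apply: connected_continuous_connected => //.
  exact/continuous_subspaceT/mulmx_continuous.
have gK : cancel (mulmx (\val g) : 'cV_2 -> 'cV_2) (mulmx (invmx (\val g))).
  exact: SL2_mulKmx.
have gVK : cancel (mulmx (invmx (\val g)) : 'cV_2 -> 'cV_2) (mulmx (\val g)).
  exact: SL2_mulVKmx.
have bounded_le (h h' : 'M[R]_2) (K : R) (A B : set 'cV[R]_2) : 0 <= K ->
    (forall x : 'cV[R]_2, `|h' *m x| <= K * `|x|) ->
    cancel (mulmx h : 'cV_2 -> 'cV_2) (mulmx h') ->
    [set h *m z | z in A] `<=` B -> bounded_set B -> bounded_set A.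
  move=> K0 hK hh' AB /pinfty_ex_gt0[r r0 Br].
  exists (K * r); split=> [|s rs x Ax]; first exact: num_real.
  apply: le_trans (ltW rs); rewrite -[x]hh'; apply: (le_trans (hK _)).
  by apply: ler_wpM2l => //; apply: Br; apply: AB; exists x.
split=> -[/boundary_mul zb|[zb zbnd]]; [by left|right|by left|right].
  split; first by move=> /boundary_mul.
  apply: (bounded_le (\val g) (invmx (\val g)) N) zbnd => //.
  apply: (image_component _ (invmx (\val g))) => // u; rewrite /setC /=.
  by apply: contra_not => /=; rewrite -{1}[u]gVK => /boundary_mul.
split; first by move=> /boundary_mul.
apply: (bounded_le (invmx (\val g)) (\val g) M) zbnd => //.
apply: (image_component _ (\val g)) => // u; rewrite /setC /=.
by apply: contra_not => /boundary_mul.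
Qed.

Lemma simple_polygon_mul v : simple_polygon v -> simple_polygon (g .* v).
Proof.
move=> sv k l s t s01 t01; rewrite !edge_pt_mul.
by move=> /(congr1 (mulmx (invmx (\val g)))); rewrite !SL2_mulKmx; exact: sv.
Qed.

Lemma positively_oriented_mul v :
  positively_oriented v -> positively_oriented (g .* v).
Proof.
move=> ov k t t01; rewrite edge_pt_mul edge_vec_mul.
have nv : \forall z \near \val g *m edge_pt v k t,
    polygon v (invmx (\val g) *m z) <->
    0 <= cross (edge_vec v k) (invmx (\val g) *m z - edge_pt v k t).
  have c := @mulmx_continuous (invmx (\val g)) (\val g *m edge_pt v k t).
  by rewrite /continuous_at SL2_mulKmx in c; exact: c (ov k t t01).
near=> z; have : polygon v (invmx (\val g) *m z) <->
    0 <= cross (edge_vec v k) (invmx (\val g) *m z - edge_pt v k t).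
  by near: z; exact: nv.
rewrite -polygon_mul SL2_mulVKmx => ->.
by rewrite -{2}[z]SL2_mulVKmx -mulmxBr cross_mul SL2_det mul1r.
Unshelve. all: by end_near. Qed.

End Mul.
End Polygon.

(* Side (i, k) joins vertex k of polygon i to the next one. *)
Definition sides n (m : 'I_n -> nat) := {i : 'I_n & 'I_(m i)}.

(* A compact translation surface, given by finitely many polygons whose sides
   are identified in pairs by translations.  The polygons are positively
   oriented, so a translation identifying two sides leaves the polygons on
   opposite sides of the glued segment when the vectors of the two sides are
   opposite.  Connectedness of the surface is connectedness of the graph of
   adjacent polygons. *)
Record translation_surface (R : realType) := TranslationSurface {
  npolygon : nat;
  nside : 'I_npolygon -> nat;
  vertex : forall i, 'I_(nside i) -> 'cV[R]_2;
  mate : sides nside -> sides nside;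
  npolygon_gt0 : (0 < npolygon)%N;
  nside_gt2 : forall i, (2 < nside i)%N;
  vertex_simple : forall i, simple_polygon (@vertex i);
  vertex_oriented : forall i, positively_oriented (@vertex i);
  mateK : involutive mate;
  mate_opp : forall e : sides nside,
    edge_vec (@vertex (tag (mate e))) (tagged (mate e)) =
    - edge_vec (@vertex (tag e)) (tagged e);
  polygons_connected : forall i j : 'I_npolygon,
    connect [rel a b | [exists e : sides nside,
                          (tag e == a) && (tag (mate e) == b)]] i j
}.
Arguments nside {R} w i : rename.
Arguments vertex {R} w i k : rename.
Arguments mate {R} w e : rename.

Section Action.
Context {R : realType} (g : SL2 R) (w : translation_surface R).

Definition act_vertex i (k : 'I_(nside w i)) : 'cV[R]_2 :=
  \val g *m vertex w i k.

Lemma act_opp (e : sides (nside w)) :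
  edge_vec (@act_vertex (tag (mate w e))) (tagged (mate w e)) =
  - edge_vec (@act_vertex (tag e)) (tagged e).
Proof. by rewrite !edge_vec_mul mate_opp mulmxN. Qed.

Definition act : translation_surface R :=
  @TranslationSurface R (npolygon w) (nside w) act_vertex (mate w)
    (npolygon_gt0 w) (@nside_gt2 _ w)
    (fun i => @simple_polygon_mul _ g _ _ (@vertex_simple _ w i))
    (fun i => @positively_oriented_mul _ g _ _ (@vertex_oriented _ w i))
    (@mateK _ w) act_opp (@polygons_connected _ w).

End Action.

Section Surface.
Context {R : realType} (w : translation_surface R).

Definition pieces := {i : 'I_(npolygon w) & polygon (vertex w i)}.

Definition side_pt (e : sides (nside w)) (t : R) : 'cV[R]_2 :=
  edge_pt (vertex w (tag e)) (tagged e) t.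

Definition pos (p : pieces) : 'cV[R]_2 := \val (tagged p).

(* Opposite orientations: the point at parameter t on a side is identified
   with the point at parameter 1 - t on its mate. *)
Definition glued (p q : pieces) : Prop :=
  exists (e : sides (nside w)) (t : R), [/\ 0 <= t <= 1,
    tag p = tag e, pos p = side_pt e t,
    tag q = tag (mate w e) & pos q = side_pt (mate w e) (1 - t)].

Definition glue_rel (p q : pieces) : bool :=
  `[< clos_refl_sym_trans pieces glued p q >].

Lemma glue_rel_refl : reflexive glue_rel.
Proof. by move=> p; apply/asboolP; exact: rst_refl. Qed.

Lemma glue_rel_sym : symmetric glue_rel.
Proof. by move=> p q; apply/asboolP/asboolP; exact: rst_sym. Qed.

Lemma glue_rel_trans : transitive glue_rel.
Proof.
by move=> q p r /asboolP pq /asboolP qr; apply/asboolP; exact: rst_trans qr.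
Qed.

Definition glue_equiv : equiv_rel pieces :=
  EquivRel glue_rel glue_rel_refl glue_rel_sym glue_rel_trans.

Definition surface : Type := quotient_topology {eq_quot glue_equiv}.

HB.instance Definition _ :=
  Quotient.copy surface (quotient_topology {eq_quot glue_equiv}).
HB.instance Definition _ :=
  Topological.copy surface (quotient_topology {eq_quot glue_equiv}).

Definition pr (p : pieces) : surface := \pi_surface p.

(* phi is a primitive of the form on the open set V: on every polygon it
   is, locally, z + constant. *)
Definition primitive (V : set surface) (phi : surface -> 'cV[R]_2) : Prop :=
  open V /\
  forall p, V (pr p) ->
    \forall q \near p, phi (pr q) - phi (pr p) = pos q - pos p.

Definition flat_chart (V : set surface) (phi : surface -> 'cV[R]_2) : Prop :=
  primitive V phi /\ set_inj V phi.

(* Near a point of total angle 2 pi (k + 1) there is a holomorphic coordinate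
   zeta for which the primitive is zeta ^ (k + 1) up to a constant; so the form
   vanishes there (k >= 1) exactly when no primitive is injective nearby. *)
Definition zero : set surface :=
  [set x | ~ exists V phi, V x /\ flat_chart V phi].

(* Paths are parametrized by [0, 1]; geodesics have constant speed. *)
Definition saddle_connection (gamma : R -> surface) : Prop :=
  [/\ {within `[0, 1], continuous gamma},
      zero (gamma 0), zero (gamma 1),
      forall t, 0 < t < 1 -> ~ zero (gamma t) &
      forall t, 0 < t < 1 -> exists V phi (v : 'cV[R]_2),
        [/\ flat_chart V phi, V (gamma t), v != 0 &
            \forall s \near t,
              V (gamma s) /\ phi (gamma s) - phi (gamma t) = (s - t) *: v]].

(* z is the integral of the form along gamma: F is a primitive along gamma. *)
Definition holonomy (gamma : R -> surface) (z : 'cV[R]_2) : Prop :=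
  exists F : R -> 'cV[R]_2, z = F 1 - F 0 /\
    forall t, 0 <= t <= 1 -> exists V phi,
      [/\ primitive V phi, V (gamma t) &
          \forall s \near t, 0 <= s <= 1 ->
            V (gamma s) /\ F s - F t = phi (gamma s) - phi (gamma t)].

Definition holonomy_vectors : set 'cV[R]_2 :=
  [set z | exists gamma, saddle_connection gamma /\ holonomy gamma z].

Definition Cdelta (delta : R) : set 'cV[R]_2 :=
  [set z | 0 < z 0 0 /\ `|z 1 0| < delta * z 0 0].

(* The infimum is attained when the set is not empty, since the holonomy
   vectors form a discrete closed set; ereal_inf set0 = +oo. *)
Definition Psi (delta : R) : \bar R :=
  ereal_inf [set (z 0 0)%:E | z in holonomy_vectors `&` Cdelta delta].

End Surface.

Definition isomorphic {R : realType} (w w' : translation_surface R) : Prop :=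
  exists (f : surface w -> surface w') (f' : surface w' -> surface w),
    [/\ continuous f, continuous f', cancel f f', cancel f' f &
        forall V phi, primitive V phi -> primitive (f @^-1` V) (phi \o f)].

Definition veech_group {R : realType} (w : translation_surface R) :
    set (SL2 R) :=
  [set g | isomorphic (act g w) w].

Definition borel (T : ptopologicalType) := g_sigma_algebraType (@open T).

Section Quotient.
Context {R : realType} (Gamma : set (SL2 R)).
Local Open Scope group_scope.

Definition left_coset (g : SL2 R) : set (SL2 R) := [set g * x | x in Gamma].

Definition coset_rel (g h : SL2 R) : bool := `[< left_coset g = left_coset h >].

Lemma coset_rel_refl : reflexive coset_rel.
Proof. by move=> g; apply/asboolP. Qed.

Lemma coset_rel_sym : symmetric coset_rel.
Proof. by move=> g h; apply/asboolP/asboolP. Qed.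

Lemma coset_rel_trans : transitive coset_rel.
Proof.
by move=> h g k /asboolP gh /asboolP hk; apply/asboolP; rewrite gh.
Qed.

Definition coset_equiv : equiv_rel (SL2 R) :=
  EquivRel coset_rel coset_rel_refl coset_rel_sym coset_rel_trans.

Definition SL2_quotient : Type := quotient_topology {eq_quot coset_equiv}.

HB.instance Definition _ :=
  Quotient.copy SL2_quotient (quotient_topology {eq_quot coset_equiv}).
HB.instance Definition _ :=
  Topological.copy SL2_quotient (quotient_topology {eq_quot coset_equiv}).

Definition to_quotient (g : SL2 R) : SL2_quotient := \pi_SL2_quotient g.

HB.instance Definition _ := isPointed.Build SL2_quotient (to_quotient 1).

End Quotient.

Definition haar_measure {R : realType}
    (m : {measure set (borel (SL2 R)) -> \bar R}) : Prop :=
  [/\ forall (g : SL2 R) (A : set (borel (SL2 R))), measurable A ->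
        m [set (g * x)%g | x in A] = m A,
      forall K : set (SL2 R), compact K -> (m K < +oo)%E &
      m setT != 0%E].

(* For a discrete Gamma the projection g |-> g Gamma is a covering, and the
   measure induced by m is the one for which this projection preserves the
   measure of every Borel set on which it is injective. *)
Definition induced_measure {R : realType} (Gamma : set (SL2 R))
    (m : {measure set (borel (SL2 R)) -> \bar R})
    (mu : {measure set (borel (SL2_quotient Gamma)) -> \bar R}) : Prop :=
  forall B : set (borel (SL2 R)), measurable B ->
    set_inj B (to_quotient Gamma) -> mu (to_quotient Gamma @` B) = m B.

(* Finiteness of the volume does not depend on the normalization of mu. *)
Definition veech_surface {R : realType} (w : translation_surface R)
    (mu : {measure set (borel (SL2_quotient (veech_group w))) -> \bar R}) :
    Prop :=
  veech_group w `<=` isolated (veech_group w) /\ (mu setT < +oo)%E.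

(* Main.v *)
(* Conjugation by a = diag(sqrt delta, 1 / sqrt delta) turns the event into
   a h_s being in A, where A is the set of g with Psi(g omega, 1) <= T, and it
   turns the arc {a h_s} into a long orbit of the unipotent flow h.  The flow is
   ergodic on the quotient: by von Neumann's argument its averages are Cauchy in
   L1, hence almost invariant under translations close to 1, hence by Mautner's
   phenomenon under all of SL(2, R), hence close to a constant.  Thus the arcs
   {a h_s g} equidistribute for suitable g arbitrarily close to 1.  Such a g is
   removed by writing h_s g = p h_u, with u a Moebius function of s close to s
   and p upper triangular close to 1: conjugation by a keeps p close to 1, so it
   only moves T slightly.  Finally the measure of A depends continuously on T,
   since a level set of Psi has infinitely many disjoint translates by lower
   triangular matrices. *)
From HB Require Import structures.
From Stdlib Require Import Relation_Operators.
Require Import Defs.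
From mathcomp Require Import all_boot all_order all_algebra.
From mathcomp Require Import generic_quotient.
From mathcomp Require Import all_classical all_reals all_analysis.
From mathcomp Require Import measurable_realfun.
From mathcomp Require Import ring lra.
Set Implicit Arguments.
Unset Strict Implicit.
Unset Printing Implicit Defensive.
Import Order.TTheory GRing.Theory Num.Theory.
Import numFieldNormedType.Exports.
Local Open Scope classical_set_scope.
Local Open Scope ring_scope.

(** * The group SL(2, R) *)

(** Equidistribution is available only in the mean, so the point [g] near the identity is chosen
    anew for each [a]. This is harmless because the comparison of the arcs through 1 and through [g]
    is uniform over a fixed box of [g] and over [a <= 1]. Analysis on the quotient is replaced by
    analysis of right [Gamma]-invariant functions on the group, integrated against Haar measure on a
    fundamental domain. The set observed is not [Psi <= T] itself but the open set [hit T] of those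
    [g] for which some holonomy vector lands in an open truncated cone. Openness gives
    measurability, and it makes the time averages lower semicontinuous in the starting point; as
    translations preserve their mean, this yields continuity of translations in L1 without
    approximation by continuous functions. Before any of this the Veech group has to be shown to be
    a group: its definition lets an isomorphism pull primitives back in one direction only, and the
    other direction requires a local primitive at every point, zeros included. *)

Lemma forall_I2 (P : 'I_2 -> Prop) : P 0 -> P 1 -> forall i, P i.
Proof.
move=> P0 P1 [[|[|//]] i2].
- by have -> : Ordinal i2 = 0 by exact: val_inj.
- by have -> : Ordinal i2 = 1 by exact: val_inj.
Qed.

Lemma sum_I2 (V : nmodType) (F : 'I_2 -> V) : \sum_i F i = F 0 + F 1.
Proof.
rewrite !big_ord_recl big_ord0 addr0; congr (_ + _).
by congr F; exact: val_inj.
Qed.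

Section SL2_algebra.
Context {R : realType}.
Implicit Types g x y : SL2 R.

Definition mx2 (a b c d : R) : 'M[R]_2 :=
  \matrix_(i, j) (if i == 0 then if j == 0 then a else b
                  else if j == 0 then c else d).

Lemma det_mx2 a b c d : \det (mx2 a b c d) = a * d - b * c.
Proof. by rewrite det2E !mxE. Qed.

Lemma SL2_eqP g x : (forall i j, \val g i j = \val x i j) -> g = x.
Proof. by move=> gx; apply: val_inj; apply/matrixP. Qed.

Lemma SL2_mulE g x i j :
  \val (g * x)%g i j = \val g i 0 * \val x 0 j + \val g i 1 * \val x 1 j.
Proof. by rewrite mxE sum_I2. Qed.

Lemma SL2_detE g : \val g 0 0 * \val g 1 1 - \val g 0 1 * \val g 1 0 = 1.
Proof. by rewrite -det2E SL2_det. Qed.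

Lemma SL2_invE g : \val (g^-1)%g = mx2 (\val g 1 1) (- \val g 0 1) (- \val g 1 0) (\val g 0 0).
Proof.
have dg := SL2_detE g.
have e : \val g *m mx2 (\val g 1 1) (- \val g 0 1) (- \val g 1 0) (\val g 0 0) = 1%:M.
  apply/matrixP; apply: forall_I2; apply: forall_I2; rewrite !mxE sum_I2 !mxE /=; lra.
rewrite -[RHS]mul1mx -[X in X *m _](mulVmx (SL2_unit g)) -mulmxA e mulmx1.
by [].
Qed.

Lemma SL2_mul1E : \val (1 : SL2 R)%g = 1%:M. Proof. by []. Qed.

Lemma SL2_mulmx g x : \val (g * x)%g = \val g *m \val x. Proof. by []. Qed.

End SL2_algebra.

Section SL2_topology.
Context {R : realType}.
Implicit Types g x y : SL2 R.

Definition SL2_box g (e : R) : set (SL2 R) :=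
  [set x : SL2 R | forall i j, `|\val x i j - \val g i j| < e].

Lemma SL2_nbhsP g (A : set (SL2 R)) :
  nbhs g A <-> exists2 e : R, 0 < e & SL2_box g e `<=` A.
Proof.
split.
  move=> [_ [[B oB <-] Bg BA]]; have : nbhs (\val g) B by exact: open_nbhs_nbhs.
  rewrite -nbhs_ballE => -[e /= e0 eB]; exists e => // x xg.
  apply: BA; apply: eB; split => // i j.
  rewrite /ball/= -normrN opprB; exact: xg.
move=> [e e0 eA].
rewrite nbhsE; exists [set x : SL2 R | (ball (\val g) e)° (\val x)].
  split; first by exists (ball (\val g) e)°; [exact: open_interior|].
  by rewrite /mkset /interior; exact: nbhsx_ballx.
move=> x /interior_subset [_ xg]; apply: eA => i j.
by rewrite -normrN opprB; exact: xg.
Qed.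

Lemma SL2_openP (O : set (SL2 R)) :
  open O <-> forall g, O g -> exists2 e : R, 0 < e & SL2_box g e `<=` O.
Proof.
rewrite openE; split=> [oO g /oO/SL2_nbhsP//|oO g Og].
by apply/SL2_nbhsP; exact: oO.
Qed.

Lemma open_SL2_box g (e : R) : open (SL2_box g e).
Proof.
apply/SL2_openP => y yg; pose m i j : R := e - `|\val y i j - \val g i j|.
have m0 i j : 0 < m i j by rewrite subr_gt0; exact: yg.
have [M M0 gM] : exists2 M : R, 0 < M & forall i j, M <= m i j.
  exists (Num.min (Num.min (m 0 0) (m 0 1)) (Num.min (m 1 0) (m 1 1))).
    by rewrite !lt_min !m0.
  by apply: forall_I2; apply: forall_I2; rewrite !ge_min lexx ?orbT.
exists M => // x xy i j; rewrite -(subrK (\val y i j) (\val x i j)) -addrA.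
apply: (le_lt_trans (ler_normD _ _)); have := xy i j; have := gM i j; rewrite /m.
by move: (`|_|) (`|_|) => ? ? ? ?; lra.
Qed.

Lemma SL2_entry_bound g : exists2 M : R, 0 < M & forall i j, `|\val g i j| <= M.
Proof.
exists (1 + \sum_i \sum_j `|\val g i j|).
  by rewrite ltr_pwDl// sumr_ge0// => k _; exact: sumr_ge0.
move=> k l; apply: (@le_trans _ _ (\sum_i \sum_j `|\val g i j|)); last by rewrite lerDr.
rewrite (bigD1 k)//= (bigD1 l)//= -addrA lerDl addr_ge0//.
  exact: sumr_ge0.
by apply: sumr_ge0 => ? _; exact: sumr_ge0.
Qed.

(** A countable base of the topology. The centres are arbitrary rational matrices, which need not
    have determinant 1. *)
Definition SL2_cell (k : 'M[rat]_2 * nat) : set (SL2 R) :=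
  [set x : SL2 R | forall i j, `|\val x i j - ratr (k.1 i j)| < k.2.+1%:R^-1].

Lemma SL2_open_bigcup (O : set (SL2 R)) : open O ->
  O = \bigcup_(k in [set k | SL2_cell k `<=` O]) SL2_cell k.
Proof.
move=> oO; apply/seteqP; split=> [g Og|g [k kO]]; last exact: kO.
have [e e0 eO] := (SL2_openP O).1 oO g Og.
have [n] := @ltr_add_invr R 0 (e / 2) (divr_gt0 e0 (ltr0n _ 2)).
rewrite add0r => ne.
have n0 : 0 < n.+1%:R^-1 :> R by rewrite invr_gt0.
have [d dE] : exists d : R, d = n.+1%:R^-1 by exists n.+1%:R^-1.
rewrite -dE in ne n0.
have ex i j : exists q : rat, `|\val g i j - ratr q| < d.
  have lt : \val g i j - d < \val g i j + d by lra.
  have [q] := rat_in_itvoo lt.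
  rewrite in_itv /= => /andP[q1 q2]; exists q; rewrite ltr_norml; apply/andP; split; lra.
have [q Hq] := choice (fun ij : 'I_2 * 'I_2 => ex ij.1 ij.2).
exists (\matrix_(i, j) q (i, j), n) => /=; last by move=> i j; rewrite /= -dE mxE; exact: (Hq (i, j)).
move=> x /= xq; apply: eO => i j.
have := xq i j; have := Hq (i, j); rewrite mxE /= -dE !ltr_norml.
move=> /andP[? ?] /andP[? ?]; apply/andP; split; lra.
Qed.

End SL2_topology.

Section SL2_continuity.
Context {R : realType}.
Implicit Types g x y : SL2 R.

Lemma entry_continuous i j : continuous (fun g : SL2 R => \val g i j).
Proof.
move=> g A /nbhs_ballP[e e0 eA]; apply/SL2_nbhsP; exists e => // x xg.
by apply: eA; rewrite /ball /= distrC; exact: xg.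
Qed.

Lemma SL2_continuous (X : topologicalType) (F : X -> SL2 R) :
  (forall i j, continuous (fun x : X => \val (F x) i j)) -> continuous F.
Proof.
move=> cF x A /SL2_nbhsP[e e0 eA].
have nF i j : \forall y \near x, `|\val (F y) i j - \val (F x) i j| < e.
  have /cvgrPdist_lt := cF i j x => /(_ e e0).
  by apply: filterS => y; rewrite distrC.
near=> y; apply: eA => i j; move: i j.
apply: forall_I2; apply: forall_I2; near: y; exact: nF.
Unshelve. all: by end_near. Qed.

Lemma continuous_SL2_mul (X : topologicalType) (F G : X -> SL2 R) :
  continuous F -> continuous G -> continuous (fun x : X => (F x * G x)%g).
Proof.
move=> cF cG; apply: SL2_continuous => i j x; under eq_fun do rewrite SL2_mulE.
have e k l (H : X -> SL2 R) : continuous H ->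
    (fun y : X => \val (H y) k l) @ x --> \val (H x) k l.
  move=> cH; exact: (@continuous_comp _ _ _ H (fun g : SL2 R => \val g k l) x
    (cH x) (@entry_continuous k l (H x))).
by apply: cvgD; apply: cvgM; exact: e.
Qed.

Lemma continuous_SL2_inv : continuous (fun g : SL2 R => (g^-1)%g).
Proof.
have e i j x : (fun y : SL2 R => - \val y i j) @ x --> - \val x i j.
  exact: (cvgN (@entry_continuous i j x)).
apply: SL2_continuous; apply: forall_I2; apply: forall_I2 => x;
  under eq_fun do rewrite SL2_invE mxE /=.
- exact: entry_continuous.
- exact: e.
- exact: e.
- exact: entry_continuous.
Qed.

Lemma SL2_mull_continuous g : continuous (fun x : SL2 R => (g * x)%g).
Proof.
have c : continuous (fun _ : SL2 R => g) by exact: cst_continuous.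
by apply: (continuous_SL2_mul c) => x; exact: cvg_id.
Qed.

Lemma SL2_mulr_continuous g : continuous (fun x : SL2 R => (x * g)%g).
Proof.
have c : continuous (fun _ : SL2 R => g) by exact: cst_continuous.
by apply: continuous_SL2_mul c => x; exact: cvg_id.
Qed.

(** For each cell contained in some [W h], one such [h] is kept; there are countably many cells, and
    every point lies in a cell contained in its own [W g]. *)
Lemma SL2_lindelof (W : SL2 R -> set (SL2 R)) :
  (forall g, open (W g)) -> (forall g, W g g) ->
  exists u : nat -> SL2 R, \bigcup_n W (u n) = [set: SL2 R].
Proof.
move=> oW Wg.
have ex (k : 'M[rat]_2 * nat) : exists g, (exists h, SL2_cell k `<=` W h) ->
    SL2_cell k `<=` W g.
  have [[h kh]|nk] := pselect (exists h : SL2 R, SL2_cell k `<=` W h); first by exists h.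
  by exists 1%g => /nk.
have [f fP] := choice ex.
exists (fun n => if unpickle n is Some k then f k else 1%g).
apply/seteqP; split=> // g _.
have := SL2_open_bigcup (oW g) => WE; have := Wg g; rewrite {1}WE => -[k kW kg].
by exists (pickle k) => //; rewrite pickleK; apply: (fP k) kg; exists g.
Qed.

(** In the coordinates [psi] the set is a compact cube cut by the closed condition [ad - bc = 1]. A
    cluster point of the coordinates thus has determinant 1 and is a cluster point in the group. *)
Lemma SL2_bounded_compact (M : R) :
  compact [set g : SL2 R | forall i j, `|\val g i j| <= M].
Proof.
move=> F FF FM.
pose psi (g : SL2 R) := (\val g 0 0, \val g 0 1, (\val g 1 0, \val g 1 1)).
pose I := `[-M, M]%classic.
have cI : compact ((I `*` I) `*` (I `*` I)).
  by do !apply: compact_setX; exact: segment_compact.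
pose D : set (R * R * (R * R)) := [set p | p.1.1 * p.2.2 - p.1.2 * p.2.1 = 1].
have cD : closed D.
  have f1 (S : topologicalType) (p : S * S) : (fun q : S * S => q.1) @ p --> p.1.
    by move=> A nA; exists (A, setT) => [|q []//]; split=> //; exact: filterT.
  have f2 (S : topologicalType) (p : S * S) : (fun q : S * S => q.2) @ p --> p.2.
    by move=> A nA; exists (setT, A) => [|q []//]; split=> //; exact: filterT.
  have c11 p := continuous_comp (@f1 _ p) (@f1 R _).
  have c12 p := continuous_comp (@f1 _ p) (@f2 R _).
  have c21 p := continuous_comp (@f2 _ p) (@f1 R _).
  have c22 p := continuous_comp (@f2 _ p) (@f2 R _).
  have c (p : R * R * (R * R)) : (fun q : R * R * (R * R) =>
      q.1.1 * q.2.2 - q.1.2 * q.2.1) @ p --> p.1.1 * p.2.2 - p.1.2 * p.2.1.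
    exact: (cvgB (cvgM (c11 p) (c22 p)) (cvgM (c12 p) (c21 p))).
  have := @preimage_closed _ _ (fun p : R * R * (R * R) =>
    p.1.1 * p.2.2 - p.1.2 * p.2.1) [set 1] (fun p _ => c p).
  by apply; apply: accessible_closed_set1; apply: hausdorff_accessible; exact: Rhausdorff.
have cK := compact_closedI cI cD.
have FK : (psi @ F) ((I `*` I) `*` (I `*` I) `&` D).
  apply: (@filterS _ F _ _ _ _ FM) => g gM; split.
    by rewrite /I /=; split; split; rewrite /= in_itv /= -ler_norml; exact: gM.
  by rewrite /D/= SL2_detE.
have [p [[pI pD] pF]] := cK _ _ FK.
have dp : \det (mx2 p.1.1 p.1.2 p.2.1 p.2.2) = 1 by rewrite det_mx2.
exists (SL2_of dp); split.
  case: pI => -[] /=; rewrite /I /= !in_itv /= -!ler_norml => ? ? [] ? ?.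
  by apply: forall_I2; apply: forall_I2; rewrite mxE.
move=> A B FA /SL2_nbhsP[e e0 eB].
have FA' : (psi @ F) (psi @` A) by apply: (@filterS _ F _ _ _ _ FA) => g Ag; exists g.
have nB : nbhs p [set q : R * R * (R * R) | [/\ `|q.1.1 - p.1.1| < e,
    `|q.1.2 - p.1.2| < e, `|q.2.1 - p.2.1| < e & `|q.2.2 - p.2.2| < e]].
  exists (ball p.1 e, ball p.2 e); first by split; exact: nbhsx_ballx.
  by move=> q [[/= ? ?] [/= ? ?]]; split; rewrite distrC.
have [_ [[g Ag <-] [? ? ? ?]]] := pF _ _ FA' nB.
exists g; split=> //; apply: eB.
by apply: forall_I2; apply: forall_I2; rewrite /= [in X in _ - X]mxE.
Qed.

End SL2_continuity.

Section SL2_measurability.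
Context {R : realType}.
Local Notation G := (borel (SL2 R)).

Lemma open_measurable_SL2 (B : set (SL2 R)) : open B -> measurable (B : set G).
Proof. by move=> oB; exact: sub_sigma_algebra. Qed.

Lemma measurable_entry i j : measurable_fun setT (fun g : G => \val (g : SL2 R) i j).
Proof.
apply: (measurability _ (measurable_realfun.RGenOpens.measurableE R)) => _ [B [a [b -> <-]]].
rewrite setTI; apply: open_measurable_SL2; apply: open_comp => [g _|]; last exact: interval_open.
exact: entry_continuous.
Qed.

(** An open set is a countable union of cells, and the preimage of a cell is a finite intersection
    of conditions on entries. This gives joint measurability of the group operations for product
    sigma-algebras. *)
Lemma measurable_SL2 d (X : measurableType d) (F : X -> G) :
  (forall i j, measurable_fun setT (fun x : X => \val (F x : SL2 R) i j)) ->
  measurable_fun setT F.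
Proof.
move=> mF; apply: (@measurability _ _ X G setT F (@open (SL2 R))) => // _ [B oB <-].
rewrite setTI (SL2_open_bigcup oB) preimage_bigcup.
rewrite bigcup_mkcond; apply: countable_bigcupT_measurable => [|k]; first exact: countableP.
case: ifPn => // _.
have -> : F @^-1` SL2_cell k =
    \bigcap_(ij in [set: 'I_2 * 'I_2]) (fun x : X => \val (F x : SL2 R) ij.1 ij.2) @^-1`
       (ball (ratr (k.1 ij.1 ij.2) : R) k.2.+1%:R^-1).
  apply/seteqP; split=> [x xk [i j] _ /=|x xk i j].
    by rewrite /ball /= distrC; exact: xk.
  by have := xk (i, j) I; rewrite /= /ball /= distrC.
apply: fin_bigcap_measurable => // -[i j] _.
rewrite -[X in measurable X]setTI; apply: (mF i j) => //; by rewrite ball_itv; exact: measurable_itv.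
Qed.

End SL2_measurability.

(** * Affine isomorphisms of translation surfaces *)

Lemma finite_set_eps (R : realFieldType) (I : choiceType) (A : set I) (P : I -> R -> Prop) :
  finite_set A -> (forall i e e', 0 < e' -> e' <= e -> P i e -> P i e') ->
  (forall i, A i -> exists2 e, 0 < e & P i e) ->
  exists2 e, 0 < e & forall i, A i -> P i e.
Proof.
move=> /finite_seqP[s ->] Pmono; elim: s => [|i s IH] Pe; first by exists 1.
have [|e e0 Pse] := IH; first by move=> j js; apply: Pe; rewrite /= inE js orbT.
have [|d d0 Pd] := Pe i; first by rewrite /= inE eqxx.
have m0 : 0 < Num.min e d by rewrite lt_min e0.
exists (Num.min e d) => // j /=; rewrite inE => /orP[/eqP ->|js].
  by apply: Pmono Pd => //; rewrite ge_min lexx orbT.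
by apply: Pmono (Pse _ js) => //; rewrite ge_min lexx.
Qed.

Section LocalPrimitive.
Context {R : realType} (w : translation_surface R).
Implicit Types (p q : pieces w) (e : sides (nside w)).

Lemma pieces_eq p q : tag p = tag q -> pos p = pos q -> p = q.
Proof.
case: p q => i x [j y] /= ij; subst j; rewrite /pos /= => xy.
by congr existT; exact: val_inj.
Qed.

Lemma pieces_nbhsP p (A : set (pieces w)) :
  nbhs p A <-> exists2 e : R, 0 < e &
    forall q, tag q = tag p -> `|pos q - pos p| < e -> A q.
Proof.
case: p => i x; split.
  move=> [_ [[B oB <-] Bx BA]]; have : nbhs (\val x) B by exact: open_nbhs_nbhs.
  rewrite -nbhs_ballE => -[e /= e0 eB]; exists e => // -[j y] /= ji; subst j => xy.
  by apply: BA; apply: eB; rewrite -ball_normE /= distrC.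
move=> [e e0 eA]; have : nbhs x [set y | A (existT _ i y)]; last by [].
rewrite nbhsE; exists [set y : polygon (vertex w i) | (ball (\val x) e)° (\val y)].
  split; first by exists (ball (\val x) e)°; [exact: open_interior|].
  by rewrite /mkset /interior; exact: nbhsx_ballx.
move=> y /interior_subset xy; apply: eA => //.
by move: xy; rewrite -ball_normE /= distrC.
Qed.

Lemma pr_eqP p q : pr p = pr q <-> clos_refl_sym_trans _ (@glued _ w) p q.
Proof.
split=> [/eqquotP/asboolP//|pq].
by apply/eqquotP; apply/asboolP.
Qed.

Lemma pr_repr (y : surface w) : pr (repr y) = y.
Proof. exact: reprK. Qed.

Lemma side_in_polygon e t : 0 <= t <= 1 -> polygon (vertex w (tag e)) (side_pt e t).
Proof. by move=> t01; left; exists (tagged e), t. Qed.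

Definition side_piece e t (t01 : 0 <= t <= 1) : pieces w :=
  existT (fun i => polygon (vertex w i)) (tag e)
    (exist _ (side_pt e t) (mem_set (side_in_polygon e t01))).

Lemma glued_side e t (t01 : 0 <= t <= 1) (t01' : 0 <= 1 - t <= 1) :
  glued (side_piece e t01) (side_piece (mate w e) t01').
Proof. by exists e, t. Qed.

Lemma glued_sym p q : glued p q -> glued q p.
Proof.
move=> [e [t [/andP[t0 t1] pe pt qe qt]]].
exists (mate w e), (1 - t); rewrite mateK subKr; split=> //.
by rewrite subr_ge0 t1 gerBl t0.
Qed.

Lemma side_inj e e' (s t : R) : tag e = tag e' -> 0 <= s < 1 -> 0 <= t < 1 ->
  side_pt e s = side_pt e' t -> e = e' /\ s = t.
Proof.
case: e e' => i k [j l] /= ij; subst j => s1 t1 st.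
by have [/= -> ->] := @vertex_simple _ w i _ _ _ _ s1 t1 st.
Qed.

Lemma side_pt_inj e (s t : R) : side_pt e s = side_pt e t -> s = t.
Proof.
rewrite /side_pt /edge_pt => /addrI st; apply/eqP; rewrite -subr_eq0.
apply: contraT => st0.
have /eqP : (s - t) *: edge_vec (vertex w (tag e)) (tagged e) = 0.
  by rewrite scalerBl st subrr.
rewrite scaler_eq0 (negbTE st0) /= => /eqP e0.
have [|||_ /eqP] := @side_inj e e 0 2^-1 erefl.
- by rewrite lexx ltr01.
- by apply/andP; split; lra.
- by rewrite /side_pt /edge_pt e0 !scaler0.
by rewrite eq_sym invr_eq0 pnatr_eq0.
Qed.

Lemma side_pt1 e : side_pt e 1 =
  side_pt (existT (fun i => 'I_(nside w i)) (tag e) (ordS (tagged e))) 0.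
Proof. by rewrite /side_pt /edge_pt /edge_vec scale1r scale0r addr0 addrC subrK. Qed.

Let le011 : 0 <= (0 : R) <= 1. Proof. by rewrite lexx ler01. Qed.

Let vertices : set (pieces w) := [set side_piece e le011 | e in setT].

Let side_vertex q e t : tag q = tag e -> pos q = side_pt e t -> t = 0 \/ t = 1 ->
  vertices q.
Proof.
move=> qe qt [t0|t1]; subst t; first by exists e => //; exact: pieces_eq.
rewrite side_pt1 in qt.
by eexists; [|apply: pieces_eq; last exact/esym/qt].
Qed.

Let vertices_glued p q : vertices p -> glued p q -> vertices q.
Proof.
move=> [e' _ <-] [e [t [t01 pe pt qe qt]]]; apply: side_vertex qe qt _.
have [t1|t1] := eqVneq t 1; first by left; rewrite t1 subrr.
right; have [|||_ t0] := @side_inj e' e 0 t pe.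
- by rewrite lexx ltr01.
- by move: t01 => /andP[-> tle]; rewrite lt_neqAle t1.
- by [].
by rewrite -t0 subr0.
Qed.

(* The vertices, p0 and the points glued to p0: a point which is not a vertex
   is glued to at most one other point. *)
Lemma glue_closed_finite p0 : exists S : set (pieces w),
  [/\ finite_set S, S p0 & forall p q, S p -> glued p q -> S q].
Proof.
exists (vertices `|` [set p0] `|` [set q | glued p0 q]); split.
- rewrite !finite_setU; split; first split.
  + exact/finite_image/finite_finset.
  + exact: finite_set1.
  pose Q e := [set q | exists t, [/\ pos p0 = side_pt e t,
    tag q = tag (mate w e) & pos q = side_pt (mate w e) (1 - t)]].
  apply: (@sub_finite_set _ _ [set xget p0 (Q e) | e in setT]).
    move=> q [e [t [t01 pe pt qe qt]]]; exists e => //.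
    apply: xget_unique; first by exists t.
    move=> q' [t' [pt' qe' qt']]; apply: pieces_eq; first by rewrite qe.
    by rewrite qt qt'; congr (side_pt _ (1 - _)); apply: (@side_pt_inj e); rewrite -pt.
  exact/finite_image/finite_finset.
- by left; right.
move=> p q [[vp|->] pq|p0p pq]; [by left; left; exact: vertices_glued pq|by right|].
have [vp|nvp] := pselect (vertices p); first by left; left; exact: vertices_glued pq.
left; right; move: p0p pq => [e [t [/andP[t0 t1] pe pt qe qt]]].
move=> [e1 [s [/andP[s0 s1] pe1 ps1 qe1 qs1]]].
have [||||e1E s1E] := @side_inj (mate w e) e1 (1 - t) s.
- by rewrite -qe.
- rewrite subr_ge0 t1 gtrBl lt_neqAle t0 andbT /=; apply/eqP => t00; apply: nvp.
  by apply: side_vertex qe qt _; right; rewrite -t00 subr0.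
- rewrite s0 lt_neqAle s1 andbT /=; apply/eqP => s11; apply: nvp.
  by apply: side_vertex pe1 ps1 _; right.
- by rewrite -qt.
by apply: pieces_eq; rewrite ?qe1 ?qs1 -e1E mateK// pt -s1E subKr.
Qed.

End LocalPrimitive.

Section LocalPrimitiveExists.
Context {R : realType} (w : translation_surface R).
Implicit Types (p q : pieces w) (e : sides (nside w)).

Lemma side_pt_lin e (s t : R) :
  side_pt e s - side_pt e t = (s - t) *: edge_vec (vertex w (tag e)) (tagged e).
Proof. by rewrite /side_pt /edge_pt opprD addrACA subrr add0r scalerBl. Qed.

Lemma side_closed e : closed [set side_pt e t | t in `[0, 1]%classic].
Proof.
apply: compact_closed; first exact: norm_hausdorff.
apply: continuous_compact; last exact: segment_compact.
apply: continuous_subspaceT => t.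
by apply: cvgD; [exact: cvg_cst|apply: cvgZr_tmp; exact: cvg_id].
Qed.

(* The chart near the point x: the displacement from the nearest point of a
   finite set closed under gluing. *)
Lemma local_primitive (x : surface w) : exists V phi, V x /\ @primitive R w V phi.
Proof.
have [S [finS Sx Sg]] := glue_closed_finite (repr x).
(* The factor 2 makes the discs of radius [e] around distinct points of [S] in one polygon disjoint,
   so that a nearby point determines the position of its centre. *)
pose P1 (pq : pieces w * pieces w) (e : R) := tag pq.1 = tag pq.2 ->
  pos pq.1 <> pos pq.2 -> 2 * e <= `|pos pq.1 - pos pq.2|.
have [e1 e10 sep] : exists2 e, 0 < e & forall pq, (S `*` S) pq -> P1 pq e.
  apply: finite_set_eps; first exact: finite_setX.
    move=> pq e e' e'0 ee' P t n; apply: le_trans (P t n).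
    by rewrite ler_pM2l.
  move=> [p q] /= _; have [pq|pq] := eqVneq (pos p) (pos q).
    by exists 1 => // _; rewrite /= pq.
  exists (`|pos p - pos q| / 2); first by rewrite divr_gt0// normr_gt0 subr_eq0.
  by move=> _ _ /=; rewrite mulrCA divff ?mulr1.
(* A side coming closer than [eps] to a point of [S] in the same polygon contains that point. *)
pose P2 (pe : pieces w * sides (nside w)) (eps : R) := tag pe.2 = tag pe.1 ->
  forall t, 0 <= t <= 1 -> `|side_pt pe.2 t - pos pe.1| < eps ->
  exists2 t', 0 <= t' <= 1 & pos pe.1 = side_pt pe.2 t'.
have [e2 e20 near_side] : exists2 eps, 0 < eps & forall pe, (S `*` setT) pe -> P2 pe eps.
  apply: finite_set_eps; first by apply: finite_setX => //; exact: finite_finset.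
    move=> pe e e' e'0 ee' P te t t01 d; apply: (P te t) => //.
    exact: lt_le_trans ee'.
  move=> [p e] /= _.
  have [[t t01 tE]|np] := pselect ([set side_pt e t | t in `[0, 1]%classic] (pos p)).
    exists 1 => // te t' _ _; exists t; last exact/esym.
    by move: t01; rewrite /= in_itv.
  have : nbhs (pos p) (~` [set side_pt e t | t in `[0, 1]%classic]).
    by apply: open_nbhs_nbhs; split => //; exact/closed_openC/side_closed.
  rewrite -nbhs_ballE => -[r /= r0 rS]; exists r => // te t t01 /= d.
  exfalso; apply: (rS (side_pt e t)); first by rewrite -ball_normE /= distrC.
  by exists t => //=; rewrite in_itv.
pose e := Num.min e1 e2.
have e0 : 0 < e by rewrite lt_min e10.
have ee1 : e <= e1 by rewrite ge_min lexx.
have ee2 : e <= e2 by rewrite ge_min lexx orbT.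
pose N p q := tag q = tag p /\ `|pos q - pos p| < e.
(* Crossing a side: if [q], near [p], lies on a side, so does [p], at a possibly different
   parameter. The gluing translates both alike, so the displacement from the centre does not
   change. *)
have step p q q' : S p -> N p q -> glued q q' ->
    exists p', [/\ S p', N p' q' & pos q' - pos p' = pos q - pos p].
  move=> Sp [tq dq] [f [t [t01 qf qt q'f q't]]].
  have [||t' t'01 pt'] := near_side (p, f) (conj Sp I) _ t t01.
  - by rewrite /= -tq qf.
  - by rewrite /= -qt; exact: lt_le_trans ee2.
  have t1' : 0 <= 1 - t' <= 1 by apply/andP; split; lra.
  have pE : p = side_piece f t'01 by apply: pieces_eq => //=; rewrite -tq qf.
  have dE : pos q' - side_pt (mate w f) (1 - t') = pos q - pos p.
    rewrite q't qt /= pt' !side_pt_lin mate_opp scalerN -scaleNr; congr (_ *: _).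
    ring.
  exists (side_piece (mate w f) t1'); split.
  - by apply: (Sg p) => //; rewrite pE; exact: glued_side.
  - by split=> //; rewrite [X in `|_ - X|]/pos/= dE.
  - exact: dE.
have chain q q' : pr q = pr q' -> forall p, S p -> N p q ->
    exists p', [/\ S p', N p' q' & pos q' - pos p' = pos q - pos p].
  move=> /pr_eqP qq'.
  suff : (forall p, S p -> N p q ->
    exists p', [/\ S p', N p' q' & pos q' - pos p' = pos q - pos p]) /\
    (forall p, S p -> N p q' ->
    exists p', [/\ S p', N p' q & pos q - pos p' = pos q' - pos p]) by case.
  elim: qq' => {q q'} [q q' qq'|q|q q' _ [h1 h2]|q q' q2 _ [h1 h2] _ [h3 h4]].
  - split=> p Sp Np; first exact: step Sp Np qq'.
    exact: step Sp Np (glued_sym qq').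
  - by split=> p Sp Np; exists p.
  - by [].
  - split=> p Sp Np.
      have [p1 [Sp1 Np1 E1]] := h1 p Sp Np.
      by have [p2 [Sp2 Np2 E2]] := h3 p1 Sp1 Np1; exists p2; rewrite E2.
    have [p1 [Sp1 Np1 E1]] := h4 p Sp Np.
    by have [p2 [Sp2 Np2 E2]] := h2 p1 Sp1 Np1; exists p2; rewrite E2.
have uniq p p' q : S p -> S p' -> N p q -> N p' q -> pos p = pos p'.
  move=> Sp Sp' [tq dq] [tq' dq']; apply: contrapT => pp'.
  have := sep (p, p') (conj Sp Sp') _ pp'; rewrite /= -tq -tq' => /(_ erefl).
  apply/negP; rewrite -ltNge.
  have -> : pos p - pos p' = (pos q - pos p') - (pos q - pos p).
    by rewrite opprB [RHS]addrC addrA subrK.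
  apply: le_lt_trans (ler_normB _ _) _.
  rewrite mulr_natl mulr2n; apply: ltrD; exact: lt_le_trans ee1.
pose V := [set y : surface w | exists2 p, S p & N p (repr y)].
(* Several centres may qualify, but by [uniq] they share their position, which is all that [phi]
   uses. The default [repr x] matters only outside [V]. *)
pose c (y : surface w) := xget (repr x) [set p | S p /\ N p (repr y)].
pose phi (y : surface w) := pos (repr y) - pos (c y).
have phiE p q : S p -> N p q -> V (pr q) /\ phi (pr q) = pos q - pos p.
  move=> Sp Np; have [|p' [Sp' Np' E]] := chain q (repr (pr q)) _ p Sp Np.
    by rewrite pr_repr.
  have Vq : V (pr q) by exists p'.
  split=> //; rewrite -E /phi; congr (_ - _); rewrite /c.
  by case: xgetP => [p2 _ [Sp2 Np2]|/(_ p')[]//]; exact: uniq Np2 Np'.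
have VP q : V (pr q) -> exists2 p, S p & N p q.
  move=> [p Sp Np]; have [|p' [Sp' Np' _]] := chain _ q _ p Sp Np.
    by rewrite pr_repr.
  by exists p'.
have near_N p q : N p q -> nbhs q [set q' | N p q'].
  move=> [tq dq]; apply/pieces_nbhsP; exists (e - `|pos q - pos p|); first by rewrite subr_gt0.
  move=> q' tq' dq'; split; first by rewrite tq'.
  rewrite -[pos q'](subrK (pos q)) -addrA; apply: le_lt_trans (ler_normD _ _) _.
  by rewrite -ltrBrDr.
exists V, phi; split.
  exists (repr x) => //; split=> //; by rewrite subrr normr0.
split.
  suff : open ((@pr _ w) @^-1` V) by [].
  rewrite openE => q /VP[p Sp Np]; apply: (@filterS _ (nbhs q)) (near_N p q Np).
  by move=> q' Np'; exact: (phiE p q' Sp Np').1.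
move=> q /VP[p Sp Np]; apply: (@filterS _ (nbhs q)) (near_N p q Np).
move=> q' Np'; rewrite (phiE p q Sp Np).2 (phiE p q' Sp Np').2.
by rewrite opprB addrA subrK.
Qed.

End LocalPrimitiveExists.

Section AffineIso.
Context {R : realType}.
Implicit Types (w : translation_surface R) (g h : SL2 R).

Definition pull_primitive (A : 'M[R]_2) w w' (f : surface w -> surface w') :=
  forall V phi, primitive V phi -> primitive (f @^-1` V) (fun x => A *m phi (f x)).

(** The homeomorphism [f] has linear part [g]: a primitive on [w], carried over by [f'], becomes a
    primitive on [w'] after multiplication by [g]. Both directions are recorded, so that inverses
    and composites are formal. *)
Definition affine_iso g w w' : Prop :=
  exists (f : surface w -> surface w') (f' : surface w' -> surface w),
    [/\ continuous f, continuous f', cancel f f' & cancel f' f] /\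
    pull_primitive (\val g) f' /\ pull_primitive (\val (g^-1)%g) f.

Lemma affine_iso_sym g w w' : affine_iso g w w' -> affine_iso (g^-1)%g w' w.
Proof.
move=> [f [f' [[cf cf' fK f'K] [pf' pf]]]]; exists f', f.
by split; [split|rewrite invgK; split].
Qed.

Lemma pull_primitive_comp (A B : 'M[R]_2) w w' w2
    (f : surface w -> surface w') (f2 : surface w' -> surface w2) :
  pull_primitive A f -> pull_primitive B f2 -> pull_primitive (A *m B) (f2 \o f).
Proof.
move=> pf pf2 V phi pV; have := pf _ _ (pf2 _ _ pV).
by under eq_fun do rewrite mulmxA.
Qed.

Lemma affine_iso_comp g h w w' w2 :
  affine_iso g w w' -> affine_iso h w' w2 -> affine_iso (h * g)%g w w2.
Proof.
move=> [f [f' [[cf cf' fK f'K] [pf' pf]]]] [k [k' [[ck ck' kK k'K] [pk' pk]]]].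
exists (k \o f), (f' \o k'); split; first split.
- by move=> x; exact: (@continuous_comp _ _ _ f k x (cf x) (ck _)).
- by move=> x; exact: (@continuous_comp _ _ _ k' f' x (ck' x) (cf' _)).
- by move=> x /=; rewrite kK fK.
- by move=> x /=; rewrite f'K k'K.
split; first exact: pull_primitive_comp.
by rewrite invgM; exact: pull_primitive_comp.
Qed.

Lemma pr_continuous w : continuous (@pr R w).
Proof. exact: pi_continuous. Qed.

Lemma surface_openP w (V : set (surface w)) : open V <-> open ((@pr R w) @^-1` V).
Proof. by []. Qed.

(* Two primitives differ by a locally constant function, so it is enough to
   pull back the primitives of one of the two surfaces. *)
Lemma isomorphic_affine w w' : isomorphic w w' -> affine_iso 1%g w w'.
Proof.
move=> [f [f' [cf cf' fK f'K pf]]]; exists f, f'; split; first by split.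
split; last first.
  move=> V phi pV; rewrite invg1; have := pf V phi pV.
  by under [X in _ -> primitive _ X]eq_fun do rewrite mul1mx.
move=> V phi [oV pV].
under [X in primitive _ X]eq_fun do rewrite mul1mx.
split; first by apply: open_comp => // x _; exact: cf'.
move=> p' Vp'.
have [W [psi [Wp' pW]]] := local_primitive (pr p').
have [oW' pW'] := pf _ _ pW; have [oW pWW] := pW.
pose c (y : surface w) := phi y - psi (f y).
pose y0 := f' (pr p').
pose A := [set y : surface w | [/\ V y, W (f y) & c y = c y0]].
have oA : open A.
  apply/surface_openP; rewrite openE => q [Vq Wq cq].
  have := pW' q Wq => n1; have := pV q Vq => n2.
  have n3 : nbhs q ((@pr R w) @^-1` (V `&` f @^-1` W)).
    apply: open_nbhs_nbhs; split; last by [].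
    by apply: open_comp => [? _|]; [exact: pr_continuous|exact: openI].
  apply: (@filterS _ (nbhs q)) (filterI n1 (filterI n2 n3)) => q' [e1 [e2 [Vq' Wq']]].
  split=> //; rewrite -cq /c; apply/eqP; rewrite -subr_eq0; apply/eqP.
  have -> (a b a' b' : 'cV[R]_2) : a - b - (a' - b') = (a - a') - (b - b').
    by rewrite !opprD !opprK addrACA.
  by move: e1 e2 => /= -> ->; rewrite subrr.
have nA : nbhs p' [set q' : pieces w' | A (f' (pr q'))].
  have : nbhs (pr p') (f' @^-1` A).
    apply: open_nbhs_nbhs; split; first by apply: open_comp => // x _; exact: cf'.
    by split=> //; rewrite f'K.
  exact: (@pr_continuous w' p').
apply: (@filterS _ (nbhs p')) (filterI nA (pWW p' Wp')) => q' [[_ _ cq'] e].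
move: cq'; rewrite /c /y0 !f'K => /eqP; rewrite subr_eq => /eqP ->.
rewrite -e -addrA [LHS]addrAC; congr (_ + _).
by rewrite addrC subrK.
Qed.

Lemma affine_isomorphic w w' : affine_iso 1%g w w' -> isomorphic w w'.
Proof.
move=> [f [f' [[cf cf' fK f'K] [_ pf]]]]; exists f, f'; split => // V phi pV.
have := pf V phi pV; rewrite invg1.
by under [X in primitive _ X]eq_fun do rewrite mul1mx.
Qed.

Section Lift.
Variables (A B : 'M[R]_2) (w w' : translation_surface R).
Variable F : pieces w -> pieces w'.
Hypothesis BA : B *m A = 1%:M.
Hypothesis F_tag : forall p q, tag p = tag q -> tag (F p) = tag (F q).
Hypothesis F_pos : forall p, pos (F p) = A *m pos p.
Hypothesis F_glued : forall p q, glued p q -> glued (F p) (F q).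

Definition lift_pieces (x : surface w) : surface w' := pr (F (repr x)).

Lemma lift_pr p : lift_pieces (pr p) = pr (F p).
Proof.
rewrite /lift_pieces; move: (repr (pr p)) (pr_repr (pr p)) => r /pr_eqP rp.
apply/pr_eqP; elim: rp => [x y xy|x|x y _|x y z _ h1 _ h2].
- by apply: rst_step; exact: F_glued.
- exact: rst_refl.
- exact: rst_sym.
- exact: rst_trans h2.
Qed.

Lemma F_continuous : continuous F.
Proof.
have [M M0 AM] := mulmx_bounded A.
move=> p C /pieces_nbhsP[e e0 eC]; apply/pieces_nbhsP.
exists (e / (M + 1)); first by rewrite divr_gt0// ltr_wpDl.
move=> q qp d; apply: eC; first exact: F_tag.
rewrite !F_pos -mulmxBr; apply: (le_lt_trans (AM _)).
apply: (@le_lt_trans _ _ ((M + 1) * `|pos q - pos p|)).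
  by apply: ler_wpM2r => //; rewrite lerDl.
by rewrite mulrC -ltr_pdivlMr// ltr_wpDl.
Qed.

Lemma lift_continuous : continuous lift_pieces.
Proof.
apply/continuousP => V oV; apply/surface_openP.
have -> : (@pr R w) @^-1` (lift_pieces @^-1` V) = (@pr R w' \o F) @^-1` V.
  by apply/seteqP; split=> p /=; rewrite lift_pr.
apply: open_comp => // p _; apply: continuous_comp; first exact: F_continuous.
exact: pr_continuous.
Qed.

Lemma lift_primitive : pull_primitive B lift_pieces.
Proof.
move=> V phi [oV pV]; split; first by apply: open_comp => // x _; exact: lift_continuous.
move=> p; rewrite /= lift_pr => Vp; have := @F_continuous p _ (pV _ Vp).
apply: (@filterS _ (nbhs p)) => q /= e.
by rewrite !lift_pr -mulmxBr e !F_pos -mulmxBr mulmxA BA mul1mx.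
Qed.

End Lift.

Lemma affine_iso_act g w : affine_iso g w (act g w).
Proof.
pose F (p : pieces w) : pieces (act g w) :=
  existT (fun i => polygon (vertex (act g w) i)) (tag p) (exist _ (\val g *m pos p)
    (mem_set ((polygon_mul g (vertex w (tag p)) (pos p)).2 (set_mem (valP (tagged p)))))).
have F'P (p : pieces (act g w)) : polygon (vertex w (tag p)) (invmx (\val g) *m pos p).
  by apply/(polygon_mul g); rewrite SL2_mulVKmx; exact: set_mem (valP (tagged p)).
pose F' (p : pieces (act g w)) : pieces w :=
  existT (fun i => polygon (vertex w i)) (tag p)
    (exist _ (invmx (\val g) *m pos p) (mem_set (F'P p))).
have gF p q : glued p q -> glued (F p) (F q).
  move=> [e [t [t01 pe pt qe qt]]]; exists e, t; split=> //.
    by rewrite [LHS]/pos/= pt /side_pt edge_pt_mul.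
  by rewrite [LHS]/pos/= qt /side_pt edge_pt_mul.
have gF' p q : glued p q -> glued (F' p) (F' q).
  move=> [e [t [t01 pe pt qe qt]]]; exists e, t; split=> //.
    by rewrite [LHS]/pos/= pt /side_pt edge_pt_mul SL2_mulKmx.
  by rewrite [LHS]/pos/= qt /side_pt edge_pt_mul SL2_mulKmx.
exists (lift_pieces F), (lift_pieces F'); split; first split.
- by apply: (@lift_continuous (\val g)).
- by apply: (@lift_continuous (invmx (\val g))).
- move=> x; rewrite /lift_pieces -/(lift_pieces F' _) lift_pr// -[RHS]pr_repr.
  by congr pr; apply: pieces_eq => //; rewrite [LHS]/pos/= SL2_mulKmx.
- move=> x; rewrite /lift_pieces -/(lift_pieces F _) lift_pr// -[RHS]pr_repr.
  by congr pr; apply: pieces_eq => //; rewrite [LHS]/pos/= SL2_mulVKmx.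
split.
  by apply: (@lift_primitive (invmx (\val g))) => //; rewrite mulmxV ?SL2_unit.
by apply: (@lift_primitive (\val g)) => //; rewrite mulVmx ?SL2_unit.
Qed.

End AffineIso.

Section AffineHolonomy.
Context {R : realType}.
Implicit Types (w : translation_surface R) (g h : SL2 R).

Lemma affine_flat_chart (A : 'M[R]_2) w w' (f : surface w -> surface w') V phi :
  A \in unitmx -> injective f -> pull_primitive A f -> flat_chart V phi ->
  flat_chart (f @^-1` V) (fun x => A *m phi (f x)).
Proof.
move=> uA finj pf [pV iV]; split; first exact: pf.
move=> x y /set_mem xV /set_mem yV /(congr1 (mulmx (invmx A))).
rewrite !mulmxA mulVmx// !mul1mx => xy; apply: finj.
by apply: iV => //; exact: mem_set.
Qed.

(** Zeros and geodesics are defined through flat charts, and an affine isomorphism carries flat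
    charts to flat charts in both directions, their coordinates being multiplied by the linear
    part. *)
Lemma affine_holonomy g w w' z :
  affine_iso g w w' -> holonomy_vectors w z -> holonomy_vectors w' (\val g *m z).
Proof.
move=> [f [f' [[cf cf' fK f'K] [pf' pf]]]] [gam [sg hg]].
have finj := can_inj fK; have f'inj := can_inj f'K.
have ch V phi : flat_chart V phi -> flat_chart (f @^-1` V) (fun x => \val (g^-1)%g *m phi (f x)).
  by apply: affine_flat_chart => //; exact: SL2_unit.
have ch' V phi : flat_chart V phi -> flat_chart (f' @^-1` V) (fun x => \val g *m phi (f' x)).
  by apply: affine_flat_chart => //; exact: SL2_unit.
have zf x : Defs.zero x -> Defs.zero (f x).
  move=> zx [V [phi [Vx cV]]]; apply: zx.
  by exists (f @^-1` V), (fun x => \val (g^-1)%g *m phi (f x)); split=> //; exact: ch.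
have zf' x : Defs.zero (f x) -> Defs.zero x.
  move=> zx [V [phi [Vx cV]]]; apply: zx.
  exists (f' @^-1` V), (fun x => \val g *m phi (f' x)); split; last exact: ch'.
  by rewrite /= fK.
exists (f \o gam); split.
  case: sg => cg z0 z1 nz geo; split.
  - by move=> t V nV; exact: cg t _ (cf _ _ nV).
  - exact: zf.
  - exact: zf.
  - by move=> t t01 /zf'; exact: nz.
  - move=> t t01; have [V [phi [v [cV Vt v0 n]]]] := geo t t01.
    exists (f' @^-1` V), (fun x => \val g *m phi (f' x)), (\val g *m v); split.
    + exact: ch'.
    + by rewrite /= fK.
    + apply: contra v0 => /eqP gv; rewrite -[v](SL2_mulKmx g) gv mulmx0.
      exact: eqxx.
    + apply: (@filterS _ (nbhs t)) n => s /= [Vs e]; rewrite !fK; split=> //.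
      by rewrite -mulmxBr e scalemxAr.
case: hg => F [-> hF]; exists (fun t => \val g *m F t); split; first by rewrite mulmxBr.
move=> t t01; have [V [phi [pV Vt n]]] := hF t t01.
exists (f' @^-1` V), (fun x => \val g *m phi (f' x)); split.
- exact: pf'.
- by rewrite /= fK.
- apply: (@filterS _ (nbhs t)) n => s /= n s01; have [Vs e] := n s01.
  by rewrite /= !fK -!mulmxBr e.
Qed.

End AffineHolonomy.

Section VeechGroup.
Context {R : realType} (w : translation_surface R).
Local Open Scope group_scope.

(** Composing with the tautological affine map from [w] to [act g w] turns an isomorphism of
    [act g w] with [w] into an affine self-map of [w]. Closure under products and inverses becomes
    visible in this form. *)
Lemma veech_groupP g : veech_group w g <-> affine_iso g w w.
Proof.
split=> [/isomorphic_affine h|h].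
  by have := affine_iso_comp (affine_iso_act g w) h; rewrite mul1g.
apply: affine_isomorphic; rewrite -(mulgV g).
exact: affine_iso_comp (affine_iso_sym (affine_iso_act g w)) h.
Qed.

Lemma veech_group1 : veech_group w 1.
Proof.
apply/veech_groupP; rewrite -(mulVg 1).
exact: affine_iso_comp (affine_iso_act 1 w) (affine_iso_sym (affine_iso_act 1 w)).
Qed.

Lemma veech_groupM g h : veech_group w g -> veech_group w h -> veech_group w (g * h).
Proof.
by move=> /veech_groupP wg /veech_groupP wh; apply/veech_groupP; exact: affine_iso_comp wh wg.
Qed.

Lemma veech_groupV g : veech_group w g -> veech_group w g^-1.
Proof. by move=> /veech_groupP wg; apply/veech_groupP; exact: affine_iso_sym. Qed.

Lemma veech_group_holonomy g z : veech_group w g ->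
  holonomy_vectors w z -> holonomy_vectors w (\val g *m z).
Proof. by move=> /veech_groupP; exact: affine_holonomy. Qed.

Lemma holonomy_actE g z :
  holonomy_vectors (act g w) z <-> exists2 v, holonomy_vectors w v & z = (\val g *m v)%R.
Proof.
split=> [zg|[v wv ->]]; last exact: affine_holonomy (affine_iso_act g w) wv.
exists (invmx (\val g) *m z); last by rewrite SL2_mulVKmx.
exact: affine_holonomy (affine_iso_sym (affine_iso_act g w)) zg.
Qed.

End VeechGroup.

(** * Triangular matrices and Moebius transformations *)

Section Triangular.
Context {R : realType}.
Implicit Types (g : SL2 R) (a b : R).

Definition nonzero a : R := if a == 0 then 1 else a.

Lemma nonzero_neq0 a : nonzero a != 0.
Proof. by rewrite /nonzero; case: ifPn => //; rewrite oner_neq0. Qed.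

Lemma upper_subproof a b : \det (mx2 (nonzero a) b 0 (nonzero a)^-1) = 1.
Proof. by rewrite det_mx2 mulr0 subr0 divff// nonzero_neq0. Qed.

(* The matrix [[a, b], [0, a^-1]]; the value at a = 0 is junk. *)
Definition upper a b : SL2 R := SL2_of (upper_subproof a b).

Lemma upperE a b : a != 0 -> \val (upper a b) = mx2 a b 0 a^-1.
Proof. by rewrite /= /nonzero => /negbTE ->. Qed.

Lemma hE (s : R) : \val (h_ s) = mx2 1 0 (- s) 1.
Proof. by apply/matrixP; apply: forall_I2; apply: forall_I2; rewrite !mxE. Qed.

Lemma SL2_eq4 g (h : SL2 R) : \val g 0 0 = \val h 0 0 -> \val g 0 1 = \val h 0 1 ->
  \val g 1 0 = \val h 1 0 -> \val g 1 1 = \val h 1 1 -> g = h.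
Proof. by move=> *; apply: SL2_eqP; apply: forall_I2; apply: forall_I2. Qed.

Lemma h_add (s t : R) : h_ (s + t) = (h_ s * h_ t)%g.
Proof. by apply: SL2_eq4; rewrite !SL2_mulE !hE !mxE /=; ring. Qed.

Lemma h_0 : h_ 0 = 1%g :> SL2 R.
Proof. by apply: SL2_eq4; rewrite hE !mxE /= ?oppr0. Qed.

Lemma upper_1 : upper 1 0 = 1%g :> SL2 R.
Proof. by apply: SL2_eq4; rewrite upperE ?oner_neq0// !mxE /= ?invr1. Qed.

Lemma upper_mul a b c d : a != 0 -> c != 0 ->
  (upper a b * upper c d)%g = upper (a * c) (a * d + b * c^-1).
Proof.
move=> a0 c0; have ac : a * c != 0 by rewrite mulf_neq0.
by apply: SL2_eq4; rewrite !SL2_mulE !upperE// !mxE /=; field; rewrite ?a0 ?c0.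
Qed.

Lemma upper_h a s : a != 0 -> (upper a 0 * h_ s)%g = (h_ (s / a ^+ 2) * upper a 0)%g.
Proof.
move=> a0.
by apply: SL2_eq4; rewrite !SL2_mulE !upperE// !hE !mxE /=; field; rewrite ?a0.
Qed.

(* The double coset of the lower unipotent group through an element with a
   nonzero upper right entry is determined by that entry. *)
Lemma upper_bruhat a b : a != 0 -> b != 0 ->
  upper a b = (h_ ((1 - a^-1) / b) * upper 1 b * h_ ((1 - a) / b))%g.
Proof.
move=> a0 b0; apply: SL2_eq4;
  by rewrite !SL2_mulE !upperE ?oner_neq0// !hE !mxE /=; field; rewrite ?a0 ?b0.
Qed.

Lemma SL2_lower_upper g : \val g 1 1 != 0 ->
  g = (upper ((\val g 1 1)^-1)%R (\val g 0 1)%R * h_ (\val g 1 0 / - \val g 1 1)%R)%g.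
Proof.
move aE : (\val g 0 0) => a; move bE : (\val g 0 1) => b.
move cE : (\val g 1 0) => c; move dE : (\val g 1 1) => d d0.
have ad : a * d = 1 + b * c by have := SL2_detE g; rewrite aE bE cE dE => <-; ring.
apply: SL2_eq4; rewrite !SL2_mulE !upperE ?invr_eq0// !hE !mxE ?aE ?bE ?cE ?dE /=.
- by rewrite -[LHS](mulfK d0) ad; field; rewrite ?oppr_eq0.
- by field; rewrite ?oppr_eq0 ?d0.
- by field; rewrite ?oppr_eq0 ?d0.
- by field; rewrite ?oppr_eq0 ?d0.
Qed.

End Triangular.

Section Moebius.
Context {R : realType}.
Implicit Types (g : SL2 R) (r u v : R).

Definition denominator g u : R := \val g 1 1 - u * \val g 0 1.

Definition moebius g u : R := (u * \val g 0 0 - \val g 1 0) / denominator g u.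

(** Modulo upper triangular matrices on the left, the [h_ u] form an affine chart of the projective
    line. Right multiplication by [g] acts there by a Moebius transformation, and the triangular
    factor is its cocycle. *)
Lemma h_mul_moebius g u : denominator g u != 0 ->
  (h_ u * g)%g = (upper ((denominator g u)^-1)%R (\val g 0 1)%R * h_ (moebius g u))%g.
Proof.
rewrite /moebius /denominator; have := SL2_detE g.
move aE : (\val g 0 0) => a; move bE : (\val g 0 1) => b.
move cE : (\val g 1 0) => c; move dE : (\val g 1 1) => d.
set D := d - u * b => det D0.
apply: SL2_eq4; rewrite !SL2_mulE !upperE ?invr_eq0// !hE !mxE ?aE ?bE ?cE ?dE /= ?invrK.
- have q : (u * a - c) / D * D = u * a - c by rewrite divfK.
  apply: (mulIf D0); rewrite mul1r mul0r addr0 mulr1 mulrDl mulVf// mulrN mulNr -mulrA q.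
  by rewrite -det /D; ring.
- by rewrite mul1r mul0r addr0 mulr0 add0r mulr1.
- by rewrite mul0r add0r mulNr mul1r mulrN [D * _]mulrC divfK//; ring.
- by rewrite /D; ring.
Qed.

Lemma moebius_sub g u v : denominator g u != 0 -> denominator g v != 0 ->
  moebius g u - moebius g v = (u - v) / (denominator g u * denominator g v).
Proof.
move=> u0 v0; rewrite -[u - v]mulr1 -(SL2_detE g).
by move: u0 v0; rewrite /moebius /denominator => u0 v0; field; rewrite u0 v0.
Qed.

Lemma denominatorV g u : denominator g u != 0 ->
  denominator (g^-1)%g (moebius g u) = (denominator g u)^-1.
Proof.
move=> u0; rewrite /denominator SL2_invE !mxE /= -/(denominator g u) /moebius.
apply: (mulIf u0); rewrite mulVf// mulrBl mulrN mulNr opprK mulrAC divfK//.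
by rewrite -[RHS](SL2_detE g) /denominator; ring.
Qed.

Lemma moebiusK g u : denominator g u != 0 -> moebius (g^-1)%g (moebius g u) = u.
Proof.
move=> u0; rewrite {1}/moebius denominatorV// invrK SL2_invE !mxE /= opprK.
rewrite mulrDl mulrAC [moebius g u]/moebius divfK//.
by rewrite -[RHS]mulr1 -[X in _ = _ * X](SL2_detE g) /denominator; ring.
Qed.

Lemma SL2_box_inv r g : SL2_box 1%g r g -> SL2_box 1%g r (g^-1)%g.
Proof.
move=> gr; have h := gr; move: (h 0 0) (h 0 1) (h 1 0) (h 1 1); rewrite !SL2_mul1E !mxE /= !subr0.
move=> h00 h01 h10 h11.
by apply: forall_I2; apply: forall_I2; rewrite SL2_invE SL2_mul1E !mxE /= ?subr0 ?normrN.
Qed.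

Section CloseToIdentity.
Variables (S rho : R) (g : SL2 R).
Hypotheses (S0 : 0 <= S) (rho0 : 0 < rho) (rho2 : rho <= 2^-1).
Hypothesis g1 : SL2_box 1%g (rho / (1 + S) ^+ 2) g.

Let bounds : exists2 r : R, 0 < r & r * (1 + S) ^+ 2 = rho /\
  [/\ `|\val g 0 0 - 1| < r, `|\val g 0 1| < r, `|\val g 1 0| < r & `|\val g 1 1 - 1| < r].
Proof.
have S1 : 0 < (1 + S) ^+ 2 by rewrite exprn_gt0// ltr_pwDl.
exists (rho / (1 + S) ^+ 2); first by rewrite divr_gt0.
split; first by rewrite divfK// gt_eqF.
by move: (g1 0 0) (g1 0 1) (g1 1 0) (g1 1 1); rewrite !SL2_mul1E !mxE /= !subr0.
Qed.

Lemma upper_right_close : `|\val g 0 1| <= rho.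
Proof.
have [r r0 [rS [_ h _ _]]] := bounds; apply: le_trans (ltW h) _.
by rewrite -rS ler_peMr ?(ltW r0)// exprn_ege1// lerDl.
Qed.

Lemma denominator_close u : `|u| <= S -> `|denominator g u - 1| <= rho.
Proof.
move=> uS; have [r r0 [rS [_ hb _ hd]]] := bounds.
rewrite /denominator addrAC; apply: le_trans (ler_normB _ _) _; rewrite normrM.
have h : `|u| * `|\val g 0 1| <= S * r by apply: ler_pM => //; exact: ltW.
have h2 : 0 <= r * (S + S ^+ 2) by rewrite mulr_ge0 ?(ltW r0)// addr_ge0// sqr_ge0.
have e : rho = r + S * r + r * (S + S ^+ 2) by rewrite -rS; ring.
by rewrite e; move: (r * (S + _)) (S * r) h h2 => ? ? ? ?; lra.
Qed.

Lemma denominator_gt0 u : `|u| <= S -> 0 < denominator g u.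
Proof.
move=> uS; have := denominator_close uS; rewrite ler_norml => /andP[h _].
by move: rho2 h; lra.
Qed.

(** The numerator of the difference is a quadratic polynomial in [u] bounded by
    [r * (1 + 2 * S + S ^+ 2)], which is [rho]: this is the origin of the radius
    [rho / (1 + S) ^+ 2]. The denominator is at least 1/2. *)
Lemma moebius_close u : `|u| <= S -> `|moebius g u - u| <= 2 * rho.
Proof.
move=> uS; have D0 := denominator_gt0 uS.
have [r r0 [rS [ha hb hc hd]]] := bounds.
have -> : moebius g u - u = (u * (\val g 0 0 - 1) - \val g 1 0 -
    u * (\val g 1 1 - 1) + u * u * \val g 0 1) / denominator g u.
  apply: (mulIf (lt0r_neq0 D0)); rewrite mulrBl !divfK ?gt_eqF// /denominator; ring.
rewrite normrM normfV ler_pdivrMr ?normr_gt0 ?gt_eqF// (gtr0_norm D0).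
have h1 : `|u * (\val g 0 0 - 1)| <= S * r by rewrite normrM; apply: ler_pM => //; exact: ltW.
have h2 : `|u * (\val g 1 1 - 1)| <= S * r by rewrite normrM; apply: ler_pM => //; exact: ltW.
have h3 : `|u * u * \val g 0 1| <= S * S * r.
  by rewrite normrM; apply: ler_pM => //; [rewrite normrM; exact: ler_pM|exact: ltW].
have hD : 2^-1 <= denominator g u.
  by have := denominator_close uS; rewrite ler_norml => /andP[h _]; move: rho2 h; lra.
have hR : rho <= 2 * rho * denominator g u.
  by rewrite mulrAC -[leLHS]mul1r ler_pM2r//; lra.
apply: le_trans hR; have -> : rho = S * r + r + S * r + S * S * r by rewrite -rS; ring.
apply: le_trans (ler_normD _ _) _; apply: lerD => //.
apply: le_trans (ler_normB _ _) _; apply: lerD => //.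
by apply: le_trans (ler_normB _ _) _; apply: lerD => //; exact: ltW.
Qed.

(** The difference quotient is the inverse of a product of two denominators, each at least
    [1 - rho]. The constant 6 is the least one for which [(1 + 6 * rho) * (1 - rho) ^+ 2 >= 1] for
    all [rho] up to 1/2. *)
Lemma moebius_lipschitz u v : `|u| <= S -> `|v| <= S ->
  `|moebius g u - moebius g v| <= (1 + 6 * rho) * `|u - v|.
Proof.
move=> uS vS; have Du := denominator_gt0 uS; have Dv := denominator_gt0 vS.
rewrite moebius_sub ?gt_eqF// normrM mulrC; apply: ler_wpM2r => //.
rewrite normfV gtr0_norm ?mulr_gt0//.
have hu : 1 - rho <= denominator g u.
  by have := denominator_close uS; rewrite ler_norml => /andP[h _]; lra.
have hv : 1 - rho <= denominator g v.
  by have := denominator_close vS; rewrite ler_norml => /andP[h _]; lra.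
have r1 : 0 < 1 - rho by move: rho2; lra.
have key : 1 <= (1 + 6 * rho) * ((1 - rho) * (1 - rho)).
  have -> : (1 + 6 * rho) * ((1 - rho) * (1 - rho)) =
    1 + rho * ((1 - 2 * rho) * (4 - 3 * rho)) by ring.
  rewrite lerDl mulr_ge0 ?(ltW rho0)// mulr_ge0//; move: rho2; lra.
have D2 : (1 - rho) * (1 - rho) <= denominator g u * denominator g v.
  by apply: ler_pM => //; exact: ltW.
rewrite -[leLHS]mul1r ler_pdivrMr ?mulr_gt0//; apply: le_trans key _.
by rewrite ler_pM2l//; move: rho0; lra.
Qed.

End CloseToIdentity.
End Moebius.

(** * Perturbations of the truncated cone by triangular matrices *)

Section Cone.
Context {R : realType} (Lam : set 'cV[R]_2).
Implicit Types (g x : SL2 R) (T K a u : R).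

Definition cone T : set 'cV[R]_2 := [set z | `|z 1 0| < z 0 0 /\ z 0 0 < T].

(** For [Lam] the holonomy vectors of [w] this is the event [Psi (act g w) 1 < T]; the strict
    inequality makes it open. *)
Definition hit T : set (SL2 R) := [set g | exists2 z, Lam z & cone T (\val g *m z)].

Lemma hit_le T T' : T <= T' -> hit T `<=` hit T'.
Proof. by move=> TT g [z Lz [z1 z2]]; exists z => //; split=> //; exact: lt_le_trans TT. Qed.

Lemma entry_mulmx_continuous (z : 'cV[R]_2) i :
  continuous (fun g : SL2 R => (\val g *m z) i 0).
Proof.
move=> g; under eq_fun do rewrite mxE sum_I2.
have e k l : (fun x : SL2 R => \val x i k * z k l) @ g --> \val g i k * z k l.
  exact: (cvgM (@entry_continuous R i k g) (cvg_cst _)).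
exact: (cvgD (e 0 0) (e 1 0)).
Qed.

Lemma open_cone_preimage (z : 'cV[R]_2) T : open [set g : SL2 R | cone T (\val g *m z)].
Proof.
have c i := @entry_mulmx_continuous z i.
rewrite openE => g [g1 g2]; rewrite /interior /=.
have n1 : \forall x \near g, 0 < (\val x *m z) 0 0 - `|(\val x *m z) 1 0|.
  have cc : (fun x : SL2 R => (\val x *m z) 0 0 - `|(\val x *m z) 1 0|) @ g -->
      (\val g *m z) 0 0 - `|(\val g *m z) 1 0|.
    exact: (cvgB (c 0 g) (cvg_norm (c 1 g))).
  by have := cvgr_gt _ cc 0; apply; rewrite subr_gt0.
have n2 : \forall x \near g, (\val x *m z) 0 0 < T by have := cvgr_lt _ (c 0 g) T; apply.
near=> x; split; last by near: x.
by rewrite -subr_gt0; near: x.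
Unshelve. all: by end_near. Qed.

Lemma open_hit T : open (hit T).
Proof.
have -> : hit T = \bigcup_(z in Lam) [set g : SL2 R | cone T (\val g *m z)].
  by apply/seteqP; split=> g [z Lz gz]; exists z.
by apply: bigcup_open => z _; exact: open_cone_preimage.
Qed.

(** A vector with [|q| < p] gets the abscissa [A * p + B * q], which is at least
    [(A - |B|) * p >= p / A > |q| / A] and at most [(A + |B|) * p]. *)
Lemma hit_upper (A B : R) T T' x : 0 < A -> A^-1 + `|B| <= A -> (A + `|B|) * T <= T' ->
  hit T x -> hit T' (upper A B * x)%g.
Proof.
move=> A0 AB AT [z Lz]; rewrite /cone /= => -[z1 z2]; exists z => //.
rewrite SL2_mulmx -mulmxA; move: (\val x *m z) z1 z2 => v v1 v2.
rewrite upperE ?gt_eqF// /cone /= !mxE !sum_I2 !mxE /= mul0r add0r.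
move: (v 0 0) (v 1 0) v1 v2 => p q qp pT.
have p0 : 0 < p by exact: le_lt_trans qp.
have Bq : `|B * q| <= `|B| * p by rewrite normrM ler_wpM2l// ltW.
have h1 : `|A^-1 * q| < A^-1 * p.
  by rewrite normrM gtr0_norm ?invr_gt0// ltr_pM2l ?invr_gt0.
have h2 : (A^-1 + `|B|) * p <= A * p by rewrite ler_pM2r.
have h3 : (A + `|B|) * p < T'.
  by apply: lt_le_trans AT; rewrite ltr_pM2l// ltr_pwDl.
move: Bq; rewrite ler_norml => /andP[b1 b2].
move: h2 h3; rewrite !mulrDl => h2 h3.
move: (A * p) (B * q) (`|B| * p) (A^-1 * p) h1 b1 b2 h2 h3 => a' b' c' d' *.
by split; [apply: (@lt_le_trans _ _ d') => //|]; lra.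
Qed.

Section Transfer.
Variables (K rho S a T : R) (g : SL2 R).
Hypotheses (K1 : 1 < K) (rho0 : 0 < rho) (rhoK : 2 * (K * rho) <= K - 1) (S0 : 0 <= S).
Hypotheses (a0 : 0 < a) (a1 : a <= 1) (T0 : 0 < T).
Hypothesis g1 : SL2_box 1%g (rho / (1 + S) ^+ 2) g.

Let K0 : 0 < K. Proof. by apply: lt_trans K1. Qed.

Let rho2 : rho <= 2^-1.
Proof.
rewrite -(ler_pM2l K0); move: rhoK; lra.
Qed.

(** A matrix merely close to 1 may push a vector out of the cone. The factor [K > 1] first pulls the
    cone into its interior: [2 * K * rho <= K - 1] gives [1 + K * rho <= K * (1 - rho)], and the
    abscissa grows by at most [K + 2 * K * rho <= 2 * K - 1 <= K ^+ 2]. *)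
Let close_matrix u (B : R) x : `|u| <= S -> `|B| <= K * rho ->
  hit T x -> hit (K ^+ 2 * T) (upper (K * denominator g u) B * x)%g.
Proof.
move=> uS BK; have := denominator_close S0 rho0 g1 uS; set d := denominator g u.
rewrite ler_norml => /andP[d1 d2].
have h1 : K * (1 - rho) <= K * d by rewrite ler_pM2l//; lra.
have h2 : K * d <= K * (1 + rho) by rewrite ler_pM2l//; lra.
have A1 : 1 + K * rho <= K * d by apply: le_trans h1; rewrite mulrBr mulr1; move: rhoK; lra.
have Kr : 0 < K * rho by rewrite mulr_gt0.
have A0 : 0 < K * d by apply: lt_le_trans A1; lra.
apply: hit_upper => //.
  apply: (@le_trans _ _ (1 + K * rho)) => //; apply: lerD => //.
  by rewrite invf_le1//; apply: le_trans A1; rewrite lerDl ltW.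
rewrite ler_pM2r//; apply: (@le_trans _ _ (K * (1 + rho) + K * rho)); first exact: lerD.
have -> : K * (1 + rho) + K * rho = K + 2 * (K * rho) by ring.
have : 0 <= (K - 1) * (K - 1) by rewrite mulr_ge0//; lra.
have -> : K ^+ 2 = (K - 1) * (K - 1) + (K - 1) + K by ring.
by move: rhoK; move: ((K - 1) * _) => ? ? ?; lra.
Qed.

(** Conjugation by [upper a 0] keeps the diagonal of the triangular factor and multiplies its upper
    right entry by [a ^+ 2 <= 1]. The factor thus stays close to 1 however small [a] is. *)
Let conj_moebius u : `|u| <= S ->
  (upper a 0 * h_ u * g)%g =
  (upper ((denominator g u)^-1)%R (a ^+ 2 * \val g 0 1)%R * (upper a 0 * h_ (moebius g u)))%g.
Proof.
move=> uS; have D0 := denominator_gt0 S0 rho0 rho2 g1 uS.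
rewrite -mulgA h_mul_moebius ?gt_eqF// !mulgA; congr (_ * _)%g.
rewrite !upper_mul ?gt_eqF ?invr_gt0//; congr upper; first by rewrite mulrC.
by rewrite mul0r mulr0 addr0 add0r; field; rewrite gt_eqF.
Qed.

Let small u : `|u| <= S -> `|a ^+ 2 * \val g 0 1| <= rho.
Proof.
move=> uS; rewrite normrM -[leRHS]mul1r; apply: ler_pM => //.
  by rewrite ger0_norm ?sqr_ge0// expr_le1// ltW.
exact: upper_right_close g1.
Qed.

Let inv_upper u (b : R) : `|u| <= S ->
  (upper (denominator g u) (- b) * upper ((denominator g u)^-1)%R b)%g = 1%g.
Proof.
move=> uS; have D0 := denominator_gt0 S0 rho0 rho2 g1 uS.
rewrite upper_mul ?invr_eq0 ?gt_eqF// invrK mulfV ?gt_eqF// mulrC mulNr subrr.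
exact: upper_1.
Qed.

(** The dilation [upper K 0] is left in the conclusion on purpose: it is later absorbed in the
    observed set, whose measure it does not change. *)
Lemma hit_moebius_inv u : `|u| <= S -> hit T (upper a 0 * h_ u)%g ->
  hit (K ^+ 2 * T) (upper K 0 * (upper a 0 * h_ (moebius g u) * g^-1))%g.
Proof.
move=> uS; have D0 := denominator_gt0 S0 rho0 rho2 g1 uS.
set b := a ^+ 2 * \val g 0 1; set D := denominator g u.
have -> : (upper K 0 * (upper a 0 * h_ (moebius g u) * g^-1) =
  upper (K * D)%R (- (K * b))%R * (upper a 0 * h_ u))%g.
  rewrite -[(upper a 0 * h_ u)%g](mulgK g) conj_moebius// -/b -/D !mulgA.
  congr (_ * _ * _)%g.
  have -> : upper (K * D)%R (- (K * b))%R = (upper K 0 * upper D (- b)%R)%g.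
    by rewrite upper_mul ?gt_eqF// mul0r addr0 mulrN.
  by congr (_ * _)%g; rewrite -mulgA inv_upper// mulg1.
move=> hx; apply: (close_matrix uS _ hx); rewrite normrN normrM (gtr0_norm K0) ler_pM2l//.
exact: small uS.
Qed.

Lemma hit_moebius u : `|u| <= S -> hit T (upper K^-1%R 0 * (upper a 0 * h_ u * g))%g ->
  hit (K ^+ 2 * T) (upper a 0 * h_ (moebius g u))%g.
Proof.
move=> uS; have D0 := denominator_gt0 S0 rho0 rho2 g1 uS.
set b := a ^+ 2 * \val g 0 1; set D := denominator g u.
have -> : (upper a 0 * h_ (moebius g u))%g =
  (upper (K * D)%R (- (b / K))%R * (upper K^-1%R 0 * (upper a 0 * h_ u * g)))%g.
  rewrite conj_moebius// -/b -/D mulgA upper_mul ?invr_eq0 ?gt_eqF ?mulr_gt0// invrK.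
  rewrite mulr0 add0r mulNr divfK ?gt_eqF// [K * D]mulrC mulfK ?gt_eqF//.
  by rewrite mulgA inv_upper// mul1g.
move=> hx; apply: (close_matrix uS _ hx); rewrite normrN normrM normfV (gtr0_norm K0) ler_pdivrMr//.
apply: le_trans (small uS) _; rewrite -[leLHS]mul1r mulrAC ler_pM2r//.
by rewrite -[1]mulr1 ler_pM// ltW.
Qed.

End Transfer.
End Cone.

(** * Lipschitz maps and Lebesgue measure *)

Section LebesgueLipschitz.
Context {R : realType}.
Local Notation mu := (@lebesgue_measure R).

(** In a covering of [E] by intervals, the part of the image over an interval of length [l] lies in
    an interval of length [K * l] that starts at its infimum. Taking [E'] inside the image avoids
    asking whether the image is measurable. *)
Lemma lebesgue_measure_lipschitz (E E' : set R) (phi : R -> R) (K : R) :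
  measurable E' -> 0 < K -> E' `<=` phi @` E ->
  (forall x y, E x -> E y -> `|phi x - phi y| <= K * `|x - y|) ->
  (mu E' <= K%:E * mu E)%E.
Proof.
move=> mE' K0 E'E lip; rewrite -lee_pdivrMl//.
apply: le_ereal_inf_tmp => _ [A [mA EA] <-].
rewrite lee_pdivrMl//.
have wge0 k : (0 <= wlength (@idfun R) (A k))%E by exact: (@wlength_ge0 R idfun).
have exJ k : exists J : set R, [/\ measurable J, phi @` (E `&` A k) `<=` J &
    (mu J <= K%:E * wlength idfun (A k))%E].
  have [EA0|/set0P[e0 [Ee0 Ae0]]] := eqVneq (E `&` A k) set0.
    exists set0; split=> //; first by rewrite EA0 image_set0.
    by rewrite measure0 mule_ge0 ?lee_fin ?(ltW K0) ?wge0.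
  have [[a b] /= _ AkE] := mA k.
  move: Ae0; rewrite -AkE /= in_itv /= => /andP[ae0 e0b].
  have ab : a <= b by apply: le_trans e0b; exact: ltW.
  have dist x y : (E `&` A k) x -> (E `&` A k) y -> phi x - K * (b - a) <= phi y.
    rewrite -AkE => -[Ex]; rewrite /= in_itv /= => /andP[ax xb] -[Ey].
    rewrite /= in_itv /= => /andP[ay yb].
    have := lip _ _ Ex Ey; rewrite ler_norml => /andP[_ h].
    have : `|x - y| <= b - a by rewrite ler_norml; apply/andP; split; lra.
    by move=> /(ler_wpM2l (ltW K0)) h2; move: (K * `|x - y|) h h2 => ? ? ?; lra.
  have ne0 : (E `&` A k) e0 by split=> //; rewrite -AkE /= in_itv /= ae0.
  pose S := phi @` (E `&` A k).
  have lbS x : (E `&` A k) x -> lbound S (phi x - K * (b - a)).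
    by move=> Ex _ [y Ey <-]; exact: dist.
  exists `[inf S, inf S + K * (b - a)]%classic; split => //.
    rewrite AkE => _ [x Ex <-]; rewrite /= in_itv /=; apply/andP; split.
      apply: ge_inf; last by exists x.
      by exists (phi e0 - K * (b - a)); exact: lbS.
    rewrite -lerBlDr; apply: lb_le_inf; last exact: lbS.
    by exists (phi e0), e0.
  rewrite lebesgue_measure_itv /= wlength_itv_bnd//.
  case: ifPn => _; first by rewrite -EFinD -EFinM lee_fin addrAC subrr add0r.
  by rewrite mule_ge0 ?lee_fin ?(ltW K0)// subr_ge0.
have [J HJ] := choice exJ.
apply: (@le_trans _ _ (\sum_(k <oo) mu (J k))%E).
  apply: measure_sigma_subadditive => //.
    by move=> k; have [] := HJ k.
  move=> y /E'E[x Ex <-]; have [k _ Ak] := EA x Ex.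
  by exists k => //; have [_ + _] := HJ k; apply; exists x.
rewrite -nneseriesZl; last by move=> k _; exact: wge0.
by apply: lee_nneseries => k _ //; have [] := HJ k.
Qed.

End LebesgueLipschitz.

(** * Means with respect to a finite measure *)

Section BoundedExpectation.
Context d (T : measurableType d) (R : realType) (nu : {finite_measure set T -> \bar R}).
Implicit Types (f g : T -> R).

Definition bounded_measurable f :=
  measurable_fun setT f /\ exists M : R, forall x, `|f x| <= M.

Definition mean f : R := fine (\int[nu]_x (f x)%:E)%E.

Lemma bounded_measurable_cst c : bounded_measurable (cst c).
Proof. by split; [exact: measurable_cst|exists `|c|]. Qed.

Lemma bounded_measurableD f g : bounded_measurable f -> bounded_measurable g ->
  bounded_measurable (fun x => f x + g x).
Proof.
move=> [mf [M fM]] [mg [N gN]]; split; first exact: measurable_funD.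
by exists (M + N) => x; apply: le_trans (ler_normD _ _) _; exact: lerD.
Qed.

Lemma bounded_measurableM f g : bounded_measurable f -> bounded_measurable g ->
  bounded_measurable (fun x => f x * g x).
Proof.
move=> [mf [M fM]] [mg [N gN]]; split; first exact: measurable_funM.
by exists (M * N) => x; rewrite normrM; apply: ler_pM.
Qed.

Lemma bounded_measurableZ c f : bounded_measurable f -> bounded_measurable (fun x => c * f x).
Proof. by move=> bf; apply: bounded_measurableM => //; exact: bounded_measurable_cst. Qed.

Lemma bounded_measurableB f g : bounded_measurable f -> bounded_measurable g ->
  bounded_measurable (fun x => f x - g x).
Proof.
move=> bf bg; have := bounded_measurableD bf (bounded_measurableZ (-1) bg).
by under eq_fun do rewrite mulN1r.
Qed.

Lemma bounded_measurable_norm f : bounded_measurable f -> bounded_measurable (fun x => `|f x|).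
Proof.
move=> [mf [M fM]]; split; first exact: measurableT_comp.
by exists M => x; rewrite normr_id.
Qed.

Lemma bounded_measurable_sum n (F : 'I_n -> T -> R) :
  (forall i, bounded_measurable (F i)) -> bounded_measurable (fun x => \sum_(i < n) F i x).
Proof.
move=> bF; elim: n F bF => [|n IH] F bF.
  by under eq_fun do rewrite big_ord0; exact: bounded_measurable_cst.
by under eq_fun do rewrite big_ord_recr /=; apply: bounded_measurableD => //; exact: IH.
Qed.

Lemma bounded_measurable_integrable f : bounded_measurable f ->
  nu.-integrable setT (EFin \o f).
Proof.
move=> [mf [M fM]]; apply: measurable_bounded_integrable => //; first exact: fin_num_fun_lty.
by exists M; split=> [|x Mx y _ /=]; [exact: num_real|exact: le_trans (fM y) (ltW Mx)].
Qed.

Lemma meanE f : bounded_measurable f -> (\int[nu]_x (f x)%:E)%E = (mean f)%:E.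
Proof.
move=> bf; rewrite /mean fineK//.
by have := integrable_fin_num measurableT (bounded_measurable_integrable bf).
Qed.

Lemma meanD f g : bounded_measurable f -> bounded_measurable g ->
  mean (fun x => f x + g x) = mean f + mean g.
Proof.
move=> bf bg; apply: EFin_inj; rewrite EFinD -!meanE//; last exact: bounded_measurableD.
by rewrite -integralD//; exact: bounded_measurable_integrable.
Qed.

Lemma meanZ c f : bounded_measurable f -> mean (fun x => c * f x) = c * mean f.
Proof.
move=> bf; apply: EFin_inj; rewrite EFinM -!meanE//; last exact: bounded_measurableZ.
by rewrite -integralZl//; exact: bounded_measurable_integrable.
Qed.

Lemma meanB f g : bounded_measurable f -> bounded_measurable g ->
  mean (fun x => f x - g x) = mean f - mean g.
Proof.
move=> bf bg; rewrite -mulN1r -meanZ// -meanD//; last exact: bounded_measurableZ.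
by congr mean; apply/funext => x; rewrite mulN1r.
Qed.

Lemma mean_cst c : mean (cst c) = c * fine (nu setT).
Proof.
rewrite /mean -[RHS]/(fine (_)%:E) EFinM fineK ?fin_num_measure//.
by rewrite -integral_cst.
Qed.

Lemma le_mean f g : bounded_measurable f -> bounded_measurable g ->
  (forall x, f x <= g x) -> mean f <= mean g.
Proof.
move=> bf bg fg; rewrite -lee_fin -!meanE//; apply: le_integral => //.
- exact: bounded_measurable_integrable.
- exact: bounded_measurable_integrable.
- by move=> x _; rewrite lee_fin.
Qed.

Lemma mean_ge0 f : (forall x, 0 <= f x) -> 0 <= mean f.
Proof. by move=> f0; apply/fine_ge0/integral_ge0 => x _; rewrite lee_fin. Qed.

Lemma mean_sum n (F : 'I_n -> T -> R) : (forall i, bounded_measurable (F i)) ->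
  mean (fun x => \sum_(i < n) F i x) = \sum_(i < n) mean (F i).
Proof.
elim: n F => [|n IH] F bF.
  rewrite big_ord0; under eq_fun do rewrite big_ord0.
  by rewrite -[LHS]/(mean (cst 0)) mean_cst mul0r.
under eq_fun do rewrite big_ord_recr /=.
by rewrite big_ord_recr /= meanD// ?IH//; exact: bounded_measurable_sum.
Qed.

Lemma mean_norm_triangle f g k : bounded_measurable f -> bounded_measurable g ->
  bounded_measurable k ->
  mean (fun x => `|f x - k x|) <= mean (fun x => `|f x - g x|) + mean (fun x => `|g x - k x|).
Proof.
move=> bf bg bk; have b1 := bounded_measurable_norm (bounded_measurableB bf bg).
have b2 := bounded_measurable_norm (bounded_measurableB bg bk).
have b3 := bounded_measurable_norm (bounded_measurableB bf bk).
rewrite -meanD//; apply: le_mean => //; first exact: bounded_measurableD.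
by move=> x; exact: ler_distD.
Qed.

(* |t| <= (t^2 / e + e) / 2 *)
Lemma mean_norm_le_square f (e : R) : bounded_measurable f -> 0 < e ->
  mean (fun x => `|f x|) <= (mean (fun x => f x * f x) / e + e * fine (nu setT)) / 2.
Proof.
move=> bf e0; have b1 := bounded_measurable_norm bf; have b2 := bounded_measurableM bf bf.
rewrite -mean_cst [X in X + _]mulrC -meanZ// -meanD//; last 2 first.
- exact: bounded_measurableZ.
- exact: bounded_measurable_cst.
have b3 : bounded_measurable (fun x => e^-1 * (f x * f x) + cst e x).
  by apply: bounded_measurableD; [exact: bounded_measurableZ|exact: bounded_measurable_cst].
rewrite mulrC -meanZ//; apply: le_mean => //; first exact: bounded_measurableZ.
move=> x /=; have -> : f x * f x = `|f x| * `|f x| by rewrite -!expr2 real_normK ?num_real.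
move: `|f x| => t; have h : 0 <= e^-1 * (t - e) ^+ 2 by rewrite mulr_ge0 ?sqr_ge0// invr_ge0 ltW.
have E : e^-1 * (t - e) ^+ 2 = e^-1 * (t * t) - 2 * t + e by field; rewrite gt_eqF.
by rewrite E in h; move: (e^-1 * (t * t)) h => ? ?; lra.
Qed.

End BoundedExpectation.

(** * Invariant measure on the quotient *)

Section Equidistribution.
Context {R : realType}.
Local Notation G := (borel (SL2 R)).
Implicit Types (g x y : SL2 R) (A B : set (SL2 R)).
Variables (Gamma : set (SL2 R)) (haar : {measure set G -> \bar R}).
Hypothesis Gamma1 : Gamma 1%g.
Hypothesis GammaM : forall g h : SL2 R, Gamma g -> Gamma h -> Gamma (g * h)%g.
Hypothesis GammaV : forall g, Gamma g -> Gamma (g^-1)%g.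
Hypothesis Gamma_isolated : Gamma `<=` isolated Gamma.
Hypothesis haarP : haar_measure haar.

Definition right_invariant A := forall x g, Gamma g -> A x -> A (x * g)%g.

Definition saturation A : set (SL2 R) :=
  \bigcup_(g in Gamma) [set x : SL2 R | A (x * g)%g].

Lemma to_quotient_eqP x y :
  to_quotient Gamma x = to_quotient Gamma y <-> exists2 g, Gamma g & y = (x * g)%g.
Proof.
split=> [/eqquotP/asboolP|[g Gg ->]].
  move=> /seteqP[_ /(_ y)[|g Gg <-]]; last by exists g.
  by exists 1%g => //; rewrite mulg1.
apply/eqquotP/asboolP/seteqP; split=> _ [h Gh <-].
  by exists (g^-1 * h)%g; [exact/GammaM/Gh/GammaV|rewrite -mulgA mulVKg].
by exists (g * h)%g; [exact: GammaM|rewrite mulgA].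
Qed.

Lemma right_invariantE A x g : right_invariant A -> Gamma g -> A (x * g)%g <-> A x.
Proof.
move=> rA Gg; split=> [Axg|]; last exact: rA.
by rewrite -(mulgK g x); apply: rA => //; exact: GammaV.
Qed.

Lemma sub_saturation A : A `<=` saturation A.
Proof. by move=> x Ax; exists 1%g => //=; rewrite mulg1. Qed.

Lemma saturation_invariant A : right_invariant (saturation A).
Proof.
move=> x g Gg [h Gh Axh]; exists (g^-1 * h)%g; first exact/GammaM/Gh/GammaV.
by rewrite /= mulgA mulgK.
Qed.

Lemma open_saturation A : open A -> open (saturation A).
Proof.
move=> oA; apply: bigcup_open => g _; apply: open_comp => // x _.
exact: SL2_mulr_continuous.
Qed.

Lemma image_saturation A : to_quotient Gamma @` saturation A = to_quotient Gamma @` A.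
Proof.
apply/seteqP; split=> [_ [x [g Gg Axg] <-]|]; last exact/image_subset/sub_saturation.
by exists (x * g)%g => //; apply/esym/to_quotient_eqP; exists g.
Qed.

Lemma open_mull g A : open A -> open [set x : SL2 R | A (g * x)%g].
Proof. by move=> oA; apply: open_comp => // x _; exact: SL2_mull_continuous. Qed.

Lemma mull_measurable g : measurable_fun setT (fun x : G => (g * x)%g : G).
Proof.
apply: (@measurability _ _ G G setT _ (@open (SL2 R))) => // _ [B oB <-].
by rewrite setTI; apply: open_measurable_SL2; exact: open_mull.
Qed.

Lemma mull_image g A : [set (g * x)%g | x in A] = [set x : SL2 R | A (g^-1 * x)%g].
Proof.
apply/seteqP; split=> [_ [x Ax <-]|x Ax] /=; first by rewrite mulKg.
by exists (g^-1 * x)%g => //; rewrite mulVKg.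
Qed.

Lemma measurable_mull g (A : set G) : measurable A ->
  measurable ([set x : SL2 R | A (g * x)%g] : set G).
Proof. by move=> mA; rewrite -[X in measurable X]setTI; exact: mull_measurable. Qed.

Lemma haar_mull g (A : set G) : measurable A ->
  haar ([set x : SL2 R | A (g * x)%g] : set G) = haar A.
Proof.
move=> mA; case: haarP => + _ _ => /(_ (g^-1)%g _ mA).
by rewrite mull_image invgK.
Qed.

(** Countably many left translates of a nonempty open set cover the group, so a null one would make
    the whole measure vanish. *)
Lemma haar_open_gt0 A : open A -> A !=set0 -> (0 < haar (A : set G))%E.
Proof.
move=> oA [a Aa]; rewrite lt0e measure_ge0 andbT; apply/negP => /eqP A0.
case: haarP => _ _ /eqP; apply.
have [||u uT] := @SL2_lindelof R (fun g => [set x | A (a * g^-1 * x)%g]).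
- by move=> g; exact: open_mull.
- by move=> g /=; rewrite mulgVK.
apply/eqP; rewrite eq_le measure_ge0 andbT.
pose F n : set G := [set x : SL2 R | A (a * (u n)^-1 * x)%g].
apply: (@le_trans _ _ (\sum_(n <oo) haar (F n))%E).
  apply: measure_sigma_subadditive => //; last by rewrite -uT.
  by move=> n; apply: open_measurable_SL2; exact: open_mull.
by rewrite eseries0// => n _ _; rewrite /F haar_mull//; exact: open_measurable_SL2.
Qed.

Definition bounded_SL2 (M : R) : set (SL2 R) :=
  [set g : SL2 R | forall i j, `|\val g i j| <= M].

Lemma measurable_bounded_SL2 M : measurable (bounded_SL2 M : set G).
Proof.
have -> : bounded_SL2 M = \bigcap_(ij in [set: 'I_2 * 'I_2])
    ((fun g : G => \val (g : SL2 R) ij.1 ij.2) @^-1` `[- M, M]%classic).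
  apply/seteqP; split=> [g gM [i j] _ /=|g gM i j].
    by rewrite in_itv /= -ler_norml; exact: gM.
  by have := gM (i, j) I; rewrite /= in_itv /= -ler_norml.
apply: fin_bigcap_measurable => // -[i j] _.
by rewrite -[X in measurable X]setTI; exact: measurable_entry.
Qed.

Lemma haar_bounded_SL2 M : (haar (bounded_SL2 M : set G) < +oo)%E.
Proof. by case: haarP => _ + _; apply; exact: SL2_bounded_compact. Qed.

Lemma bigcup_bounded_SL2 : \bigcup_n bounded_SL2 n%:R = [set: SL2 R].
Proof.
apply/seteqP; split=> // g _; have [M M0 gM] := SL2_entry_bound g.
exists (Num.bound M) => // i j; apply: (le_trans (gM i j)).
by apply: ltW; apply: archi_boundP; exact: ltW.
Qed.

(** The identity is isolated in [Gamma] and [x^-1 * y] is continuous at (1, 1), so two points of a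
    small box that differ by an element of [Gamma] coincide. *)
Lemma injective_box : exists2 e : R, 0 < e &
  forall x y g, SL2_box 1%g e x -> SL2_box 1%g e y -> Gamma g -> y = (x * g)%g -> x = y.
Proof.
have [_ [N N1 NG]] := Gamma_isolated Gamma1.
have c : continuous (fun p : SL2 R * SL2 R => (p.1^-1 * p.2)%g).
  have f1 : continuous (fun p : SL2 R * SL2 R => p.1).
    by move=> p A nA; exists (A, setT) => [|q []//]; split=> //; exact: filterT.
  have f2 : continuous (fun p : SL2 R * SL2 R => p.2).
    by move=> p A nA; exists (setT, A) => [|q []//]; split=> //; exact: filterT.
  apply: continuous_SL2_mul => // p.
  exact: (@continuous_comp _ _ _ fst (fun g : SL2 R => (g^-1)%g) p (f1 p)
    (@continuous_SL2_inv R _)).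
have : nbhs ((1%g, 1%g) : SL2 R * SL2 R) ((fun p : SL2 R * SL2 R => (p.1^-1 * p.2)%g) @^-1` N).
  by apply: c; rewrite /= mulVg.
move=> [[A B] /= [/SL2_nbhsP[a a0 aA] /SL2_nbhsP[b b0 bB]] AB].
exists (Num.min a b); first by rewrite lt_min a0.
move=> x y g xb yb Gg yE.
have : (N `&` Gamma) (x^-1 * y)%g.
  split; last by rewrite yE mulKg.
  apply: (AB (x, y)); split=> /=.
    by apply: aA => i j; apply: (lt_le_trans (xb i j)); rewrite ge_min lexx.
  by apply: bB => i j; apply: (lt_le_trans (yb i j)); rewrite ge_min lexx orbT.
by rewrite NG => /= /(congr1 (fun z => x * z)%g); rewrite mulVKg mulg1.
Qed.

Definition fundamental_domain (D : set (SL2 R)) :=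
  (forall x y g, D x -> D y -> Gamma g -> y = (x * g)%g -> x = y) /\
  (forall x, exists2 g, Gamma g & D (x * g)%g).

(** Countably many translates of the injective box cover the group. Removing from each one the
    saturations of its predecessors leaves exactly one point of every coset, in the first translate
    that the coset meets. *)
Lemma ex_fundamental_domain : exists2 D : set (SL2 R),
  measurable (D : set G) & fundamental_domain D.
Proof.
have [e e0 inj] := injective_box.
pose V g := [set x : SL2 R | SL2_box 1%g e (g^-1 * x)%g].
have oV g : open (V g) by apply: open_mull; exact: open_SL2_box.
have [|u uT] := SL2_lindelof oV.
  by move=> g i j; rewrite mulVg subrr normr0.
pose D := \bigcup_n (V (u n) `\` \bigcup_(k < n) saturation (V (u k))).
exists D.
  apply: bigcupT_measurable => n; apply: measurableD.
    exact: open_measurable_SL2.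
  apply: bigcup_measurable => k _; apply: open_measurable_SL2.
  exact/open_saturation.
split.
  move=> x y g [n _ [xn xk]] [m _ [ym yk]] Gg yE.
  have [nm|mn|nm] := ltngtP n m.
  - exfalso; apply: yk; exists n => //; exists (g^-1)%g; first exact: GammaV.
    by rewrite /= yE mulgK.
  - exfalso; apply: xk; exists m => //; exists g => //.
    by rewrite /= -yE.
  have /(congr1 (fun z => u n * z)%g) : ((u n)^-1 * x)%g = ((u n)^-1 * y)%g.
    apply: (inj _ _ g) => //; first by rewrite nm; exact: ym.
    by rewrite yE mulgA.
  by rewrite !mulVKg.
move=> x.
have ex : exists n, `[< saturation (V (u n)) x >].
  have [n _ xn] : (\bigcup_n V (u n)) x by rewrite uT.
  by exists n; apply/asboolP; exact: sub_saturation.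
case: (ex_minnP ex) => n /asboolP [g Gg xg] nmin; exists g => //.
exists n => //; split=> // -[k /= kn [h Gh xgh]].
suff : (n <= k)%N by rewrite leqNgt kn.
apply: nmin; apply/asboolP; exists (g * h)%g; first exact: GammaM.
by rewrite /= mulgA.
Qed.

Local Notation mfun F := (measurable_fun [set: G] F).

Variables (D : set (SL2 R)) (mu : {measure set (borel (SL2_quotient Gamma)) -> \bar R}).
Hypothesis mD : measurable (D : set G).
Hypothesis fdD : fundamental_domain D.
Hypothesis muP : induced_measure haar mu.
Hypothesis mu_fin : (mu setT < +oo)%E.

Lemma inj_to_quotient (A : set (SL2 R)) :
  (forall x y g, A x -> A y -> Gamma g -> y = (x * g)%g -> x = y) ->
  set_inj A (to_quotient Gamma).
Proof.
move=> iA x y /set_mem Ax /set_mem Ay /to_quotient_eqP[g Gg yE].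
exact: iA Gg yE.
Qed.

Lemma haar_fundamental (D' : set (SL2 R)) (B : set G) :
  measurable (D' : set G) -> fundamental_domain D' -> measurable B ->
  right_invariant B -> haar (B `&` D') = mu (to_quotient Gamma @` B).
Proof.
move=> mD' [iD' sD'] mB rB; rewrite -muP; last 2 first.
- exact: measurableI.
- by apply: inj_to_quotient => x y g [_ Dx] [_ Dy]; exact: iD'.
congr (mu _); apply/seteqP; split=> [|_ [x Bx <-]].
  by apply: image_subset => x [].
have [g Gg Dxg] := sD' x; exists (x * g)%g; last by apply/esym/to_quotient_eqP; exists g.
by split=> //; exact: rB.
Qed.

Lemma haar_domain : haar D = mu setT.
Proof.
rewrite -[D in LHS]setTI haar_fundamental//; congr (mu _).
apply/seteqP; split=> // y _; exists (repr y) => //.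
by rewrite /to_quotient reprK.
Qed.

Lemma haar_domain_fin : (haar D < +oo)%E.
Proof. by rewrite haar_domain. Qed.

Local Notation nu := (mfrestr mD haar_domain_fin).

Lemma nu_quotient (B : set G) : measurable B -> right_invariant B ->
  nu B = mu (to_quotient Gamma @` B).
Proof. by move=> mB rB; rewrite -(haar_fundamental mD fdD mB rB). Qed.

Lemma nuT : nu setT = mu setT.
Proof. by rewrite /mfrestr /mrestr /= setTI haar_domain. Qed.

(** The translate of [D] is again a fundamental domain, and an invariant set has the same Haar
    measure in both, namely [mu] of its image. Left invariance of Haar measure does the rest. *)
Lemma nu_mull g (B : set G) : measurable B -> right_invariant B ->
  nu ([set x : SL2 R | B (g * x)%g] : set G) = nu B.
Proof.
move=> mB rB; pose gB : set (SL2 R) := [set x : SL2 R | B (g * x)%g].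
pose gD : set (SL2 R) := [set x : SL2 R | D (g * x)%g].
have mgB : measurable (gB : set G) by exact: measurable_mull.
have mgD : measurable (gD : set G) by exact: measurable_mull.
have rgB : right_invariant gB by move=> x h Gh; rewrite /gB /= mulgA; exact: rB.
have fgD : fundamental_domain gD.
  case: fdD => iD sD; split=> [x y h xD yD Gh yE|x].
    have := iD _ _ h xD yD Gh; rewrite yE mulgA => /(_ erefl).
    by move=> /(congr1 (fun z => g^-1 * z)%g); rewrite -mulgA !mulKg.
  by have [h Gh Dh] := sD (g * x)%g; exists h => //; rewrite /gD /= mulgA.
rewrite nu_quotient// -(haar_fundamental mgD fgD mgB rgB).
exact: (haar_mull g (measurableI _ _ mB mD)).
Qed.

(** As [W] embeds in the quotient, its saturation has [nu]-measure [haar W], and [F >= c] there by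
    invariance. This Markov inequality turns a small mean into a small value at some point of [W];
    with [F = 1] it shows that the total mass is positive. *)
Lemma nu_ge_box (W : set (SL2 R)) (F : G -> \bar R) (c : R) : open W ->
  (forall x y g, W x -> W y -> Gamma g -> y = (x * g)%g -> x = y) ->
  mfun F -> (forall x, 0 <= F x)%E ->
  (forall x g, Gamma g -> F (x * g)%g = F x) -> 0 <= c ->
  (forall x, W x -> c%:E <= F x)%E ->
  (c%:E * haar (W : set G) <= \int[nu]_x F x)%E.
Proof.
move=> oW iW mF F0 rF c0 cF.
have mW : measurable (W : set G) by exact: open_measurable_SL2.
have mS : measurable (saturation W : set G) by apply: open_measurable_SL2; exact: open_saturation.
have <- : nu (saturation W) = haar W.
  rewrite nu_quotient//; last exact: saturation_invariant.
  by rewrite image_saturation muP//; exact: inj_to_quotient.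
rewrite -integral_cst//; apply: (@le_trans _ _ (\int[nu]_(x in saturation W) F x)%E).
  apply: ge0_le_integral => //.
  - exact: measurable_funTS.
  - by move=> x [g Gg Wxg]; rewrite -(rF x g Gg); exact: cF.
by apply: ge0_subset_integral => // x _.
Qed.

Definition rinv_fun (T : Type) (f : G -> T) := forall x g, Gamma g -> f (x * g)%g = f x.

(** The measure [nu] is preserved by translations only on right invariant sets. The change of
    variables is therefore made on the distribution of [F], since preimages under an invariant
    function are invariant. *)
Lemma nu_integral_mull g (F : G -> \bar R) :
  mfun F -> (forall x, 0 <= F x)%E -> rinv_fun F ->
  (\int[nu]_x F (g * x)%g = \int[nu]_x F x)%E.
Proof.
move=> mF F0 rF.
pose Fg (x : G) : \bar R := F (g * x)%g.
have mFg : mfun Fg by apply: (measurableT_comp mF); exact: mull_measurable.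
(* The pushforward formula is used for an integrand that is nonnegative on the whole extended line;
   this one agrees with the identity on the values taken. *)
pose id_ (y : \bar R) := maxe y 0.
have mid : measurable_fun setT id_ by exact: measurable_maxe.
have E1 (H : G -> \bar R) : mfun H -> (forall x, 0 <= H x)%E ->
    (\int[nu]_x H x = \int[pushforward nu H]_y id_ y)%E.
  move=> mH H0; rewrite ge0_integral_pushforward//.
    by rewrite preimage_setT; apply: eq_integral => x _; rewrite /id_ /= max_l.
  by move=> y _; rewrite /id_ le_max lexx orbT.
transitivity (\int[pushforward nu Fg]_y id_ y)%E; first by apply: E1 => // x; exact: F0.
transitivity (\int[pushforward nu F]_y id_ y)%E; last by rewrite (E1 F).
apply: eq_measure_integral => A mA _; rewrite /pushforward.
have mB : measurable ((F : G -> \bar R) @^-1` A) by rewrite -[X in measurable X]setTI; exact: mF.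
rewrite -[RHS](nu_mull g)// => x h Gh /=.
by rewrite rF.
Qed.

(** * The mean ergodic theorem *)

Local Notation bm := bounded_measurable.
Local Notation E := (mean nu).

Lemma bounded_measurable_mull g (f : G -> R) : bm f -> bm (fun x : G => f (g * x)%g).
Proof.
move=> [mf [M fM]]; split; last by exists M.
by apply: (measurableT_comp mf); exact: mull_measurable.
Qed.

Lemma mean_mull g (f : G -> R) : bm f -> rinv_fun f -> E (fun x : G => f (g * x)%g) = E f.
Proof.
move=> bf rf; have [mf [M fM]] := bf.
have b1 := bounded_measurable_cst G M.
have /(congr1 fine) e : (\int[nu]_x (f (g * x)%g + M)%:E = \int[nu]_x (f x + M)%:E)%E.
  apply: (@nu_integral_mull g (fun x => (f x + M)%:E)).
  - by apply/measurable_EFinP; apply: measurable_funD => //; exact: measurable_cst.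
  - by move=> x; rewrite lee_fin -lerBlDr sub0r; have := fM x; rewrite ler_norml => /andP[].
  - by move=> x h Gh; rewrite rf.
have bg := bounded_measurable_mull g bf.
apply: (@addIr _ (E (cst M))).
by rewrite -(meanD nu bg b1) -(meanD nu bf b1).
Qed.

Section VonNeumann.
Variable u : G -> R.
Hypothesis bu : bm u.
Hypothesis ru : rinv_fun u.
Hypothesis u01 : forall x, 0 <= u x <= 1.

Definition shift_sum (f : G -> R) n (x : G) : R := \sum_(k < n) f (h_ k%:R * x)%g.
Definition shift_avg (f : G -> R) n (x : G) : R := n%:R^-1 * shift_sum f n x.

Local Notation F := (shift_avg u).
Local Notation Q f := (E (fun x => f x * f x)).

Lemma shift_sum_le f n x : (forall x, `|f x| <= 1) -> `|shift_sum f n x| <= n%:R.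
Proof.
move=> f1; apply: le_trans (ler_norm_sum _ _ _) _.
by rewrite -[n in leRHS]card_ord -sumr_const; exact: ler_sum.
Qed.

Lemma shift_avg_le f n x : (forall x, `|f x| <= 1) -> `|shift_avg f n x| <= 1.
Proof.
move=> f1; case: n => [|n]; first by rewrite /shift_avg invr0 mul0r normr0.
rewrite normrM ger0_norm ?invr_ge0// ler_pdivrMl ?ltr0n// mulr1.
exact: shift_sum_le.
Qed.

Lemma bm_shift_avg f n : bm f -> bm (shift_avg f n).
Proof.
move=> bf; apply: bounded_measurableZ; apply: bounded_measurable_sum => k.
exact: bounded_measurable_mull.
Qed.

Lemma rinv_shift_avg f n : rinv_fun f -> rinv_fun (shift_avg f n).
Proof.
move=> rf x g Gg; rewrite /shift_avg /shift_sum; congr (_ * _).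
by apply: eq_bigr => k _; rewrite mulgA (rf _ g).
Qed.

Let u_le1 x : `|u x| <= 1.
Proof. by have /andP[u0 u1] := u01 x; rewrite ger0_norm. Qed.

(* The averages of u are asymptotically of minimal L2 norm in the convex set of
   functions with the same ergodic averages as u, so by the parallelogram law
   they form a Cauchy sequence. *)
Definition asymptotic (f : G -> R) := [/\ bm f, rinv_fun f, forall x, `|f x| <= 1 &
  exists2 C : R, 0 <= C & forall n x, `|shift_sum u n x - shift_sum f n x| <= C].

Lemma asymptotic_u : asymptotic u.
Proof. by split => //; exists 0 => // n x; rewrite subrr normr0. Qed.

Lemma asymptotic_avg (f g : G -> R) : asymptotic f -> asymptotic g ->
  asymptotic (fun x => 2^-1 * (f x + g x)).
Proof.
move=> [bf rf f1 [C C0 fC]] [bg rg g1 [C' C'0 gC]]; split.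
- by apply: bounded_measurableZ; exact: bounded_measurableD.
- by move=> x h Gh; rewrite (rf x h)// (rg x h).
- move=> x; rewrite normrM ger0_norm ?invr_ge0// ler_pdivrMl// mulr1.
  by apply: le_trans (ler_normD _ _) _; exact: lerD.
exists (2^-1 * (C + C')); first by rewrite mulr_ge0// ?invr_ge0// addr_ge0.
move=> n x; have -> : shift_sum (fun x => 2^-1 * (f x + g x)) n x =
    2^-1 * (shift_sum f n x + shift_sum g n x).
  by rewrite /shift_sum -mulr_sumr big_split.
have -> : shift_sum u n x - 2^-1 * (shift_sum f n x + shift_sum g n x) =
    2^-1 * ((shift_sum u n x - shift_sum f n x) + (shift_sum u n x - shift_sum g n x)).
  by field.
rewrite normrM ger0_norm ?invr_ge0// ler_pM2l ?invr_gt0//.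
by apply: le_trans (ler_normD _ _) _; exact: lerD.
Qed.

Lemma shift_sum_shift f n k (x : G) : (forall x, `|f x| <= 1) ->
  `|shift_sum f n x - shift_sum f n (h_ k%:R * x)%g| <= 2 * k%:R.
Proof.
move=> f1; elim: k => [|k IH]; first by rewrite h_0 mul1g subrr normr0 mulr0.
have E1 : shift_sum f n (h_ k.+1%:R * x)%g - shift_sum f n (h_ k%:R * x)%g =
    f (h_ (n + k)%:R * x)%g - f (h_ k%:R * x)%g.
  pose a (j : nat) := f (h_ (j + k)%:R * x)%g.
  have S1 : \sum_(i < n) a i + a n = a 0 + \sum_(i < n) a i.+1.
    rewrite -[LHS](big_ord_recr n (fun j : 'I_n.+1 => a j)).
    by rewrite (big_ord_recl n (fun j : 'I_n.+1 => a j)).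
  have -> : shift_sum f n (h_ k.+1%:R * x)%g = \sum_(i < n) a i.+1.
    by apply: eq_bigr => i _; rewrite /a mulgA -h_add -natrD addSnnS.
  have -> : shift_sum f n (h_ k%:R * x)%g = \sum_(i < n) a i.
    by apply: eq_bigr => i _; rewrite /a mulgA -h_add -natrD.
  rewrite -/(a n) -[h_ k%:R in RHS]/(h_ (0 + k)%:R) -/(a 0).
  by move: S1; move: (\sum_(i < n) _) (\sum_(i < n) _) (a n) (a 0) => ? ? ? ? ?; lra.
have := ler_distD (shift_sum f n (h_ k%:R * x)%g) (shift_sum f n x)
  (shift_sum f n (h_ k.+1%:R * x)%g).
move=> /le_trans; apply; rewrite [X in _ + X]distrC E1.
have := ler_normB (f (h_ (n + k)%:R * x)%g) (f (h_ k%:R * x)%g).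
have := f1 (h_ (n + k)%:R * x)%g; have := f1 (h_ k%:R * x)%g.
rewrite -natr1; move: IH; lra.
Qed.

Lemma asymptotic_shift_avg p : asymptotic (F p.+1).
Proof.
split; [exact: bm_shift_avg|exact: rinv_shift_avg|by move=> x; exact: shift_avg_le|].
exists (2 * p.+1%:R) => // n x.
have p0 : p.+1%:R != 0 :> R by rewrite pnatr_eq0.
have -> : shift_sum (F p.+1) n x = p.+1%:R^-1 * \sum_(k < p.+1) shift_sum u n (h_ k%:R * x)%g.
  rewrite /shift_sum /shift_avg -mulr_sumr exchange_big /=; congr (_ * _).
  apply: eq_bigr => k _; apply: eq_bigr => l _.
  by rewrite !mulgA -!h_add addrC.
have -> : shift_sum u n x = p.+1%:R^-1 * \sum_(k < p.+1) shift_sum u n x.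
  by rewrite sumr_const card_ord -[shift_sum _ _ _ *+ _]mulr_natl mulrA mulVf// mul1r.
rewrite -mulrBr -sumrB normrM ger0_norm ?invr_ge0// ler_pdivrMl ?ltr0n//.
apply: le_trans (ler_norm_sum _ _ _) _.
have -> : p.+1%:R * (2 * p.+1%:R) = \sum_(k < p.+1) (2 * p.+1%:R : R).
  by rewrite sumr_const card_ord -[RHS]mulr_natl.
apply: ler_sum => k _.
apply: le_trans (shift_sum_shift _ _ _ u_le1) _.
by rewrite ler_pM2l// ler_nat ltnW.
Qed.

Lemma sqr_sum_le n (a : 'I_n -> R) : (\sum_i a i) ^+ 2 <= n%:R * \sum_i a i ^+ 2.
Proof.
elim: n a => [|n IH] a; first by rewrite !big_ord0 mulr0 expr0n.
rewrite !big_ord_recr /=; set s := \sum_i _; set q := \sum_i _; set t := a _.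
have h1 : s ^+ 2 <= n%:R * q by exact: IH.
have h2 : 2 * (s * t) <= q + n%:R * t ^+ 2.
  have -> : n%:R * t ^+ 2 = \sum_(i < n) t ^+ 2 by rewrite sumr_const card_ord -[RHS]mulr_natl.
  rewrite /s mulr_suml mulr_sumr.
  rewrite /q -big_split /=; apply: ler_sum => i _.
  by have := sqr_ge0 (a (widen_ord (leqnSn n) i) - t); rewrite sqrrB; lra.
by rewrite sqrrD -natr1; move: h1 h2; rewrite mulr2n; lra.
Qed.

(** Cauchy-Schwarz at each point, after which every translate of [f * f] has the mean [Q f]. *)
Lemma Q_shift_avg f n : bm f -> rinv_fun f -> Q (shift_avg f n.+1) <= Q f.
Proof.
move=> bf rf; have bQ := bounded_measurableM bf bf.
have rQ : rinv_fun (fun x => f x * f x) by move=> x g Gg; rewrite !rf.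
have bS := bm_shift_avg n.+1 bf.
have n0 : 0 < n.+1%:R :> R by rewrite ltr0n.
have -> : Q f = E (shift_avg (fun x => f x * f x) n.+1).
  have bk (k : 'I_n.+1) : bm (fun x : G => f (h_ k%:R * x)%g * f (h_ k%:R * x)%g).
    exact: (bounded_measurable_mull (h_ k%:R) bQ).
  rewrite [RHS]meanZ; last exact: (bounded_measurable_sum bk).
  rewrite [X in _ * X](mean_sum nu bk).
  rewrite (eq_bigr (fun=> Q f)) => [|k _]; last exact: (mean_mull _ bQ rQ).
  by rewrite sumr_const card_ord -[E _ *+ _]mulr_natl mulrA mulVf ?mul1r// gt_eqF.
apply: le_mean; [exact: bounded_measurableM|exact: bm_shift_avg|move=> x].
rewrite -expr2 /shift_avg exprMn expr2 -mulrA ler_pM2l ?invr_gt0//.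
rewrite ler_pdivrMl//; apply: le_trans (sqr_sum_le _) _.
by under eq_bigr do rewrite expr2.
Qed.

Let D0 := inf [set Q f | f in asymptotic].

Let D0_le f : asymptotic f -> D0 <= Q f.
Proof.
move=> af; apply: ge_inf; last by exists f.
by exists 0 => _ [g _ <-]; apply: mean_ge0 => x; rewrite -expr2 sqr_ge0.
Qed.

(** The averages of a nearly minimal [f] are within [C / (n + 1)] of those of [u] and have no larger
    norm than [f]. Hence the norm of the averages of [u] is eventually nearly minimal. *)
Let Q_lim (e : R) : 0 < e -> exists N, forall n, (N <= n)%N -> Q (F n.+1) <= D0 + e.
Proof.
move=> e0.
have [|_ [f af <-] Qf] := @inf_adherent R [set Q f | f in asymptotic] (e / 2) (divr_gt0 e0 (ltr0Sn R 1)).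
  split; first by exists (Q u), u => //; exact: asymptotic_u.
  by exists 0 => _ [g _ <-]; apply: mean_ge0 => x; rewrite -expr2 sqr_ge0.
have [bf rf f1 [C C0 fC]] := af.
pose V := fine (nu setT).
have V0 : 0 <= V by exact: fine_ge0.
have [N NP] : exists N : nat, 2 * C * V / (e / 2) < N%:R.
  exists (Num.bound (2 * C * V / (e / 2))); apply: archi_boundP.
  exact: (divr_ge0 (mulr_ge0 (mulr_ge0 (ler0n R 2) C0) V0) (ltW (divr_gt0 e0 (ltr0Sn R 1)))).
exists N => n Nn.
have n0 : 0 < n.+1%:R :> R by rewrite ltr0n.
have bF := bm_shift_avg n.+1 bu; have bA := bm_shift_avg n.+1 bf.
have QF : Q (F n.+1) <= Q (shift_avg f n.+1) + 2 * C / n.+1%:R * V.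
  rewrite -mean_cst -meanD; [|exact: bounded_measurableM|exact: bounded_measurable_cst].
  apply: le_mean.
  - exact: bounded_measurableM.
  - apply: bounded_measurableD; [exact: bounded_measurableM|exact: bounded_measurable_cst].
  move=> x /=; rewrite -lerBlDl.
  have -> : F n.+1 x * F n.+1 x - shift_avg f n.+1 x * shift_avg f n.+1 x =
    (F n.+1 x - shift_avg f n.+1 x) * (F n.+1 x + shift_avg f n.+1 x) by ring.
  apply: le_trans (ler_norm _) _; rewrite normrM mulrC -[2 * C / _]mulrA.
  apply: ler_pM => //.
    apply: le_trans (ler_normD _ _) _.
    have := shift_avg_le n.+1 x u_le1; have := shift_avg_le n.+1 x f1; lra.
  rewrite -mulrBr normrM ger0_norm ?invr_ge0// mulrC ler_pM2r ?invr_gt0//.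
have Qa := Q_shift_avg n bf rf.
have le1 : 2 * C * V <= n.+1%:R * (e / 2).
  rewrite -ler_pdivrMr ?divr_gt0//; apply: le_trans (ltW NP) _.
  by rewrite ler_nat ltnW.
have : 2 * C / n.+1%:R * V <= e / 2 by rewrite mulrAC ler_pdivrMr// [leRHS]mulrC.
move=> le2; apply: le_trans QF _; apply: le_trans (lerD Qa le2) _.
rewrite -/D0 in Qf; apply: le_trans (lerD (ltW Qf) (lexx (e / 2))) _.
by rewrite -addrA -splitr.
Qed.

Lemma shift_avg_cauchy (e : R) : 0 < e -> exists N, forall n p, (N <= n)%N -> (N <= p)%N ->
  E (fun x => `|F n.+1 x - F p.+1 x|) <= e.
Proof.
move=> e0; pose V := fine (nu setT).
have V0 : 0 <= V by exact: fine_ge0.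
pose eta := e / (V + 1).
have V1 : 0 < V + 1 by rewrite ltr_wpDl.
have eta0 : 0 < eta by rewrite divr_gt0.
(* Norms below [D0 + e * eta / 4] give a mean square of at most [e * eta] by the parallelogram law.
   Then [mean_norm_le_square] at scale [eta] yields [(e + eta * V) / 2], and [eta * V <= e]. *)
have [N NP] := Q_lim (divr_gt0 (mulr_gt0 e0 eta0) (ltr0Sn R 3)).
exists N => n p Nn Np.
have bn := bm_shift_avg n.+1 bu; have bp := bm_shift_avg p.+1 bu.
have bB := bounded_measurableB bn bp.
apply: le_trans (mean_norm_le_square nu bB eta0) _.
have b1 := bounded_measurableM bn bn; have b2 := bounded_measurableM bp bp.
have aa := asymptotic_avg (asymptotic_shift_avg n) (asymptotic_shift_avg p).
have [b3 _ _ _] := aa; have b4 := bounded_measurableM b3 b3.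
have Eq : E (fun x => (F n.+1 x - F p.+1 x) * (F n.+1 x - F p.+1 x)) =
    2 * Q (F n.+1) + 2 * Q (F p.+1) - 4 * Q (fun x => 2^-1 * (F n.+1 x + F p.+1 x)).
  rewrite -!meanZ// -meanD; [|exact: bounded_measurableZ|exact: bounded_measurableZ].
  rewrite -meanB; last 2 first.
  - by apply: bounded_measurableD; exact: bounded_measurableZ.
  - exact: bounded_measurableZ.
  by congr (mean _ _); apply/funext => x; field.
have le1 : E (fun x => (F n.+1 x - F p.+1 x) * (F n.+1 x - F p.+1 x)) <= e * eta.
  have key (a b c d t : R) : d <= c -> a <= d + t / 4 -> b <= d + t / 4 ->
    2 * a + 2 * b - 4 * c <= t by move=> *; lra.
  by rewrite Eq; exact: key (D0_le aa) (NP _ Nn) (NP _ Np).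
have le2 : eta * V <= e.
  by rewrite /eta mulrAC ler_pdivrMr// ler_pM2l// lerDl.
have : E (fun x => (F n.+1 x - F p.+1 x) * (F n.+1 x - F p.+1 x)) / eta <= e.
  by rewrite ler_pdivrMr.
have key (a b t : R) : b <= t -> a <= t -> (a + b) / 2 <= t by move=> *; lra.
exact: key.
Qed.

End VonNeumann.

(** * Ergodicity of the unipotent flow *)

Section OrbitTime.
Variable U : set (SL2 R).
Hypothesis oU : open U.
Hypothesis rU : right_invariant U.
Local Notation lam := (@lebesgue_measure R).

Lemma h_continuous : continuous (fun r : R => h_ r : SL2 R).
Proof.
apply: SL2_continuous; apply: forall_I2; apply: forall_I2 => r;
  under eq_fun do rewrite hE mxE /=; try exact: cst_continuous.
exact: oppr_continuous.
Qed.

Definition orbit_time x : set R := [set r | U (h_ r * x)%g].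

Lemma open_orbit_time x : open (orbit_time x).
Proof.
apply: (@open_comp _ _ (fun r => (h_ r * x)%g)) => // r _.
apply: continuous_SL2_mul; first exact: h_continuous.
exact: cst_continuous.
Qed.

Lemma measurable_orbit_time x : measurable (orbit_time x).
Proof. by apply: open_measurable; exact: open_orbit_time. Qed.

Definition time x (a b : R) : R := fine (lam (orbit_time x `&` `[a, b[%classic)).

Lemma lam_itv (a b : R) : a <= b -> lam `[a, b[%classic = (b - a)%:E.
Proof.
rewrite le_eqVlt => /predU1P[->|ab].
  by rewrite set_itvco0 measure0 subrr.
by rewrite lebesgue_measure_itv /= lte_fin ab EFinB.
Qed.

Lemma lam_itv_fin (a b : R) : (lam `[a, b[%classic < +oo)%E.
Proof.
by rewrite lebesgue_measure_itv /=; case: ifPn => // _; rewrite -EFinD ltry.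
Qed.

Lemma timeE x a b : lam (orbit_time x `&` `[a, b[%classic) = (time x a b)%:E.
Proof.
rewrite /time fineK// ge0_fin_numE//; apply: le_lt_trans (lam_itv_fin a b).
apply: le_measure; rewrite ?inE//.
  by apply: measurableI => //; exact: measurable_orbit_time.
Qed.

Lemma time_ge0 x a b : 0 <= time x a b.
Proof. exact: fine_ge0. Qed.

Lemma time_le x a b : a <= b -> time x a b <= b - a.
Proof.
move=> ab; rewrite -lee_fin -timeE -lam_itv//; apply: le_measure; rewrite ?inE//.
  by apply: measurableI => //; exact: measurable_orbit_time.
Qed.

Lemma time_split x a b c : a <= b -> b <= c -> time x a c = time x a b + time x b c.
Proof.
move=> ab bc; apply: EFin_inj; rewrite EFinD -!timeE -measureU; last 3 first.
- by apply: measurableI => //; exact: measurable_orbit_time.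
- by apply: measurableI => //; exact: measurable_orbit_time.
- apply/seteqP; split=> // r [[_ +] [_]]; rewrite /= !in_itv /= => /andP[_ rb] /andP[br _].
  by move: rb; rewrite ltNge br.
rewrite -setIUr; congr (lam (_ `&` _)); apply/seteqP; split=> r; rewrite /= !in_itv /=.
  by move=> /andP[ar rc]; have [rb|br] := ltP r b; [left; rewrite ar|right].
move=> [/andP[-> rb]|/andP[br ->]] /=; first exact: lt_le_trans bc.
by rewrite andbT; exact: le_trans br.
Qed.

Lemma time_shift_le t x a b : time x (a + t) (b + t) <= time (h_ t * x)%g a b.
Proof.
rewrite -lee_fin -!timeE -[leRHS]mul1e.
apply: (@lebesgue_measure_lipschitz _ _ _ (fun r => r + t)) => //.
- by apply: measurableI => //; exact: measurable_orbit_time.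
- move=> r [Ur]; rewrite /= in_itv /= => /andP[ar rb]; exists (r - t); last by rewrite subrK.
  split; first by rewrite /orbit_time /= mulgA -h_add subrK.
  by rewrite /= in_itv /= lerBrDr ar ltrBlDr.
- by move=> r s _ _; rewrite mul1r opprD addrACA subrr addr0.
Qed.

Lemma time_shift t x a b : time (h_ t * x)%g a b = time x (a + t) (b + t).
Proof.
apply: le_anti; apply/andP; split; last exact: time_shift_le.
have := time_shift_le (- t) (h_ t * x)%g (a + t) (b + t).
by rewrite mulgA -h_add addNr h_0 mul1g !addrK.
Qed.

Lemma measurable_h_mul : measurable_fun [set: G * measurableTypeR R]
  (fun p : G * measurableTypeR R => (h_ p.2 * p.1)%g : G).
Proof.
apply: measurable_SL2; apply: forall_I2; apply: forall_I2;
  under eq_fun do rewrite SL2_mulE hE !mxE /=;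
  apply: measurable_funD; apply: measurable_funM;
  by [exact: measurable_cst | apply: measurableT_comp => //; exact: measurable_snd |
      apply: (measurableT_comp (measurable_entry _ _)); exact: measurable_fst].
Qed.

Definition orbit_graph : set (G * measurableTypeR R) := [set p | U (h_ p.2 * p.1)%g].

Lemma measurable_orbit_graph : measurable orbit_graph.
Proof.
by rewrite -[orbit_graph]setTI; apply: measurable_h_mul => //; exact: open_measurable_SL2.
Qed.

Lemma measurable_co_itv (a b : R) : measurable (`[a, b[%classic : set (measurableTypeR R)).
Proof. exact: measurable_itv. Qed.

Local Notation lamco a b := (mfrestr (measurable_co_itv a b) (lam_itv_fin a b)).

Lemma lamcoE x a b : (lamco a b) (xsection orbit_graph x) = (time x a b)%:E.
Proof. by rewrite -timeE /mfrestr /mrestr /= xsectionE. Qed.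

Lemma measurable_time a b : measurable_fun [set: G] (fun x : G => time x a b).
Proof.
have := measurable_fun_xsection (lamco a b) measurable_orbit_graph.
move=> m; apply/measurable_EFinP.
by apply: eq_measurable_fun m => x _; exact: lamcoE.
Qed.

Lemma rinv_time a b : rinv_fun (fun x : G => time x a b).
Proof.
move=> x g Gg; rewrite /time; congr (fine (lam (_ `&` _))); apply/seteqP.
by split=> r; rewrite /orbit_time /= mulgA => /(right_invariantE _ rU Gg).
Qed.

(** Fubini on the orbit graph: its slice at time [r] is a translate of [U], of the same measure as
    [U]. *)
Lemma mean_time b : 0 <= b -> E (fun x => time x 0 b) = b * fine (nu U).
Proof.
move=> b0; rewrite /mean.
have -> : (\int[nu]_x (time x 0 b)%:E = \int[lamco 0 b]_r nu U)%E.
  have := indic_fubini_tonelli nu (lamco 0 b) measurable_orbit_graph.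
  rewrite indic_fubini_tonelli_FE ?indic_fubini_tonelli_GE; try exact: measurable_orbit_graph.
  move=> e; transitivity (\int[nu]_x ((lamco 0 b) \o xsection orbit_graph) x)%E.
    by apply: eq_integral => x _ /=; rewrite -lamcoE.
  rewrite e; apply: eq_integral => r _ /=; rewrite ysectionE.
  by apply: (nu_mull (h_ r)); [exact: open_measurable_SL2|exact: rU].
have -> : (\int[lamco 0 b]_r nu U = nu U * (lamco 0 b) setT)%E by rewrite integral_cst.
have -> : (lamco 0 b) setT = b%:E.
  by rewrite -[in RHS](subr0 b) -lam_itv// -[in RHS](setTI `[0, b[%classic).
rewrite fineM//; first by rewrite mulrC.
by apply: fin_num_measure; exact: open_measurable_SL2.
Qed.

(** Its sums over integer shifts are the times spent in [U] by the continuous flow, so the discrete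
    ergodic theorem applies to the flow itself. *)
Definition unit_time : G -> R := fun x => time x 0 1.

Lemma unit_time01 x : 0 <= unit_time x <= 1.
Proof. by rewrite time_ge0 /= (le_trans (time_le _ ler01))// subr0. Qed.

Lemma bm_unit_time : bm unit_time.
Proof.
split; first exact: measurable_time.
by exists 1 => x; have /andP[u0 u1] := unit_time01 x; rewrite ger0_norm.
Qed.

Lemma rinv_unit_time : rinv_fun unit_time. Proof. exact: rinv_time. Qed.

Lemma shift_sum_time n x : shift_sum unit_time n x = time x 0 n%:R.
Proof.
elim: n => [|n IH].
  rewrite /shift_sum big_ord0; apply/eqP; rewrite eq_le time_ge0/=.
  by rewrite (le_trans (time_le _ (lexx 0)))// subrr.
rewrite /shift_sum big_ord_recr /= -/(shift_sum _ _ _) IH.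
rewrite (@time_split x 0 n%:R n.+1%:R)//; last by rewrite ler_nat.
by rewrite /unit_time time_shift add0r nat1r.
Qed.

Lemma shift_avg_time n x : shift_avg unit_time n x = n%:R^-1 * time x 0 n%:R.
Proof. by rewrite /shift_avg shift_sum_time. Qed.

Local Notation F n := (shift_avg unit_time n.+1).

Lemma mean_shift_avg n : E (F n) = fine (nu U).
Proof.
have -> : F n = (fun x : G => n.+1%:R^-1 * time x 0 n.+1%:R).
  by apply/funext => x; rewrite shift_avg_time.
rewrite meanZ ?mean_time//; first by rewrite mulrA mulVf ?mul1r// pnatr_eq0.
split; first exact: measurable_time.
exists n.+1%:R => x; rewrite ger0_norm ?time_ge0// (le_trans (time_le _ _))//.
by rewrite subr0.
Qed.

Lemma shift_avg_h s n x : `|F n (h_ s * x)%g - F n x| <= 2 * `|s| / n.+1%:R.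
Proof.
have n0 : 0 < n.+1%:R :> R by rewrite ltr0n.
rewrite !shift_avg_time -mulrBr normrM ger0_norm ?invr_ge0// mulrC ler_pM2r ?invr_gt0//.
rewrite time_shift add0r; set N := n.+1%:R : R.
have N0 : 0 <= N by exact: ltW.
have aux (t a : R) : 0 <= t -> `|time x (a + t) (a + N + t) - time x a (a + N)| <= 2 * t.
  move=> t0; have e1 := @time_split x a (a + t) (a + N + t); have e2 := @time_split x a (a + N) (a + N + t).
  have l1 := @time_le x a (a + t); have l2 := @time_le x (a + N) (a + N + t).
  have g1 := time_ge0 x a (a + t); have g2 := time_ge0 x (a + N) (a + N + t).
  have {}e1 := e1 ltac:(lra) ltac:(lra); have {}e2 := e2 ltac:(lra) ltac:(lra).
  have {}l1 := l1 ltac:(lra); have {}l2 := l2 ltac:(lra).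
  rewrite ler_norml; apply/andP; split; lra.
have [s0|s0] := leP 0 s; first by have := aux s 0 s0; rewrite !add0r (ger0_norm s0).
have := aux (- s) s; rewrite subrr addrAC subrr add0r distrC [N + s]addrC.
by rewrite (ltr0_norm s0); apply; rewrite oppr_ge0 ltW.
Qed.

Definition defect g n : R := E (fun x : G => `|F n (g * x)%g - F n x|).

(** An eventual bound in place of a limit: errors add under products, and the factorizations below
    have boundedly many factors, which may depend on [e]. *)
Definition almost_fixed g (e : R) := exists N, forall n, (N <= n)%N -> defect g n <= e.

Lemma bmF n : bm (F n). Proof. exact/bm_shift_avg/bm_unit_time. Qed.

Lemma rinvF n : rinv_fun (F n). Proof. exact/rinv_shift_avg/rinv_unit_time. Qed.

Lemma bmFg g n : bm (fun x : G => F n (g * x)%g).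
Proof. exact/bounded_measurable_mull/bmF. Qed.

Lemma F_norm_le1 n x : `|F n x| <= 1.
Proof.
apply: shift_avg_le => y; have /andP[u0 u1] := unit_time01 y.
by rewrite ger0_norm.
Qed.

Lemma bm_defect g n : bm (fun x : G => `|F n (g * x)%g - F n x|).
Proof. by apply: bounded_measurable_norm; apply: bounded_measurableB; [exact: bmFg|exact: bmF]. Qed.

Lemma rinv_defect g n : rinv_fun (fun x : G => `|F n (g * x)%g - F n x|).
Proof. by move=> x h Gh; rewrite mulgA !(@rinvF n _ h). Qed.

Lemma defectM g (g' : SL2 R) n : defect (g * g')%g n <= defect g n + defect g' n.
Proof.
have -> : defect g n = E (fun x : G => `|F n (g * g' * x)%g - F n (g' * x)%g|).
  rewrite /defect -(mean_mull g' (bm_defect g n) (rinv_defect g n)).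
  by congr (mean _ _); apply/funext => x; rewrite mulgA.
exact: (mean_norm_triangle nu (bmFg _ _) (bmFg _ _) (bmF _)).
Qed.

Lemma defectV g n : defect (g^-1)%g n = defect g n.
Proof.
rewrite /defect -(mean_mull g (bm_defect g^-1%g n) (@rinv_defect g^-1%g n)).
by congr (mean _ _); apply/funext => x; rewrite mulKg distrC.
Qed.

Lemma almost_fixedM g (g' : SL2 R) (e e' : R) :
  almost_fixed g e -> almost_fixed g' e' -> almost_fixed (g * g')%g (e + e').
Proof.
move=> [N gN] [N' gN']; exists (maxn N N') => n; rewrite geq_max => /andP[Nn N'n].
by apply: le_trans (defectM _ _ _) _; apply: lerD; [exact: gN|exact: gN'].
Qed.

Lemma almost_fixedV g (e : R) : almost_fixed g e -> almost_fixed (g^-1)%g e.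
Proof. by move=> [N gN]; exists N => n Nn; rewrite defectV; exact: gN. Qed.

Let V := fine (nu setT).
Let V0 : 0 <= V. Proof. exact: fine_ge0. Qed.

Lemma ex_nat_gt (c : R) : exists n : nat, c < n.+1%:R.
Proof.
exists (Num.bound `|c|); apply: le_lt_trans (ler_norm c) _.
by apply: lt_le_trans (archi_boundP (normr_ge0 c)) _; rewrite ler_nat.
Qed.

Lemma almost_fixed_h s (e : R) : 0 < e -> almost_fixed (h_ s) e.
Proof.
move=> e0; have [N NP] := ex_nat_gt (2 * `|s| * V / e); exists N => n Nn.
have n0 : 0 < n.+1%:R :> R by rewrite ltr0n.
apply: (@le_trans _ _ (2 * `|s| / n.+1%:R * V)).
  rewrite /V -mean_cst; apply: le_mean; [exact: bm_defect|exact: bounded_measurable_cst|].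
  by move=> x; exact: shift_avg_h.
rewrite mulrAC ler_pdivrMr// -ler_pdivrMl// mulrC; apply: ltW; apply: lt_le_trans NP _.
by rewrite ler_nat.
Qed.

(** Since [U] is open, a time at which the orbit of [x] is in [U] is also one for the orbit of
    [v k * x] once [k] is large. By dominated convergence the average cannot drop in the limit; only
    this one-sided statement holds at each point. *)
Lemma F_lsc n x (v : nat -> SL2 R) : v @ \oo --> (1%g : SL2 R) ->
  Num.max (F n x - F n (v k * x)%g) 0 @[k --> \oo] --> (0 : R).
Proof.
move=> v1; have n0 : 0 < n.+1%:R :> R by rewrite ltr0n.
pose I : set (measurableTypeR R) := `[0 : R, n.+1%:R[%classic.
pose A k : set (measurableTypeR R) := orbit_time x `\` orbit_time (v k * x)%g.
have mO y : measurable (orbit_time y : set (measurableTypeR R)) by exact: measurable_orbit_time.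
have mA k : measurable (A k) by apply: measurableD; exact: mO.
have mI : measurable I by exact: measurable_co_itv.
have finI : (lam I < +oo)%E by exact: lam_itv_fin.
have cvg0 : lam (A k `&` I) @[k --> \oo] --> (0 : \bar R)%E.
  have := @dominated_cvg _ (measurableTypeR R) R lam I mI (fun k r => (\1_(A k) r)%:E) (cst 0%E) (cst 1%E).
  have -> : (fun k => \int[lam]_(r in I) (\1_(A k) r)%:E)%E = (fun k => lam (A k `&` I)).
    by apply/funext => k; exact: integral_indic.
  rewrite integral0; apply.
  - by move=> k; apply/measurable_EFinP; exact: measurable_indic.
  - move=> r _; have [Ur|nUr] := pselect (orbit_time x r); last first.
      apply: cvg_near_cst; apply: nearW => k.
      by rewrite indicE memNset//= => -[].
    apply: cvg_near_cst.
    have c : (fun k => (h_ r * (v k * x))%g) @ \oo --> (h_ r * x)%g.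
      have cc : continuous (fun y : SL2 R => (h_ r * (y * x))%g).
        move=> y; apply: (@continuous_comp _ _ _ (fun y : SL2 R => (y * x)%g)
          (fun z : SL2 R => (h_ r * z)%g)); first exact: SL2_mulr_continuous.
        exact: SL2_mull_continuous.
      have := @cvg_comp _ _ _ v (fun y : SL2 R => (h_ r * (y * x))%g) _ _ _ v1 (cc 1%g).
      by rewrite mul1g.
    have : nbhs (h_ r * x)%g U by exact: open_nbhs_nbhs.
    move=> /c; apply: (@filterS _ (nbhs \oo)) => k /= Uk.
    by rewrite indicE memNset//= => -[_].
  - by [].
  - apply/integrableP; split; first exact: measurable_cst.
    have -> : (\int[lam]_(z in I) `|cst 1%E z| = \int[lam]_(z in I) cst 1%E z)%E.
      by apply: eq_integral => z _; rewrite /= normr1.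
    by rewrite integral_cst// mul1e.
  - by move=> k r _ /=; rewrite lee_fin indicE; case: (_ \in _) => /=; rewrite ?normr1 ?normr0.
have finA k : lam (A k `&` I) \is a fin_num.
  rewrite ge0_fin_numE//; apply: le_lt_trans finI.
  by apply: le_measure; rewrite ?inE//; exact: measurableI.
pose t k := fine (lam (A k `&` I)).
have t0 : t @ \oo --> (0 : R).
  by have /fine_cvgP[] := cvg0.
apply: (squeeze_cvgr _ (cvg_cst 0) t0).
near=> k; rewrite le_max lexx orbT /= ge_max fine_ge0// andbT.
rewrite !shift_avg_time -mulrBr.
have dt : time x 0 n.+1%:R - time (v k * x)%g 0 n.+1%:R <= t k.
  rewrite lerBlDl -lee_fin EFinD -!timeE /t fineK//.
  apply: le_trans (measureU2 _ _ _); last 2 first.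
  - by apply: measurableI => //; exact: mO.
  - exact: measurableI.
  apply: le_measure; rewrite ?inE.
  - by apply: measurableI => //; exact: mO.
  - apply: measurableU; last exact: measurableI.
    by apply: measurableI => //; exact: mO.
  move=> r [Or Ir]; have [Or'|nOr'] := pselect (orbit_time (v k * x)%g r); first by left.
  by right.
have tk0 : 0 <= t k by exact: fine_ge0.
rewrite ler_pdivrMl//; apply: le_trans dt _; rewrite ler_peMl//.
by rewrite ler1n.
Unshelve. all: by end_near. Qed.

(** Translation preserves the mean of [F n], so the gains and the losses in the difference have
    equal means. The defect is therefore twice the mean of the loss, which [F_lsc] controls. *)
Lemma F_translate_cvg n (v : nat -> SL2 R) : v @ \oo --> (1%g : SL2 R) ->
  defect (v k) n @[k --> \oo] --> (0 : R).
Proof.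
move=> v1; pose m k (x : G) : R := Num.max (F n x - F n (v k * x)%g) 0.
have bm_m k : bm (m k).
  split.
    apply: measurable_maxr; last exact: measurable_cst.
    by apply: measurable_funB; [exact: (bmF n).1|exact: (bmFg _ _).1].
  exists 2 => x; rewrite ger0_norm ?le_max ?lexx ?orbT// ge_max ler0n andbT.
  have := F_norm_le1 n x; have := F_norm_le1 n (v k * x)%g; rewrite !ler_norml.
  by move=> /andP[? ?] /andP[? ?]; lra.
have defE k : defect (v k) n = 2 * E (m k).
  have e : E (fun x : G => F n (v k * x)%g - F n x) = 0.
    by rewrite meanB ?mean_mull ?subrr//; [exact: bmF|exact: rinvF|exact: bmFg|exact: bmF].
  rewrite -meanZ// -[RHS]addr0 -e -meanD; last 2 first.
  - exact: bounded_measurableZ.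
  - by apply: bounded_measurableB; [exact: bmFg|exact: bmF].
  congr (mean _ _); apply/funext => x; rewrite /m.
  have [h|h] := leP (F n x - F n (v k * x)%g) 0.
    by rewrite mulr0 add0r ger0_norm// -oppr_le0 opprB.
  by rewrite distrC ger0_norm ?ltW//; lra.
have : (\int[nu]_x (m k x)%:E)%E @[k --> \oo] --> (\int[nu]_x (cst 0 x))%E.
  apply: (@dominated_cvg _ G R nu setT measurableT (fun k x => (m k x)%:E) (cst 0%E) (cst 2%:E)).
  - by move=> k; apply/measurable_EFinP; exact: (bm_m k).1.
  - move=> x _; apply: cvg_EFin; first exact: nearW.
    exact: F_lsc.
  - by [].
  - exact: finite_measure_integrable_cst.
  - move=> k x _ /=; rewrite lee_fin ger0_norm ?le_max ?lexx ?orbT//.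
    have [_ _] := bm_m k; rewrite ge_max ler0n andbT.
    have := F_norm_le1 n x; have := F_norm_le1 n (v k * x)%g; rewrite !ler_norml.
    by move=> /andP[? ?] /andP[? ?]; lra.
rewrite integral0 => /fine_cvgP[_ c].
have -> : (fun k => defect (v k) n) = (fun k => 2 * fine (\int[nu]_x (m k x)%:E)%E).
  by apply/funext => k; exact: defE.
by rewrite -[X in _ --> X](mulr0 2); apply: cvgM; [exact: cvg_cst|exact: c].
Qed.

Lemma upper_cvg1 (c : R) : (fun k => upper 1 (c / k.+1%:R)) @ \oo --> (1%g : SL2 R).
Proof.
move=> A /SL2_nbhsP[e e0 eA].
have [K KP] := ex_nat_gt (`|c| / e).
exists K => // k /= Kk; apply: eA => i j; rewrite upperE ?oner_neq0// SL2_mul1E.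
have k0 : 0 < k.+1%:R :> R by rewrite ltr0n.
have lt : `|c / k.+1%:R| < e.
  rewrite normrM (ger0_norm (_ : 0 <= k.+1%:R^-1)) ?invr_ge0//.
  rewrite ltr_pdivrMr// mulrC -ltr_pdivrMr//; apply: lt_le_trans KP _.
  by rewrite ler_nat.
by move: i j; apply: forall_I2; apply: forall_I2; rewrite !mxE /= ?invr1 ?subrr ?normr0 ?subr0.
Qed.

(** By the Cauchy property all indices [n >= N] reduce to the single index [N], for which
    translation is continuous in the mean; the bound is thus uniform in [n]. *)
Lemma almost_fixed_small (v : nat -> SL2 R) (e : R) : v @ \oo --> (1%g : SL2 R) -> 0 < e ->
  exists K, forall k, (K <= k)%N -> almost_fixed (v k) e.
Proof.
move=> v1 e0; have e3 : 0 < e / 3 by rewrite divr_gt0.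
have [N NP] := shift_avg_cauchy bm_unit_time rinv_unit_time unit_time01 e3.
have /cvgrPdist_le /(_ _ e3) [K _ KP] := @F_translate_cvg N v v1.
exists K => k Kk; exists N => n Nn.
have := KP k Kk; rewrite /= sub0r normrN ger0_norm; last exact: mean_ge0.
move=> h2; have h1 := NP n N Nn (leqnn N).
have t1 := mean_norm_triangle nu (bmFg (v k) n) (bmFg (v k) N) (bmF n).
have t2 := mean_norm_triangle nu (bmFg (v k) N) (bmF N) (bmF n).
have bB : bm (fun x : G => `|F n x - F N x|).
  by apply: bounded_measurable_norm; apply: bounded_measurableB; exact: bmF.
have rB : rinv_fun (fun x : G => `|F n x - F N x|).
  by move=> x h Gh; rewrite !(@rinvF _ _ h).
have e1 : E (fun x : G => `|F n (v k * x)%g - F N (v k * x)%g|) <= e / 3.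
  by rewrite (mean_mull (v k) bB rB).
have e2 : E (fun x : G => `|F N x - F n x|) <= e / 3 by exact: NP.
apply: le_trans t1 _; apply: le_trans (lerD e1 t2) _.
apply: le_trans (lerD (lexx _) (lerD h2 e2)) _.
by have -> : e / 3 + (e / 3 + e / 3) = e by field.
Qed.

Lemma almost_fixed_upper (c e : R) : 0 < e ->
  exists K, forall k, (K <= k)%N -> almost_fixed (upper 1 (c / k.+1%:R)) e.
Proof. by move=> e0; apply: (almost_fixed_small (@upper_cvg1 c) e0). Qed.

Lemma almost_fixed_mono g (e e' : R) : e <= e' -> almost_fixed g e -> almost_fixed g e'.
Proof. by move=> ee [N gN]; exists N => n /gN /le_trans; apply. Qed.

(* Mautner's phenomenon: for small b, upper a b is a product of elements of the
   lower unipotent group and an element close to 1. *)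
Lemma almost_fixed_diag (a e : R) : a != 0 -> 0 < e -> almost_fixed (upper a 0) e.
Proof.
move=> a0 e0; have e4 : 0 < e / 4 by rewrite divr_gt0.
have [K1 K1P] := almost_fixed_upper 1 e4.
have [K2 K2P] := almost_fixed_upper a^-1 e4.
pose k := maxn K1 K2; pose b : R := 1 / k.+1%:R.
have b0 : b != 0 by rewrite /b mul1r invr_eq0 pnatr_eq0.
have h1 : almost_fixed (upper a b) (e / 4 + e / 4 + e / 4).
  rewrite (upper_bruhat a0 b0); apply: almost_fixedM; last exact: almost_fixed_h.
  by apply: almost_fixedM; [exact: almost_fixed_h|exact/K1P/leq_maxl].
have h2 : almost_fixed (upper 1 (a^-1 / k.+1%:R))^-1%g (e / 4).
  by apply: almost_fixedV; exact/K2P/leq_maxr.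
have -> : upper a 0 = (upper a b * (upper 1 (a^-1 / k.+1%:R))^-1)%g.
  rewrite -[LHS](mulgK (upper 1 (a^-1 / k.+1%:R))) upper_mul ?oner_neq0//.
  by rewrite mulr1 mul0r addr0 mulrA divff// -/b.
by apply: almost_fixed_mono (almost_fixedM h1 h2); lra.
Qed.

(** Conjugation by a diagonal matrix with [a ^+ 2 = K + 1] takes the entry [c / (K + 1)], which is
    close to 0, to [c]. *)
Lemma almost_fixed_unipotent (c e : R) : 0 < e -> almost_fixed (upper 1 c) e.
Proof.
move=> e0; have e3 : 0 < e / 3 by rewrite divr_gt0.
have [K KP] := almost_fixed_upper c e3.
pose a : R := Num.sqrt K.+1%:R.
have a0 : a != 0 by rewrite gt_eqF// sqrtr_gt0 ltr0n.
have a0' : a^-1 != 0 by rewrite invr_eq0.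
have a2 : a * a = K.+1%:R by rewrite -expr2 sqr_sqrtr.
have -> : upper 1 c = (upper a 0 * upper 1 (c / K.+1%:R) * upper a^-1 0)%g.
  rewrite upper_mul ?oner_neq0// mulr1 upper_mul// divff//.
  congr upper; rewrite mulr0 add0r mul0r addr0 invrK mulrAC a2.
  by rewrite mulrC divfK// pnatr_eq0.
apply: almost_fixed_mono (almost_fixedM (almost_fixedM _ (KP K (leqnn K))) _); last 2 first.
- exact: (almost_fixed_diag a0 e3).
- exact: (almost_fixed_diag a0' e3).
lra.
Qed.

Lemma almost_fixed_all g (e : R) : 0 < e -> almost_fixed g e.
Proof.
have main (g' : SL2 R) (e' : R) : 0 < e' -> \val g' 1 1 != 0 -> almost_fixed g' e'.
  move=> e0 d0; have e3 : 0 < e' / 3 by rewrite divr_gt0.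
  rewrite (SL2_lower_upper d0).
  set a := (\val g' 1 1)^-1; set b := \val g' 0 1; set c := _ / _.
  have a0 : a != 0 by rewrite invr_eq0.
  have -> : upper a b = (upper a 0 * upper 1 (b / a))%g.
    by rewrite upper_mul ?oner_neq0// mulr1 mul0r addr0 mulrC divfK.
  apply: almost_fixed_mono (almost_fixedM (almost_fixedM _ _) _); last 3 first.
  - exact: (almost_fixed_diag a0 e3).
  - exact: almost_fixed_unipotent e3.
  - exact: almost_fixed_h e3.
  lra.
move=> e0; have [d0|] := eqVneq (\val g 1 1) 0; last exact: main.
have e2 : 0 < e / 2 by rewrite divr_gt0.
(* If the lower right entry vanishes, the upper right one does not, and multiplication by [h_ 1]
   subtracts the latter from the former. *)
have -> : g = ((h_ 1)^-1 * (h_ 1 * g))%g by rewrite mulKg.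
apply: almost_fixed_mono (almost_fixedM (almost_fixedV _) _); last 2 first.
- exact: almost_fixed_h e2.
- apply: (main _ _ e2); rewrite SL2_mulE hE !mxE /= d0 mulr0 addr0 mulN1r oppr_eq0.
  apply/eqP => b0; have := SL2_detE g; rewrite d0 b0 mulr0 mul0r subr0.
  by move/eqP; rewrite eq_sym oner_eq0.
lra.
Qed.

(* A synonym of haar carrying its sigma-finiteness. *)
Definition haar_ : set G -> \bar R := haar.
HB.instance Definition _ := Measure.on haar_.

Lemma haar_sigma_finite : sigma_finite setT haar_.
Proof.
exists (fun n => bounded_SL2 n%:R); first by rewrite bigcup_bounded_SL2.
by move=> n; split; [exact: measurable_bounded_SL2|exact: haar_bounded_SL2].
Qed.

HB.instance Definition _ := @Measure_isSigmaFinite.Build _ G R haar_ haar_sigma_finite.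

Lemma haar_integral_mull g (f : G -> \bar R) : mfun f -> (forall x, 0 <= f x)%E ->
  (\int[haar_]_x f (g * x)%g = \int[haar_]_x f x)%E.
Proof.
move=> mf f0; pose t (x : G) : G := (g * x)%g.
have mt : measurable_fun setT t by exact: mull_measurable.
transitivity (\int[pushforward haar_ t]_y f y)%E.
  rewrite (@ge0_integral_pushforward _ _ G G R t mt haar_ setT f measurableT mf);
    last by move=> y _; exact: f0.
  by rewrite preimage_setT; apply: eq_integral.
apply: eq_measure_integral => A mA _; rewrite /pushforward.
exact: haar_mull.
Qed.

Lemma measurable_invg_mul : measurable_fun [set: G * G] (fun p : G * G => (p.1^-1 * p.2)%g : G).
Proof.
have m1 i j : measurable_fun [set: G * G] (fun p : G * G => \val (p.1 : SL2 R) i j).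
  by apply: (measurableT_comp (measurable_entry i j)); exact: measurable_fst.
have m2 i j : measurable_fun [set: G * G] (fun p : G * G => \val (p.2 : SL2 R) i j).
  by apply: (measurableT_comp (measurable_entry i j)); exact: measurable_snd.
have m1N i j : measurable_fun [set: G * G] (fun p : G * G => - \val (p.1 : SL2 R) i j).
  by apply: measurableT_comp; [exact: oppr_measurable|exact: m1].
apply: measurable_SL2; apply: forall_I2; apply: forall_I2;
  under eq_fun do rewrite SL2_mulE SL2_invE !mxE /=;
  by apply: measurable_funD; apply: measurable_funM.
Qed.

Lemma bounded_SL2_mul (k : R) x (y : SL2 R) : 0 <= k ->
  bounded_SL2 k x -> bounded_SL2 2 y -> bounded_SL2 (4 * k) (x * y)%g.
Proof.
move=> k0 xk y2 i j; rewrite SL2_mulE; apply: le_trans (ler_normD _ _) _.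
rewrite !normrM.
have h a : `|\val x i a| * `|\val y a j| <= k * 2 by apply: ler_pM.

by have := h 0; have := h 1; lra.
Qed.

Lemma nu_total_gt0 : 0 < V.
Proof.
have [e e0 inj] := injective_box.
have ob : open (SL2_box (1%g : SL2 R) e) by exact: open_SL2_box.
have := @nu_ge_box (SL2_box 1%g e) (cst 1%E) 1 ob inj (measurable_cst _) (fun=> lee01)
  (fun x g _ => erefl) ler01 (fun x _ => lexx _).
rewrite mul1e integral_cst// mul1e => h.
have h0 : (0 < haar (SL2_box 1%g e : set G))%E.
  by apply: haar_open_gt0 => //; exists 1%g => i j; rewrite subrr normr0.
by rewrite /V -lte_fin fineK ?fin_num_measure//; exact: lt_le_trans h.
Qed.

Lemma nu_bounded (e : R) : 0 < e -> exists k : nat,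
  V - fine (nu (bounded_SL2 k%:R)) <= e.
Proof.
move=> e0; pose B (k : nat) : set G := bounded_SL2 k%:R.
have mB k : measurable (B k) by exact: measurable_bounded_SL2.
have ndB : {homo B : n m / (n <= m)%N >-> (n <= m)%O}.
  move=> n m nm; apply/subsetPset => g gn i j; apply: le_trans (gn i j) _.
  by rewrite ler_nat.
have BT : \bigcup_n B n = [set: G] by exact: bigcup_bounded_SL2.
have mBT : measurable (\bigcup_n B n) by rewrite BT; exact: measurableT.
have := @nondecreasing_cvg_mu _ G R nu B mB mBT ndB.
have VE : nu [set: G] = V%:E by rewrite fineK ?fin_num_measure.
rewrite BT [X in _ --> X]VE => /fine_cvgP[_ c].
have /cvgrPdist_le/(_ e e0)[K _ KP] := c.
exists K; apply: le_trans (ler_norm _) _.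
exact: (KP K (leqnn K)).
Qed.

Lemma defect_le n g : defect g n <= 2 * V.
Proof.
rewrite /V -mean_cst; apply: le_mean; [exact: bm_defect|exact: bounded_measurable_cst|].
move=> x /=; apply: le_trans (ler_normB _ _) _.
by have := F_norm_le1 n x; have := F_norm_le1 n (g * x)%g; lra.
Qed.

Definition discrepancy n (p : G * G) : R := `|F n (p.1^-1 * p.2)%g - F n p.2|.

Lemma measurable_discrepancy n : measurable_fun [set: G * G] (discrepancy n).
Proof.
apply: measurableT_comp => //; apply: measurable_funB.
  by apply: (measurableT_comp (bmF n).1); exact: measurable_invg_mul.
by apply: (measurableT_comp (bmF n).1); exact: measurable_snd.
Qed.

(** Large enough for all products of an element with entries up to [k] and an element of the unit
    box around 1, whose entries are at most 2. *)
Definition window (k : nat) : set G := bounded_SL2 (4 * k%:R).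

Lemma measurable_window k : measurable (window k).
Proof. exact: measurable_bounded_SL2. Qed.

Definition local_discrepancy k n (p : G * G) : \bar R :=
  (\1_(window k) p.1 * discrepancy n p)%:E.

Lemma local_discrepancy_ge0 k n p : (0 <= local_discrepancy k n p)%E.
Proof. by rewrite lee_fin; apply: mulr_ge0; [rewrite indicE; case: (_ \in _)|exact: normr_ge0]. Qed.

Lemma measurable_local_discrepancy k n :
  measurable_fun [set: G * G] (local_discrepancy k n).
Proof.
apply/measurable_EFinP; apply: measurable_funM; last exact: measurable_discrepancy.
apply: (@measurableT_comp _ _ _ _ _ _ (\1_(window k) : G -> R)); last exact: measurable_fst.
by apply: measurable_indic; exact: measurable_window.
Qed.

Lemma local_discrepancy_integral k n (g : SL2 R) :
  (\int[nu]_x local_discrepancy k n (g, x) =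
   (\1_(window k) (g : G) * defect (g^-1)%g n)%:E)%E.
Proof.
rewrite -meanZ; last exact: bm_defect.
by rewrite -meanE//; apply: bounded_measurableZ; exact: bm_defect.
Qed.

(** For fixed [g] the inner integral is, on the window, the defect of [g^-1], which tends to 0 and
    is at most [2 * V]. The window has finite Haar measure, so dominated convergence applies. *)
Lemma local_discrepancy_cvg0 k :
  (\int[haar_]_g \int[nu]_x local_discrepancy k n (g, x))%E @[n --> \oo] --> (0%E : \bar R).
Proof.
pose f (n : nat) (g : G) : \bar R := (\1_(window k) g * defect (g^-1)%g n)%:E.
have -> : (fun n => \int[haar_]_g \int[nu]_x local_discrepancy k n (g, x))%E =
    (fun n => \int[haar_]_g f n g)%E.
  by apply/funext => n; apply: eq_integral => g _; rewrite local_discrepancy_integral.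
have -> : (0 : \bar R)%E = (\int[haar_]_g cst 0%E g)%E by rewrite integral0.
apply: (@dominated_cvg _ G R haar_ setT measurableT f (cst 0%E)
   (fun g => (\1_(window k) g * (2 * V))%:E)).
- move=> n; have := measurable_fun_fubini_tonelli_F (m2 := nu) (local_discrepancy k n)
    (measurable_local_discrepancy k n) (local_discrepancy_ge0 k n).
  apply: eq_measurable_fun => g _.
  by rewrite /fubini_F /= local_discrepancy_integral.
- move=> g _; apply: cvg_EFin; first exact: nearW.
  apply/cvgrPdist_le => e e0 /=.
  have [N NP] := @almost_fixed_all (g^-1)%g e e0; exists N => // n /= Nn.
  rewrite /f /= sub0r normrN indicE.
  have d0 : 0 <= defect (g^-1)%g n by exact: mean_ge0.
  case: (_ \in _); rewrite ?mul1r ?mul0r ?normr0 ?ger0_norm//; first exact: NP.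
  exact: ltW.
- by [].
- apply/integrableP; split.
    apply/measurable_EFinP; apply: measurable_funM; last exact: measurable_cst.
    by apply: measurable_indic; exact: measurable_window.
  have V2 : 0 <= 2 * V by rewrite mulr_ge0.
  rewrite (_ : (\int[_]_x _)%E = (\int[haar_]_x ((2 * V)%:E * (\1_(window k) x)%:E))%E); last first.
    apply: eq_integral => x _; by rewrite /= -EFinM mulrC ger0_norm ?mulr_ge0.
  rewrite ge0_integralZl//; last first.
    by apply/measurable_EFinP; apply: measurable_indic; exact: measurable_window.
  rewrite integral_indic//; last exact: measurable_window.
  rewrite setIT lte_mul_pinfty//; exact: haar_bounded_SL2.
- move=> n g _ /=; rewrite lee_fin indicE.
  have d0 : 0 <= defect (g^-1)%g n by exact: mean_ge0.
  case: (_ \in _); rewrite ?mul1r ?mul0r ?normr0 ?ger0_norm//.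
  exact: defect_le.
Qed.

Local Notation unit_box := (SL2_box (1%g : SL2 R) 1 : set G).
Local Notation bounded k := (bounded_SL2 k%:R : set G).

Lemma haar_nu_swap (f : G * G -> \bar R) : measurable_fun [set: G * G] f ->
  (forall p, 0 <= f p)%E ->
  (\int[haar_]_g \int[nu]_x f (g, x) = \int[nu]_x \int[haar_]_g f (g, x))%E.
Proof.
move=> mf f0.
exact: (@fubini_tonelli _ _ G G R [the {sigma_finite_measure set G -> \bar R} of haar_] nu f mf f0).
Qed.

Lemma measurable_unit_box : measurable unit_box.
Proof. by apply: open_measurable_SL2; exact: open_SL2_box. Qed.

Lemma bm_indic (A : set G) (f : G -> R) : measurable A -> bm f ->
  bm (fun x : G => \1_A x * f x).
Proof.
move=> mA bf; apply: bounded_measurableM => //; split; first exact: measurable_indic.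
by exists 1 => x; rewrite indicE; case: (_ \in _); rewrite ?normr1 ?normr0.
Qed.

(** The local discrepancy after the substitution [g = x * v]: as [g^-1 * x = v^-1], the first value
    of [F n] no longer depends on [x]. This is where the constant approximating [F n] comes from. *)
Definition box_discrepancy k n (p : G * G) : \bar R :=
  (\1_unit_box p.1 * (\1_(bounded k) p.2 * `|F n (p.1^-1)%g - F n p.2|))%:E.

Lemma box_discrepancy_ge0 k n p : (0 <= box_discrepancy k n p)%E.
Proof.
by rewrite lee_fin mulr_ge0.
Qed.

Lemma measurable_box_discrepancy k n : measurable_fun [set: G * G] (box_discrepancy k n).
Proof.
have mi : measurable_fun setT (fun x : G => (x^-1)%g : G).
  apply: measurable_SL2; apply: forall_I2; apply: forall_I2; under eq_fun do rewrite SL2_invE mxE /=.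
  - exact: measurable_entry.
  - by apply: measurableT_comp; [exact: oppr_measurable|exact: measurable_entry].
  - by apply: measurableT_comp; [exact: oppr_measurable|exact: measurable_entry].
  - exact: measurable_entry.
apply/measurable_EFinP; apply: measurable_funM.
  apply: (@measurableT_comp _ _ _ _ _ _ (\1_unit_box : G -> R)); last exact: measurable_fst.
  by apply: measurable_indic; exact: measurable_unit_box.
apply: measurable_funM.
  apply: (@measurableT_comp _ _ _ _ _ _ (\1_(bounded k) : G -> R)); last exact: measurable_snd.
  by apply: measurable_indic; exact: measurable_bounded_SL2.
apply: measurableT_comp => //; apply: measurable_funB.
  apply: (measurableT_comp (bmF n).1).
  by apply: (measurableT_comp mi); exact: measurable_fst.
by apply: (measurableT_comp (bmF n).1); exact: measurable_snd.
Qed.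

Lemma box_discrepancy_le k n (v x : SL2 R) :
  (box_discrepancy k n (v : G, x : G) <= local_discrepancy k n ((x * v)%g : G, x : G))%E.
Proof.
rewrite /box_discrepancy /local_discrepancy /discrepancy /= lee_fin !indicE.
have [/set_mem vb|_] := boolP (v \in unit_box); last first.
  by rewrite mul0r mulr_ge0//; case: (_ \in _).
have [/set_mem xb|_] := boolP (x \in bounded k); last first.
  by rewrite mul0r mulr0 mulr_ge0//; case: (_ \in _).
have -> : ((x * v)^-1 * x = v^-1)%g by rewrite invgM mulgVK.
rewrite mem_set; first by rewrite !mul1r.
apply: bounded_SL2_mul => // i j; have := vb i j; rewrite SL2_mul1E mxE => h.
have h1 : `|((i == j)%:R : R)| <= 1 by case: (i == j); rewrite ?normr1 ?normr0.
by have := ler_dist_dist (\val v i j) (i == j)%:R; rewrite ler_norml => /andP[_]; lra.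
Qed.

(* Substituting g = x v in the integral of the local discrepancy. *)
Lemma local_discrepancy_ge k n (c : R) : 0 <= c ->
  (forall v, unit_box v -> c <= E (fun x : G => \1_(bounded k) x * `|F n (v^-1)%g - F n x|)) ->
  (c%:E * haar unit_box <= \int[haar_]_g \int[nu]_x local_discrepancy k n (g, x))%E.
Proof.
move=> c0 cE.
rewrite (haar_nu_swap (measurable_local_discrepancy k n) (local_discrepancy_ge0 k n)).
apply: (@le_trans _ _ (\int[nu]_x \int[haar_]_v box_discrepancy k n (v, x))%E); last first.
  apply: ge0_le_integral => //.
  - by move=> x _; apply: integral_ge0 => v _; exact: box_discrepancy_ge0.
  - have := measurable_fun_fubini_tonelli_G (m1 := [the {sigma_finite_measure set G -> \bar R} of haar_])
      _ (measurable_box_discrepancy k n) (box_discrepancy_ge0 k n).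
    by apply: eq_measurable_fun.
  - have := measurable_fun_fubini_tonelli_G (m1 := [the {sigma_finite_measure set G -> \bar R} of haar_])
      _ (measurable_local_discrepancy k n) (local_discrepancy_ge0 k n).
    by apply: eq_measurable_fun.
  move=> x _.
  have mx : mfun (fun g : G => local_discrepancy k n (g, x)).
    exact: measurableT_comp (measurable_local_discrepancy k n) (measurable_pair2 x).
  rewrite -(haar_integral_mull x mx); last by move=> g; exact: local_discrepancy_ge0.
  apply: ge0_le_integral => //.
  - by move=> v _; exact: box_discrepancy_ge0.
  - exact: measurableT_comp (measurable_box_discrepancy k n) (measurable_pair2 x).
  - by apply: (measurableT_comp mx); exact: mull_measurable.
  - by move=> v _; exact: box_discrepancy_le.
rewrite -(haar_nu_swap (measurable_box_discrepancy k n) (box_discrepancy_ge0 k n)).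
have -> : (c%:E * haar unit_box = \int[haar_]_v (c * \1_unit_box v)%:E)%E.
  under [RHS]eq_integral do rewrite EFinM.
  rewrite ge0_integralZl//; last first.
    by apply/measurable_EFinP; apply: measurable_indic; exact: measurable_unit_box.
  by rewrite integral_indic ?setIT//; exact: measurable_unit_box.
apply: ge0_le_integral => //.
- by move=> v _; rewrite lee_fin mulr_ge0//; rewrite indicE; case: (_ \in _).
- apply/measurable_EFinP; apply: measurable_funM; first exact: measurable_cst.
  by apply: measurable_indic; exact: measurable_unit_box.
- have := measurable_fun_fubini_tonelli_F (m2 := nu)
    _ (measurable_box_discrepancy k n) (box_discrepancy_ge0 k n).
  by apply: eq_measurable_fun.
move=> v _; rewrite /box_discrepancy /= indicE.
have [/set_mem vb|_] := boolP (v \in unit_box); last first.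
  by rewrite mulr0; apply: integral_ge0 => x _; rewrite mul0r.
rewrite mulr1; under eq_integral do rewrite mul1r.
rewrite meanE; first by rewrite lee_fin; exact: cE.
apply: bm_indic; first exact: measurable_bounded_SL2.
apply: bounded_measurable_norm; apply: bounded_measurableB; last exact: bmF.
exact: bounded_measurable_cst.
Qed.

(* F n is almost invariant under every translation, so in the mean it is close
   to its value at most points. *)
Lemma F_near_value (e : R) : 0 < e -> exists N, forall n, (N <= n)%N ->
  exists c : R, E (fun x : G => `|F n x - c|) <= e.
Proof.
move=> e0; have e3 : 0 < e / 3 by rewrite divr_gt0.
(* Outside this bounded set the deviation is at most 2 on a mass of at most [e / 3]; the remaining
   third of [e] is left for the inside. *)
have [k kP] := nu_bounded e3.
have mB : measurable (bounded k) by exact: measurable_bounded_SL2.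
have b0 : (0 < haar unit_box)%E.
  by apply: haar_open_gt0; [exact: open_SL2_box|exists 1%g => i j; rewrite subrr normr0].
have [N NP] : exists N, forall n, (N <= n)%N ->
    (\int[haar_]_g \int[nu]_x local_discrepancy k n (g, x) < (e / 3)%:E * haar unit_box)%E.
  have lt : (0 < (e / 3)%:E * haar unit_box)%E by rewrite mule_gt0// lte_fin.
  have [N _ NP] := @local_discrepancy_cvg0 k _ (open_ereal_lt' lt).
  by exists N.
exists N => n Nn.
(* If no [v] worked, the integral of the local discrepancy would be at least [e / 3] times the Haar
   measure of the box. *)
have [v vb vE] : exists2 v, unit_box v &
    E (fun x : G => \1_(bounded k) x * `|F n (v^-1)%g - F n x|) < e / 3.
  apply: contrapT => nv; have := NP n Nn; apply/negP; rewrite -leNgt.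
  apply: local_discrepancy_ge; first exact: ltW.
  move=> v vb; rewrite leNgt; apply/negP => h; apply: nv; by exists v.
exists (F n v^-1%g).
have b1 : bm (fun x : G => `|F n v^-1%g - F n x|).
  apply: bounded_measurable_norm; apply: bounded_measurableB; last exact: bmF.
  exact: bounded_measurable_cst.
have b2 : bm (fun x : G => \1_(bounded k) x * `|F n v^-1%g - F n x|) by exact: bm_indic.
have b3 : bm (fun x : G => (\1_(~` (bounded k)) x : R) * cst (2 : R) x).
  by apply: bm_indic; [exact: measurableC|exact: bounded_measurable_cst].
have E3 : E (fun x : G => (\1_(~` (bounded k)) x : R) * cst (2 : R) x) <= 2 * (e / 3).
  have -> : (fun x : G => (\1_(~` (bounded k)) x : R) * cst (2 : R) x) =
      (fun x : G => 2 * \1_(~` (bounded k)) x).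
    by apply/funext => x; rewrite mulrC.
  have bi : bm (\1_(~` (bounded k)) : G -> R).
    have := bm_indic (measurableC mB) (bounded_measurable_cst G 1).
    by under eq_fun do rewrite mulr1.
  rewrite meanZ// ler_pM2l// /mean integral_indic ?setIT//; last exact: measurableC.
  apply: le_trans kP; rewrite -setTD measureD//; last by rewrite ltey_eq fin_num_measure.
  by rewrite setTI fineB ?fin_num_measure.
apply: (@le_trans _ _ (E (fun x : G => \1_(bounded k) x * `|F n v^-1%g - F n x| +
    \1_(~` (bounded k)) x * cst (2 : R) x))).
  apply: le_mean; [|exact: bounded_measurableD|].
    by under eq_fun do rewrite distrC.
  move=> x; rewrite distrC !indicE in_setC.
  case: (_ \in _); rewrite /= ?mul1r ?mul0r ?addr0 ?add0r//.
  apply: le_trans (ler_normB _ _) _.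
  by have := F_norm_le1 n x; have := F_norm_le1 n v^-1%g; lra.
rewrite meanD//; have key (a b t : R) : a < t / 3 -> b <= 2 * (t / 3) -> a + b <= t by move=> *; lra.
exact: key.
Qed.

(** As [F n] has mean [nu U], replacing the constant [c] by [nu U / V] costs no more than the error
    made with [c]. *)
Lemma F_mean_cvg (e : R) : 0 < e -> exists N, forall n, (N <= n)%N ->
  E (fun x : G => `|F n x - fine (nu U) / V|) <= e.
Proof.
move=> e0; have [N NP] := F_near_value (divr_gt0 e0 (ltr0Sn R 1)); exists N => n Nn.
have [c cP] := NP n Nn; set m := fine (nu U) / V.
have V1 := nu_total_gt0.
have b1 : bm (fun x : G => F n x - c).
  by apply: bounded_measurableB; [exact: bmF|exact: bounded_measurable_cst].
have b2 := bounded_measurable_norm b1.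
have Em : E (fun x : G => F n x - c) = fine (nu U) - c * V.
  rewrite meanB ?mean_shift_avg; [|exact: bmF|exact: bounded_measurable_cst].
  by rewrite [X in _ - X]mean_cst.
have h1 : `|fine (nu U) - c * V| <= E (fun x : G => `|F n x - c|).
  rewrite -Em ler_norml; apply/andP; split; last by apply: le_mean => // x; exact: ler_norm.
  rewrite -mulN1r -meanZ//; apply: le_mean => //; first exact: bounded_measurableZ.
  by move=> x; rewrite mulN1r lerNl -normrN; exact: ler_norm.
have h2 : E (fun x : G => `|c - m|) = `|fine (nu U) - c * V|.
  rewrite -[LHS]/(E (cst `|c - m|)) mean_cst -[X in _ * X = _](gtr0_norm V1) -normrM distrC.
  by rewrite mulrBl /m divfK ?gt_eqF.
have := mean_norm_triangle nu (bmF n) (bounded_measurable_cst G c) (bounded_measurable_cst G m).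
move=> /le_trans; apply; rewrite [X in _ + X]h2 [leRHS]splitr.
by apply: lerD => //; exact: le_trans cP.
Qed.

(** * Equidistribution of expanding arcs *)

Lemma time_avg_floor (x : SL2 R) n (L : R) : n.+1%:R <= L -> L <= n.+2%:R ->
  `|L^-1 * time x 0 L - F n x| <= 2 / L.
Proof.
move=> nL Ln; have n0 : 0 < n.+1%:R :> R by rewrite ltr0n.
have L0 : 0 < L by exact: lt_le_trans nL.
rewrite shift_avg_time.
have sp : time x 0 L = time x 0 n.+1%:R + time x n.+1%:R L.
  by apply: time_split => //; exact: ltW.
have t1 : time x n.+1%:R L <= 1.
  by apply: le_trans (time_le _ nL) _; rewrite lerBlDr nat1r.
have t2 := time_ge0 x n.+1%:R L.
have t3 : time x 0 n.+1%:R <= n.+1%:R.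
  by apply: le_trans (time_le _ (ltW n0)) _; rewrite subr0.
have t4 := time_ge0 x 0 n.+1%:R.
rewrite sp; move: Ln; rewrite -natr1; move: (time x 0 _) (time x _ L) t1 t2 t3 t4 => t t' t1 t2 t3 t4.
move: n.+1%:R n0 nL t3 => p p0 pL t3 Lp.
have -> : L^-1 * (t + t') - p^-1 * t = (t' - (L - p) * (t / p)) / L by field; rewrite !gt_eqF.
rewrite normrM (ger0_norm (_ : 0 <= L^-1)) ?invr_ge0 ?(ltW L0)// ler_pM2r ?invr_gt0//.
have tp : t / p <= 1 by rewrite ler_pdivrMr// mul1r.
have tp0 : 0 <= t / p by rewrite divr_ge0// ltW.
have h1 : (L - p) * (t / p) <= 1.
  by rewrite -[leRHS]mulr1; apply: ler_pM => //; lra.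
have h0 : 0 <= (L - p) * (t / p) by rewrite mulr_ge0//; lra.
by move: (_ * (t / p)) h1 h0 => u h1 h0; rewrite ler_norml; apply/andP; split; lra.
Qed.

Local Notation density := (fine (nu U) / V).

Lemma bm_time (b L : R) : 0 <= L -> bm (fun x : G => b * time x 0 L).
Proof.
move=> L0; apply: bounded_measurableZ; split; first exact: measurable_time.
by exists L => x; rewrite ger0_norm ?time_ge0// (le_trans (time_le _ L0))// subr0.
Qed.

Lemma time_mean_cvg (e : R) : 0 < e -> exists2 L0 : R, 0 < L0 & forall L, L0 <= L ->
  E (fun x : G => `|L^-1 * time x 0 L - density|) <= e.
Proof.
move=> e0; have e2 : 0 < e / 2 by rewrite divr_gt0.
have [N NP] := F_mean_cvg e2; have V1 := nu_total_gt0.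
exists (Num.max N.+1%:R (2 * V / (e / 2))); first by rewrite lt_max ltr0n.
move=> L; rewrite ge_max => /andP[NL VL].
have L0 : 0 < L by apply: lt_le_trans NL; rewrite ltr0n.
have /andP[m1 m2] := truncn_itv (ltW L0).
have mN : (N < Num.truncn L)%N by rewrite -ltnS -(@ltr_nat R); exact: le_lt_trans m2.
have mE : (Num.truncn L).-1.+1 = Num.truncn L by rewrite prednK//; exact: leq_ltn_trans mN.
set n := (Num.truncn L).-1 in mE.
have tn x : `|L^-1 * time x 0 L - F n x| <= 2 / L.
  by apply: time_avg_floor; rewrite mE// ltW.
have := mean_norm_triangle nu (bm_time L^-1 (ltW L0)) (bmF n) (bounded_measurable_cst G density).
move=> /le_trans; apply; rewrite [leRHS]splitr; apply: lerD; last first.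
  by apply: NP; rewrite -ltnS mE.
apply: (@le_trans _ _ (E (cst (2 / L)))).
  apply: le_mean; last exact: tn.
    by apply: bounded_measurable_norm; apply: bounded_measurableB; [exact: bm_time (ltW L0)|exact: bmF].
  exact: bounded_measurable_cst.
rewrite mean_cst -/V mulrAC ler_pdivrMr// [leRHS]mulrC -ler_pdivrMr//.
Qed.

Definition arc (a s0 l : R) (x : SL2 R) : set R :=
  [set s | s0 <= s < s0 + l /\ U (upper a 0 * h_ s * x)%g].

Lemma measurable_arc a s0 l x : measurable (arc a s0 l x).
Proof.
have -> : arc a s0 l x = `[s0, (s0 + l)[%classic `&` [set s | U (upper a 0 * (h_ s * x))%g].
  by apply/seteqP; split=> s; rewrite /= in_itv /= mulgA.
apply: measurableI => //; apply: open_measurable.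
apply: (@open_comp _ _ (fun r => (upper a 0 * (h_ r * x))%g)) => // r _.
apply: continuous_SL2_mul; first exact: cst_continuous.
apply: continuous_SL2_mul; first exact: h_continuous.
exact: cst_continuous.
Qed.

(** Since [a h_s x = h_((s - s0) / a^2) (a h_s0 x)], the arc is an orbit segment with time rescaled
    by [a ^+ 2]. Both inequalities are Lipschitz bounds, for this affine map and its inverse. *)
Lemma arcE (a s0 l : R) x : 0 < a -> 0 <= l ->
  lam (arc a s0 l x) = (a ^+ 2 * time (upper a 0 * h_ s0 * x)%g 0 (l / a ^+ 2))%:E.
Proof.
move=> a0 l0; have a2 : 0 < a ^+ 2 by rewrite exprn_gt0.
have act s : (upper a 0 * h_ s * x)%g = (h_ ((s - s0) / a ^+ 2) * (upper a 0 * h_ s0 * x))%g.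
  by rewrite -{1}[s](subrK s0) h_add !mulgA upper_h ?gt_eqF.
rewrite EFinM -timeE; apply/eqP; rewrite eq_le; apply/andP; split.
  apply: (@lebesgue_measure_lipschitz _ _ _ (fun t => s0 + a ^+ 2 * t)) => //.
  - exact: measurable_arc.
  - move=> s [/andP[s1 s2] Us]; exists ((s - s0) / a ^+ 2); last first.
      by rewrite mulrC divfK ?gt_eqF// addrC subrK.
    split; first by rewrite /orbit_time /= -act.
    rewrite /= in_itv /= divr_ge0 ?subr_ge0 ?(ltW a2)//=.
    by rewrite ltr_pM2r ?invr_gt0// ltrBlDl.
  - move=> s t _ _; rewrite opprD addrACA subrr add0r -mulrBr normrM.
    by rewrite (gtr0_norm a2).
rewrite -lee_pdivlMl//.
apply: (@lebesgue_measure_lipschitz _ _ _ (fun s => (s - s0) / a ^+ 2)) => //.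
- by apply: measurableI => //; exact: measurable_orbit_time.
- by rewrite invr_gt0.
- move=> t [Ut]; rewrite /= in_itv /= => /andP[t0 tl].
  have tE : (s0 + a ^+ 2 * t - s0) / a ^+ 2 = t by rewrite addrAC subrr add0r mulrC mulKf// gt_eqF.
  exists (s0 + a ^+ 2 * t) => //; split; last by rewrite act tE.
  rewrite lerDl mulr_ge0 ?(ltW a2)//= ltrD2l.
  by rewrite mulrC -ltr_pdivlMr.
- move=> s t _ _; rewrite -mulrBl opprB addrA subrK normrM [leRHS]mulrC.
  by rewrite (gtr0_norm (_ : 0 < (a ^+ 2)^-1)) ?invr_gt0.
Qed.

(* Most points are generic, hence so is some point close to 1. *)
Lemma ex_generic_arc (s0 l r e : R) : 0 < l -> 0 < r -> 0 < e ->
  exists2 a0 : R, 0 < a0 & forall a : R, 0 < a -> a < a0 ->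
  exists2 g : SL2 R, SL2_box 1%g r g &
    `|l^-1 * fine (lam (arc a s0 l g)) - density| <= e.
Proof.
move=> l0 r0 e0; have [r' r'0 inj] := injective_box.
pose d := Num.min r r'; have d0 : 0 < d by rewrite lt_min r0.
pose W : set (SL2 R) := SL2_box 1%g d.
have oW : open W by exact: open_SL2_box.
have W0 : (0 < haar (W : set G))%E.
  by apply: haar_open_gt0 => //; exists 1%g => i j; rewrite subrr normr0.
(* A mean of at most [e'] is incompatible with a deviation above [e] everywhere on [W]. The right
   side is not yet known to be finite, hence the case split. *)
have [e' e'0 e'W] : exists2 e' : R, 0 < e' & (e'%:E < e%:E * haar (W : set G))%E.
  have : (0 < e%:E * haar (W : set G))%E by rewrite mule_gt0 // lte_fin.
  case: (_ * _)%E => [q| |//].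
    by rewrite lte_fin => q0; exists (q / 2); rewrite ?divr_gt0// lte_fin ltr_pdivrMr// ltr_pMr// ltr1n.
  by move=> _; exists 1 => //; exact: ltry.
have [L0 L00 LP] := time_mean_cvg e'0.
(* Below this value of [a] the orbit segment has length [l / a ^+ 2 >= L0]. *)
exists (Num.sqrt (l / L0)); first by rewrite sqrtr_gt0 divr_gt0.
move=> a a0 aL; have a2 : 0 < a ^+ 2 by rewrite exprn_gt0.
have lL : L0 <= l / a ^+ 2.
  rewrite ler_pdivlMr// mulrC -ler_pdivlMr//.
  have lL0 : 0 <= l / L0 by rewrite divr_ge0// ltW.
  by rewrite -(sqr_sqrtr lL0) ler_sqr ?nnegrE ?sqrtr_ge0 ?ltW.
pose L := l / a ^+ 2; have L1 : 0 < L by rewrite divr_gt0.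
pose y := (upper a 0 * h_ s0)%g : SL2 R.
pose f (x : G) : R := `|L^-1 * time x 0 L - density|.
have bf : bm f.
  apply: bounded_measurable_norm; apply: bounded_measurableB; first exact: bm_time (ltW L1).
  exact: bounded_measurable_cst.
have rf : rinv_fun f by move=> x h Gh; rewrite /f (rinv_time _ _ x Gh).
have Ef : E (fun x : G => f (y * x)%g) <= e' by rewrite mean_mull//; exact: LP.
have arcf g : `|l^-1 * fine (lam (arc a s0 l g)) - density| = f (y * g)%g.
  rewrite arcE ?(ltW l0)//= /f; congr (`|_ - _|).
  by rewrite mulrA /y /L invf_div [_ / l]mulrC.
apply: contrapT => ng.
have : (e%:E * haar (W : set G) <= \int[nu]_x (f (y * x)%g)%:E)%E.
  apply: nu_ge_box => //.
  - move=> x z g xW zW; apply: inj.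
      by move=> i j; apply: lt_le_trans (xW i j) _; rewrite ge_min lexx orbT.
    by move=> i j; apply: lt_le_trans (zW i j) _; rewrite ge_min lexx orbT.
  - by apply/measurable_EFinP; exact: (bounded_measurable_mull y bf).1.
  - by move=> x; rewrite lee_fin /f.
  - by move=> x g Gg; rewrite mulgA (rf _ g).
  - exact: ltW.
  - move=> x Wx; rewrite lee_fin leNgt; apply/negP => fe; apply: ng; exists x.
      by move=> i j; apply: lt_le_trans (Wx i j) _; rewrite ge_min lexx.
    by rewrite arcf ltW.
rewrite meanE; last exact: bounded_measurable_mull.
move=> /(lt_le_trans e'W); rewrite lte_fin => h.
by move: Ef; rewrite leNgt h.
Qed.

End OrbitTime.

(** * Comparison of the arc through the identity with a generic arc *)

Section Visits.
Variable Lam : set 'cV[R]_2.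
Hypothesis LamP : forall g z, Gamma g -> Lam z -> Lam (\val g *m z).
Variable alpha : R.
Hypothesis alpha0 : 0 < alpha.
Local Notation hit := (hit Lam).
Local Notation lam := (@lebesgue_measure R).
Local Notation density A := (fine (nu A) / fine (nu [set: G])).

Lemma rinv_hit T : right_invariant (hit T).
Proof.
move=> x g Gg [z Lz xz]; exists (\val (g^-1)%g *m z); first by apply: LamP => //; exact: GammaV.
by rewrite mulmxA -SL2_mulmx mulgK.
Qed.

Definition visits a (T : R) : set R :=
  [set s | 0 <= s <= alpha /\ hit T (upper a 0 * h_ s)%g].

Lemma measurable_visits a T : measurable (visits a T).
Proof.
have -> : visits a T = `[0, alpha]%classic `&` [set s | hit T (upper a 0 * h_ s)%g].
  by apply/seteqP; split=> s; rewrite /= in_itv.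
apply: measurableI => //; apply: open_measurable.
apply: (@open_comp _ _ (fun r => (upper a 0 * h_ r)%g)); last exact: open_hit.
move=> r _; apply: continuous_SL2_mul; first exact: cst_continuous.
exact: h_continuous.
Qed.

Lemma density_dilated (K T : R) :
  density [set x : SL2 R | hit T (upper K 0 * x)%g] = density (hit T).
Proof.
by congr (fine _ / _); apply: nu_mull; [apply: open_measurable_SL2; exact: open_hit|exact: rinv_hit].
Qed.

Section Bounds.
Variables (K rho T : R).
Hypotheses (K1 : 1 < K) (rho0 : 0 < rho) (rhoK : 2 * (K * rho) <= K - 1) (T0 : 0 < T).

Let rho2 : rho <= 2^-1.
Proof.
have K0 : 0 < K by exact: lt_trans K1.
by rewrite -(ler_pM2l K0); move: rhoK; lra.
Qed.

(** Every parameter met lies within [3 * rho <= 3 / 2] of [[0, alpha]]. *)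
Let S := alpha + 2.
Let S0 : 0 <= S. Proof. by rewrite addr_ge0// ltW. Qed.

Let r := rho / (1 + S) ^+ 2.
Let r0 : 0 < r.
Proof. by rewrite divr_gt0// exprn_gt0// ltr_pwDl. Qed.

Let lam_arc_le (U : set (SL2 R)) (a s0 l : R) g (d : R) : open U -> 0 < a -> 0 < l ->
  `|l^-1 * fine (lam (arc U a s0 l g)) - d| <= rho ->
  (lam (arc U a s0 l g) <= (l * (d + rho))%:E)%E.
Proof.
move=> oU a0 l0; rewrite arcE ?(ltW l0)//= lee_fin ler_norml => /andP[_ h].
by rewrite -ler_pdivrMl//; move: (_ * _) h => ?; lra.
Qed.

Let lam_arc_ge (U : set (SL2 R)) (a s0 l : R) g (d : R) : open U -> 0 < a -> 0 < l ->
  `|l^-1 * fine (lam (arc U a s0 l g)) - d| <= rho ->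
  ((l * (d - rho))%:E <= lam (arc U a s0 l g))%E.
Proof.
move=> oU a0 l0; rewrite arcE ?(ltW l0)//= lee_fin ler_norml => /andP[h _].
by rewrite -ler_pdivlMl//; move: (_ * _) h => ?; lra.
Qed.

(** Moebius maps move the parameters by at most [2 * rho]; the margin [3 * rho] also takes care of
    the half-open end of [arc]. *)
Let widen (m u : R) : 0 <= u <= alpha -> `|m - u| <= 2 * rho ->
  - (3 * rho) <= m < - (3 * rho) + (alpha + 6 * rho).
Proof.
move: rho0; rewrite ler_norml => ? /andP[? ?] /andP[? ?]; apply/andP; split; lra.
Qed.

Let shrink (m u : R) : 3 * rho <= u < 3 * rho + (alpha - 6 * rho) ->
  `|m - u| <= 2 * rho -> 0 <= m <= alpha.
Proof.
move: rho0; rewrite ler_norml => ? /andP[? ?] /andP[? ?]; apply/andP; split; lra.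
Qed.

Let widen_le (s : R) : - (3 * rho) <= s < - (3 * rho) + (alpha + 6 * rho) -> `|s| <= S.
Proof.
rewrite /S ler_norml; move: rho0 rho2 alpha0 => ? ? ? /andP[? ?].
by apply/andP; split; lra.
Qed.

Let closed_le (s : R) : 0 <= s <= alpha -> `|s| <= S.
Proof.
by move=> /andP[? ?]; rewrite ger0_norm// /S (le_trans (_ : _ <= alpha))// lerDl.
Qed.

Let shrink_le (s : R) : 3 * rho <= s < 3 * rho + (alpha - 6 * rho) -> `|s| <= S.
Proof.
rewrite /S ler_norml; move: rho0 rho2 alpha0 => ? ? ? /andP[? ?].
by apply/andP; split; lra.
Qed.

Let rho6 : 0 < 1 + 6 * rho.
Proof. by rewrite ltr_pwDl// mulr_ge0// ltW. Qed.

(** Each visit is the image under [moebius g] of a time at which the arc through [g] is in the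
    dilated set [U]. The Lipschitz constant of [moebius g] bounds the change of measure, and
    [density_dilated] removes the dilation. *)
Lemma visits_le : exists2 a0 : R, 0 < a0 & forall a : R, 0 < a -> a < a0 ->
  (lam (visits a T) <=
   ((1 + 6 * rho) * ((alpha + 6 * rho) * (density (hit (K ^+ 2 * T)) + rho)))%:E)%E.
Proof.
pose U := [set x : SL2 R | hit (K ^+ 2 * T) (upper K 0 * x)%g].
have oU : open U by apply: open_mull; exact: open_hit.
have rU : right_invariant U.
  by move=> x g Gg; rewrite /U /= mulgA; exact: rinv_hit.
have l0 : 0 < alpha + 6 * rho by rewrite addr_gt0// mulr_gt0.
have [a0 a00 a0P] := ex_generic_arc oU rU (- (3 * rho)) l0 r0 rho0.
exists (Num.min a0 1); first by rewrite lt_min a00 ltr01.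
move=> a aa; rewrite lt_min => /andP[aa0 /ltW a1].
have [g g1 gP] := a0P a aa aa0.
have g1V := SL2_box_inv g1.
rewrite density_dilated in gP; have := lam_arc_le oU aa l0 gP => arcle.
rewrite EFinM; apply: (@le_trans _ _ ((1 + 6 * rho)%:E *
    lam (arc U a (- (3 * rho)) (alpha + 6 * rho) g))%E); last first.
  by rewrite lee_pmul2l// lte_fin.
apply: (@lebesgue_measure_lipschitz _ _ _ (moebius g)) => //.
- exact: measurable_visits.
- move=> u [u0 uh]; have uS := closed_le u0.
  have D0 := denominator_gt0 S0 rho0 rho2 g1V uS.
  exists (moebius (g^-1)%g u); last by have := moebiusK (lt0r_neq0 D0); rewrite invgK.
  split.
    exact: widen u0 (moebius_close S0 rho0 rho2 g1V uS).
  by have := hit_moebius_inv K1 rho0 rhoK S0 aa a1 T0 g1V uS uh; rewrite invgK.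
- move=> s t [/widen_le sS _] [/widen_le tS _].
  exact: (moebius_lipschitz S0 rho0 rho2 g1).
Qed.

(** The roles are exchanged: [moebius g] sends the times of the generic arc to visits. That arc is
    shortened by [3 * rho] at both ends to keep the visits in [[0, alpha]]. *)
Lemma visits_ge : 6 * rho < alpha ->
  exists2 a0 : R, 0 < a0 & forall a : R, 0 < a -> a < a0 ->
  (((alpha - 6 * rho) * (density (hit T) - rho))%:E <=
   (1 + 6 * rho)%:E * lam (visits a (K ^+ 2 * T)))%E.
Proof.
move=> rhoa; pose U := [set x : SL2 R | hit T (upper K^-1%R 0 * x)%g].
have oU : open U by apply: open_mull; exact: open_hit.
have rU : right_invariant U.
  by move=> x g Gg; rewrite /U /= mulgA; exact: rinv_hit.
have l0 : 0 < alpha - 6 * rho by rewrite subr_gt0.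
have [a0 a00 a0P] := ex_generic_arc oU rU (3 * rho) l0 r0 rho0.
exists (Num.min a0 1); first by rewrite lt_min a00 ltr01.
move=> a aa; rewrite lt_min => /andP[aa0 /ltW a1].
have [g g1 gP] := a0P a aa aa0.
have g1V := SL2_box_inv g1.
rewrite density_dilated in gP; apply: le_trans (lam_arc_ge oU aa l0 gP) _.
apply: (@lebesgue_measure_lipschitz _ _ _ (moebius (g^-1)%g)) => //.
- exact: measurable_arc.
- move=> s [s0 sh]; have sS := shrink_le s0.
  have D0 := denominator_gt0 S0 rho0 rho2 g1 sS.
  exists (moebius g s); last exact: moebiusK (lt0r_neq0 D0).
  split.
    exact: shrink s0 (moebius_close S0 rho0 rho2 g1 sS).
  exact: (hit_moebius K1 rho0 rhoK S0 aa a1 T0 g1 sS sh).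
- move=> s t [/closed_le sS _] [/closed_le tS _].
  exact: (moebius_lipschitz S0 rho0 rho2 g1V).
Qed.

End Bounds.

(** * Level sets of Psi *)

(** The event [Psi <= T], written so that it holds whether or not the infimum is attained. *)
Definition at_most T : set (SL2 R) := \bigcap_n hit (T + n.+1%:R^-1).

Section Level.
Variables (T sigma : R).
Hypotheses (T0 : 0 < T) (sigma1 : `|sigma| = 1).

Let s2 : sigma * sigma = 1.
Proof.
have h : `|sigma * sigma| = 1 by rewrite normrM sigma1 mulr1.
by rewrite -h ger0_norm// -expr2 sqr_ge0.
Qed.

(** Witnesses on one side of the horizontal axis, chosen by the sign [sigma]. The vanishing slack
    keeps the condition open while admitting ordinate 0. *)
Definition half_hit n : set (SL2 R) :=
  [set g | exists2 z, Lam z & cone (T + n.+1%:R^-1) (\val g *m z) /\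
                              - n.+1%:R^-1 < sigma * (\val g *m z) 1 0].

Definition half_level : set (SL2 R) := \bigcap_n half_hit n `\` hit T.

(** It sends (x, y) to [(c x, y / c - 2 sigma (1 / c - c) x)]. On the slope [t = sigma y / x] it
    acts by [t - 2 |-> c^-2 (t - 2)], a dilation about 2, which explains the product rule. *)
Definition shear (c : R) : SL2 R := (h_ (sigma * (2 * (c ^- 2 - 1)))%R * upper c 0)%g.

Lemma shearM (c d : R) : c != 0 -> d != 0 -> (shear c * shear d)%g = shear (c * d).
Proof.
move=> c0 d0; rewrite /shear -mulgA [(upper c 0 * _)%g]mulgA upper_h// -!mulgA.
rewrite upper_mul// mulr0 mul0r addr0 mulgA -h_add; congr (h_ _ * _)%g.
by field; rewrite c0 d0.
Qed.

(** The abscissa shrinks by [c < 1] and falls below [T]. Slopes in [0, 1) move away from 2, hence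
    stay below 1, and for [c > 9 / 10] they stay above -1 with room to spare. *)
Lemma shear_half_level (c : R) g : 9 / 10 < c -> c < 1 -> half_level g -> hit T (shear c * g)%g.
Proof.
move=> c9 c1 [gN gT]; have c0 : 0 < c by apply: lt_trans c9; rewrite divr_gt0.
(* The sheared vector stays above the lower edge of the cone as soon as [sigma y > - k c x]. As
   [k * c = 3 * c ^+ 2 - 2] is positive, this allows for the slack in [half_hit] once [n] is
   large. *)
pose k := c - 2 * (c^-1 - c).
have kc : k * c = 3 * (c * c) - 2 by rewrite /k; field; rewrite gt_eqF.
have cc : 81 / 100 < c * c.
  have : 0 < (c - 9 / 10) * (c - 9 / 10) by rewrite mulr_gt0// subr_gt0.
  by move=> h; have := c9; move: h; rewrite mulrBr !mulrBl; move: (c * c) => ?; lra.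
have k0 : 0 < k by rewrite -(pmulr_lgt0 _ c0) kc; move: (c * c) cc => ?; lra.
have [n nP] : exists n : nat, Num.max ((k * T * c)^-1) ((T * (1 - c))^-1) < n.+1%:R.
  exact: ex_nat_gt.
move: nP; rewrite gt_max => /andP[n1 n2].
have [z Lz [[z1 z2] z3]] := gN n I.
have zT : T <= (\val g *m z) 0 0.
  by rewrite leNgt; apply/negP => h; apply: gT; exists z.
exists z => //; rewrite !SL2_mulmx -!mulmxA.
move: (\val g *m z) z1 z2 z3 zT => v z1 z2 z3 zT.
have n0 : 0 < n.+1%:R :> R by rewrite ltr0n.
have e1 : n.+1%:R^-1 < k * T * c by rewrite invf_plt ?posrE ?mulr_gt0.
have e2 : n.+1%:R^-1 < T * (1 - c) by rewrite invf_plt ?posrE ?mulr_gt0// subr_gt0.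
move: z2 z3 e1 e2; move: (n.+1%:R^-1) => e z2 z3 e1 e2.
rewrite upperE ?gt_eqF// hE /cone /= !mxE !sum_I2 !mxE !sum_I2 !mxE /=.
move: (v 0 0) (v 1 0) z1 z2 z3 zT => x y z1 z2 z3 zT.
have x0 : 0 < x by exact: lt_le_trans zT.
rewrite !mul0r !addr0 !add0r !mul1r; split; last first.
  have : c * x < c * (T + e) by rewrite ltr_pM2l.
  have : c * e <= e by rewrite ler_piMl ?ltW//; move: z2 zT; lra.
  rewrite mulrDr; move: e2; rewrite mulrBr mulr1 [T * c]mulrC.
  move: (c * x) (c * T) (c * e) => ? ? ?; lra.
pose b := 2 * (c^-1 - c).
have sg : - (sigma * (2 * (c ^- 2 - 1))) * (c * x) + c^-1 * y = sigma * (sigma * y / c - b * x).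
  have -> : c^-1 * y = sigma * sigma * (c^-1 * y) by rewrite s2 mul1r.
  by rewrite /b; field; rewrite gt_eqF.
have sy : sigma * y <= `|y| by apply: le_trans (ler_norm _) _; rewrite normrM sigma1 mul1r.
rewrite sg normrM sigma1 mul1r ltr_norml; set w := _ - b * x.
have wc : w * c = sigma * y - (2 - 2 * (c * c)) * x by rewrite /w /b; field; rewrite gt_eqF.
apply/andP; split; rewrite -(ltr_pM2r c0) wc.
  have -> : - (c * x) * c = - (k * c * x) - (2 - 2 * (c * c)) * x by rewrite kc; ring.
  rewrite ltrD2r; apply: le_lt_trans z3; rewrite lerN2; apply: le_trans (ltW e1) _.
  by rewrite mulrAC ler_pM2l// mulr_gt0.
have -> : c * x * c = (2 - c * c) * x - (2 - 2 * (c * c)) * x by ring.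
rewrite ltrD2r; apply: le_lt_trans sy _; apply: lt_le_trans z1 _.
rewrite ler_peMl ?(ltW x0)//.
have : c * c <= 1 by rewrite -[1]mulr1 ler_pM// ltW.
by move: (c * c) => ? ?; lra.
Qed.

Lemma open_half_hit n : open (half_hit n).
Proof.
have -> : half_hit n = \bigcup_(z in Lam)
    [set g : SL2 R | cone (T + n.+1%:R^-1) (\val g *m z) /\ - n.+1%:R^-1 < sigma * (\val g *m z) 1 0].
  by apply/seteqP; split=> g [z Lz gz]; exists z.
apply: bigcup_open => z _; apply: openI; first exact: open_cone_preimage.
have c : continuous (fun g : SL2 R => sigma * (\val g *m z) 1 0).
  move=> g; exact: (cvgM (cvg_cst _) (@entry_mulmx_continuous R z 1 g)).
exact: (@open_comp _ _ (fun g : SL2 R => sigma * (\val g *m z) 1 0)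
  [set t | - n.+1%:R^-1 < t] (fun g _ => c g) (@open_gt _ _)).
Qed.

Lemma rinv_half_hit n : right_invariant (half_hit n).
Proof.
move=> x g Gg [z Lz xz]; exists (\val (g^-1)%g *m z); first by apply: LamP => //; exact: GammaV.
by rewrite mulmxA -SL2_mulmx mulgK.
Qed.

Lemma measurable_half_level : measurable (half_level : set G).
Proof.
apply: measurableD; last by apply: open_measurable_SL2; exact: open_hit.
by apply: bigcap_measurable => // n _; apply: open_measurable_SL2; exact: open_half_hit.
Qed.

Lemma rinv_half_level : right_invariant half_level.
Proof.
move=> x g Gg [xN xT]; split; first by move=> n _; apply: rinv_half_hit => //; exact: xN.
by move=> /(right_invariantE _ (@rinv_hit T) Gg).
Qed.

(* The translates of the level set by suitable shears are disjoint. *)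
Lemma nu_half_level : nu half_level = 0%E.
Proof.
(* A sequence decreasing from 19/20 to 9/10, so that the ratio of a later term to an earlier one
   always lies strictly between 9/10 and 1. *)
pose c (i : nat) : R := 9 / 10 + (10 * i.+2%:R)^-1.
have c9 i : 9 / 10 < c i by rewrite /c ltrDl invr_gt0 mulr_gt0.
have c1 i : c i < 1.
  rewrite /c -ltrBrDl; have -> : 1 - 9 / 10 = 10^-1 :> R by field.
  by rewrite ltf_pV2 ?posrE// ltr_pMr// ltr1n.
have c0 i : 0 < c i by apply: lt_trans (c9 i); rewrite divr_gt0.
have cj i j : (i < j)%N -> c j < c i.
  by move=> ij; rewrite /c ltrD2l ltf_pV2 ?posrE ?mulr_gt0// ltr_pM2l// ltr_nat.
pose F (i : nat) : set G := [set x : SL2 R | half_level (shear (c i) * x)%g].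
have mF i : measurable (F i) by apply: measurable_mull; exact: measurable_half_level.
have nuF i : nu (F i) = nu half_level.
  by apply: nu_mull; [exact: measurable_half_level|exact: rinv_half_level].
have disj i j x : (i < j)%N -> F i x -> F j x -> False.
  move=> ij xi [_ xj]; apply: xj.
  have -> : (shear (c j) * x = shear (c j / c i)%R * (shear (c i) * x))%g.
    by rewrite mulgA shearM ?gt_eqF ?divr_gt0// divfK ?gt_eqF.
  apply: shear_half_level => //; last by rewrite ltr_pdivrMr// mul1r cj.
  rewrite ltr_pdivlMr//; apply: lt_trans (c9 j).
  by rewrite -[ltRHS]mulr1 ltr_pM2l ?divr_gt0.
have tF : trivIset setT F.
  apply/trivIsetP => i j _ _ ij; apply/seteqP; split=> // x [xi xj].
  by move: ij; rewrite neq_ltn => /orP[ij|ij]; [exact: disj ij xi xj|exact: disj ij xj xi].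
pose v := fine (nu half_level).
have vE : nu half_level = v%:E.
  by rewrite fineK// fin_num_measure//; exact: measurable_half_level.
have v0 : 0 <= v by exact: fine_ge0.
rewrite vE; have [->//|vneq] := eqVneq v 0.
have vgt : 0 < v by rewrite lt0r vneq.
have [n nP] := ex_nat_gt (fine (nu [set: G]) / v).
have mU : measurable (\big[setU/set0]_(i < n.+1) F i) by exact: bigsetU_measurable.
have := measure_semi_additive F n.+1 mF tF mU => /(_ _ nu) e.
have : (nu (\big[setU/set0]_(i < n.+1) F i) <= nu [set: G])%E.
  by apply: le_measure; rewrite ?inE.
rewrite e (eq_bigr (fun=> v%:E)) => [|i _]; last exact: etrans (nuF i) vE.
rewrite sumEFin sumr_const card_ord -(fineK (fin_num_measure nu _ measurableT)) lee_fin.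
rewrite -mulr_natl -ler_pdivlMr// => h; exfalso.
by move: nP; rewrite ltNge h.
Qed.

End Level.

(** * Continuity of the measure in the threshold *)

Local Notation vol T := (fine (nu (hit T))).

Lemma measurable_hit T : measurable (hit T : set G).
Proof. by apply: open_measurable_SL2; exact: open_hit. Qed.

Lemma nu_hitE T : nu (hit T) = (vol T)%:E.
Proof. by rewrite fineK ?fin_num_measure//; exact: measurable_hit. Qed.

Lemma vol_le T T' : T <= T' -> vol T <= vol T'.
Proof.
move=> TT; rewrite -lee_fin -!nu_hitE; apply: le_measure; rewrite ?inE.
- exact: measurable_hit.
- exact: measurable_hit.
- exact: hit_le.
Qed.

Lemma measurable_at_most T : measurable (at_most T : set G).
Proof. by apply: bigcap_measurable => // n _; exact: measurable_hit. Qed.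

Lemma hit_at_most T : hit T `<=` at_most T.
Proof. by move=> g gT n _; apply: hit_le gT; rewrite lerDl. Qed.

(** Outside [hit T], a point that fails some [half_hit] of sign 1 has, at that level, only witnesses
    with negative ordinate. Witnesses for finer levels are among them, so the point lies in the half
    level of sign -1. *)
Lemma nu_at_most T : 0 < T -> nu (at_most T) = nu (hit T).
Proof.
move=> T0; apply/eqP; rewrite eq_le; apply/andP; split; last first.
  by apply: le_measure; rewrite ?inE; [exact: measurable_hit|exact: measurable_at_most|exact: hit_at_most].
have n1 : nu (half_level T 1) = 0%E by apply: nu_half_level => //; rewrite normr1.
have n2 : nu (half_level T (-1)) = 0%E by apply: nu_half_level => //; rewrite normrN1.
have mL s : measurable (half_level T s : set G) by exact: measurable_half_level.
apply: (@le_trans _ _ (nu ((hit T : set G) `|` (half_level T 1 `|` half_level T (-1))))%E).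
  apply: le_measure; rewrite ?inE; first exact: measurable_at_most.
    by apply: measurableU; [exact: measurable_hit|exact: measurableU].
  move=> g gT; have [gh|gh] := pselect (hit T g); [by left|right].
  have [[n ng]|all1] := pselect (exists n, ~ half_hit T 1 n g); last first.
    by left; split=> // n _; apply: contrapT => ng; apply: all1; exists n.
  right; split=> // m _.
  have [z Lz [z1 z2]] := gT (maxn n m) I.
  have le k : (k <= maxn n m)%N -> (maxn n m).+1%:R^-1 <= k.+1%:R^-1 :> R.
    by move=> kn; rewrite lef_pV2 ?posrE ?ltr0n// ler_nat.
  have ln := le n (leq_maxl _ _); have lm := le m (leq_maxr _ _).
  have yn : (\val g *m z) 1 0 <= - n.+1%:R^-1.
    rewrite leNgt; apply/negP => h; apply: ng; exists z => //; rewrite mul1r; split=> //.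
    by split=> //; apply: lt_le_trans z2 _; rewrite lerD2l.
  exists z => //; split; first by split=> //; apply: lt_le_trans z2 _; rewrite lerD2l.
  rewrite mulN1r ltrN2; apply: le_lt_trans yn _.
  by rewrite ltrNl; apply: (@lt_trans _ _ 0); rewrite ?oppr_lt0 invr_gt0.
apply: le_trans (measureU2 _ _ _) _ => //; first exact: measurable_hit.
  exact: measurableU.
rewrite -[leRHS]adde0 leeD2l// -(adde0 0%E) -{1}n1 -n2.
exact: measureU2.
Qed.

(** Continuity of the measure from above: the sets decrease to [at_most T], which has the measure of
    [hit T]. *)
Lemma vol_right (T e : R) : 0 < T -> 0 < e -> exists2 T', T < T' & vol T' <= vol T + e.
Proof.
move=> T0 e0; pose F (n : nat) : set G := hit (T + n.+1%:R^-1).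
have mF n : measurable (F n) by exact: measurable_hit.
have niF : {homo F : n m / (n <= m)%N >-> (m <= n)%O}.
  move=> n m nm; apply/subsetPset; apply: hit_le; rewrite lerD2l lef_pV2 ?posrE ?ltr0n//.
  by rewrite ler_nat.
have fin0 : (nu (F 0%N) < +oo)%E by rewrite ltey_eq fin_num_measure.
have := @nonincreasing_cvg_mu _ G R nu F fin0 mF (bigcapT_measurable mF) niF.
rewrite [X in _ --> X]nu_at_most// nu_hitE => /fine_cvgP[_ /cvgrPdist_le/(_ e e0)[N _ NP]].
exists (T + N.+1%:R^-1); first by rewrite ltrDl invr_gt0.
have := NP N (leqnn N); rewrite /= /F ler_norml => /andP[h _].
by move: h; lra.
Qed.

Lemma vol_left (T e : R) : 0 < T -> 0 < e -> exists2 T', 0 < T' < T & vol T - e <= vol T'.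
Proof.
(* Dividing by [n + 2] instead of [n + 1] keeps every [t n] positive. *)
move=> T0 e0; pose t (n : nat) : R := T - T / n.+2%:R.
pose F (n : nat) : set G := hit (t n).
have mF n : measurable (F n) by exact: measurable_hit.
have tle n m : (n <= m)%N -> t n <= t m.
  by move=> nm; rewrite lerD2l lerN2 ler_pM2l// lef_pV2 ?posrE ?ltr0n// ler_nat.
have ndF : {homo F : n m / (n <= m)%N >-> (n <= m)%O}.
  by move=> n m nm; apply/subsetPset; apply: hit_le; exact: tle.
have FT : \bigcup_n F n = hit T.
  apply/seteqP; split=> [g [n _]|g [z Lz [z1 z2]]].
    by apply: hit_le; rewrite gerBl divr_ge0// ltW.
  have [n nP] := ex_nat_gt (T / (T - (\val g *m z) 0 0)).
  exists n => //; exists z => //; split=> //.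
  rewrite /t ltrBrDr -ltrBrDl ltr_pdivrMr ?ltr0n//.
  have d0 : 0 < T - (\val g *m z) 0 0 by rewrite subr_gt0.
  rewrite mulrC -ltr_pdivrMr//; apply: lt_trans nP _.
  by rewrite ltr_nat.
have := @nondecreasing_cvg_mu _ G R nu F mF (bigcupT_measurable _ mF) ndF.
rewrite FT [X in _ --> X]nu_hitE => /fine_cvgP[_ /cvgrPdist_le/(_ e e0)[N _ NP]].
exists (t N); first by rewrite /t gtrBl divr_gt0// andbT subr_gt0 ltr_pdivrMr// ltr_pMr// ltr1n.
have := NP N (leqnn N); rewrite /= /F ler_norml => /andP[_ h].
by move: h; lra.
Qed.

End Visits.

(** * Choice of constants and convergence of the visit frequency *)

(** The comparison of arcs costs [K ^+ 2], and one more factor [K] separates the closed event from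
    an open one. For [k <= 1] one has [(1 + k) ^+ 3 <= 1 + 7 * k], hence the 7. *)
Lemma ex_cube_le (q : R) : 1 < q -> exists2 K : R, 1 < K & K ^+ 3 <= q.
Proof.
move=> q1; pose k := Num.min 1 ((q - 1) / 7).
have k0 : 0 < k by rewrite lt_min ltr01/= divr_gt0// subr_gt0.
have k1 : k <= 1 by rewrite ge_min lexx.
have kq : 7 * k <= q - 1 by rewrite mulrC -ler_pdivlMr// ge_min lexx orbT.
exists (1 + k); first by rewrite ltrDl.
have k2 : k * k <= k by rewrite ler_piMl// ltW.
have k3 : k * k * k <= k by apply: le_trans k2; rewrite ler_piMr// mulr_ge0// ltW.
have -> : (1 + k) ^+ 3 = 1 + 3 * k + 3 * (k * k) + k * k * k by ring.
by move: (k * k * k) (k * k) k2 k3 => ? ? ? ?; lra.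
Qed.

(** Each inequality is strict in the limit [rho = 0], and both sides are continuous in [rho]. *)
Lemma ex_small_error (K alpha x e : R) : 1 < K -> 0 < alpha -> 0 < e ->
  exists2 rho : R, 0 < rho &
    [/\ 2 * (K * rho) <= K - 1, 6 * rho < alpha,
        (1 + 6 * rho) * ((alpha + 6 * rho) * (x + rho)) <= alpha * (x + e) &
        (1 + 6 * rho) * (alpha * (x - e)) <= (alpha - 6 * rho) * (x - rho)].
Proof.
move=> K1 alpha0 e0.
have c0 : (fun t : R => t) @ (0 : R)^'+ --> (0 : R) by apply: cvg_within_filter; exact: cvg_id.
have lin a b : (fun t : R => b + a * t) @ (0 : R)^'+ --> b.
  rewrite -[X in _ --> X]addr0 -[X in b + X](mulr0 a).
  by apply: cvgD; [exact: cvg_cst|apply: cvgM => //; exact: cvg_cst].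
have ae : 0 < alpha * e by rewrite mulr_gt0.
have f1 : (fun t : R => (1 + 6 * t) * ((alpha + 6 * t) * (x + 1 * t))) @ (0 : R)^'+ --> 1 * (alpha * x).
  by apply: cvgM; [exact: lin|apply: cvgM; exact: lin].
have f2 : (fun t : R => (alpha + (-6) * t) * (x + (-1) * t) - (1 + 6 * t) * (alpha * (x - e)))
    @ (0 : R)^'+ --> alpha * x - 1 * (alpha * (x - e)).
  by apply: cvgB; apply: cvgM; try exact: lin; exact: cvg_cst.
near (0 : R)^'+ => t.
have t0 : 0 < t by near: t; exact: nbhs_right_gt.
exists t => //; split.
- have : 0 + (2 * K) * t < K - 1.
    by near: t; have := cvgr_lt _ (lin (2 * K) 0) (K - 1); apply; rewrite subr_gt0.
  by rewrite add0r -mulrA => /ltW.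
- have : 0 + 6 * t < alpha by near: t; have := cvgr_lt _ (lin 6 0) alpha; apply.
  by rewrite add0r.
- rewrite -[in x + t](mul1r t); apply: ltW; near: t.
  have := cvgr_lt _ f1 (alpha * (x + e)); apply.
  by rewrite mul1r ltr_pM2l// ltrDl.
have : 0 < (alpha + (-6) * t) * (x + (-1) * t) - (1 + 6 * t) * (alpha * (x - e)).
  near: t; have := cvgr_gt _ f2 0; apply.
  by rewrite mul1r -mulrBr opprB addrCA subrr addr0.
by rewrite !mulNr mul1r subr_gt0 => /ltW.
Unshelve. all: by end_near. Qed.

Section Limit.
Variable Lam : set 'cV[R]_2.
Hypothesis LamP : forall g z, Gamma g -> Lam z -> Lam (\val g *m z).
Variables (alpha T : R).
Hypotheses (alpha0 : 0 < alpha) (T0 : 0 < T).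
Local Notation hit := (hit Lam).
Local Notation lam := (@lebesgue_measure R).
Local Notation density T := (fine (nu (hit T)) / fine (nu [set: G])).

Definition returns (a : R) : set R :=
  [set s | 0 <= s <= alpha /\ at_most Lam T (upper a 0 * h_ s)%g].

Lemma measurable_returns a : measurable (returns a).
Proof.
have -> : returns a = \bigcap_n visits Lam alpha a (T + n.+1%:R^-1).
  apply/seteqP; split=> [s [s0 sT] n _|s sT]; first by split=> //; exact: sT.
  by split=> [|n _]; [have [] := sT 0%N I|have [] := sT n I].
by apply: bigcap_measurable => // n _; exact: measurable_visits.
Qed.

Lemma returns_le a : (lam (returns a) <= alpha%:E)%E.
Proof.
have -> : alpha%:E = lam `[0, alpha]%classic.
  by rewrite lebesgue_measure_itv /= lte_fin alpha0 oppr0 adde0.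
apply: le_measure; rewrite ?inE//; first exact: measurable_returns.
by move=> s [s0 _]; rewrite /= in_itv.
Qed.

Lemma returnsE a : lam (returns a) = (fine (lam (returns a)))%:E.
Proof.
by rewrite fineK// ge0_fin_numE//; exact: le_lt_trans (returns_le a) (ltry _).
Qed.

(** The event with threshold [T] lies in the open event with threshold [K * T]. The comparison
    raises it to [K ^+ 3 * T <= T'], and [T'] was chosen so that little measure is gained. *)
Lemma returns_upper (e : R) : 0 < e -> exists2 a0 : R, 0 < a0 & forall a : R, 0 < a -> a < a0 ->
  alpha^-1 * fine (lam (returns a)) <= density T + e.
Proof.
move=> e0; have e2 : 0 < e / 2 by rewrite divr_gt0.
have V1 : 0 < fine (nu [set: G]) by exact: nu_total_gt0.
have [T' TT' volT'] := vol_right LamP T0 (mulr_gt0 e2 V1).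
have dT' : density T' <= density T + e / 2 by rewrite ler_pdivrMr// mulrDl divfK// gt_eqF.
have [|K K1 KT'] := @ex_cube_le (T' / T); first by rewrite ltr_pdivlMr// mul1r.
have [rho rho0 [r1 r2 r3 _]] := ex_small_error (density T + e / 2) K1 alpha0 e2.
have KT0 : 0 < K * T by rewrite mulr_gt0// (lt_trans _ K1).
have [a0 a00 a0P] := visits_le LamP alpha0 K1 rho0 r1 KT0.
exists a0 => // a aa aa0; have := a0P a aa aa0.
have le1 : (lam (returns a) <= lam (visits Lam alpha a (K * T)))%E.
  apply: le_measure; rewrite ?inE; [exact: measurable_returns|exact: measurable_visits|].
  move=> s [s0 sT]; split=> //.
  have d0 : 0 < K * T - T by rewrite subr_gt0 -[ltLHS]mul1r ltr_pM2r.
  have [n nP] := ex_nat_gt ((K * T - T)^-1).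
  apply: hit_le (sT n I); rewrite -lerBrDl ltW// invf_plt ?posrE// ltr0n//.
move=> /(le_trans le1); rewrite returnsE lee_fin => le2.
rewrite ler_pdivrMl//; apply: le_trans le2 _.
have -> : density T + e = density T + e / 2 + e / 2 by rewrite -addrA -splitr.
apply: le_trans r3; rewrite ler_pM2l; last by rewrite addr_gt0// mulr_gt0.
rewrite ler_pM2l; last by rewrite addr_gt0// mulr_gt0.
rewrite lerD2r; apply: le_trans dT'; rewrite ler_pM2r ?invr_gt0//.
by apply: vol_le; rewrite mulrA -exprSr -ler_pdivlMr.
Qed.

(** The threshold is lowered to [T' < T] at a small loss of measure; the comparison then brings it
    back to [K ^+ 2 * T' <= T]. *)
Lemma returns_lower (e : R) : 0 < e -> exists2 a0 : R, 0 < a0 & forall a : R, 0 < a -> a < a0 ->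
  density T - e <= alpha^-1 * fine (lam (returns a)).
Proof.
move=> e0; have e2 : 0 < e / 2 by rewrite divr_gt0.
have V1 : 0 < fine (nu [set: G]) by exact: nu_total_gt0.
have [T' /andP[T'0 TT'] volT'] := vol_left Lam T0 (mulr_gt0 e2 V1).
have dT' : density T - e / 2 <= density T'.
  by rewrite ler_pdivlMr// mulrBl divfK// gt_eqF.
have [|K K1 KT'] := @ex_cube_le (T / T'); first by rewrite ltr_pdivlMr// mul1r.
have [rho rho0 [r1 r2 _ r4]] := ex_small_error (density T') K1 alpha0 e2.
have [a0 a00 a0P] := visits_ge LamP alpha0 K1 rho0 r1 T'0 r2.
exists a0 => // a aa aa0; have := a0P a aa aa0.
have r6 : 0 < 1 + 6 * rho by rewrite addr_gt0// mulr_gt0.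
have le1 : (lam (visits Lam alpha a (K ^+ 2 * T')) <= lam (returns a))%E.
  apply: le_measure; rewrite ?inE; [exact: measurable_visits|exact: measurable_returns|].
  move=> s [s0 sT]; split=> //; apply: hit_at_most; apply: hit_le sT.
  rewrite -ler_pdivlMr//; apply: le_trans KT'; rewrite [leRHS]exprSr ler_peMr ?sqr_ge0// ltW//.
have le2 : ((1 + 6 * rho)%:E * lam (visits Lam alpha a (K ^+ 2 * T')) <=
    (1 + 6 * rho)%:E * lam (returns a))%E by rewrite lee_pmul2l// lte_fin.
move=> /le_trans/(_ le2); rewrite returnsE -EFinM lee_fin => /(le_trans r4).
rewrite ler_pM2l// -ler_pdivlMl//; apply: le_trans.
by move: (density T) (density T') dT' => ? ? ?; lra.
Qed.

Lemma returns_cvg :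
  (fun delta : R => alpha^-1 * fine (lam (returns (Num.sqrt delta)))) @ (0 : R)^'+ --> density T.
Proof.
apply/cvgrPdist_le => e e0.
have [a1 a10 a1P] := returns_upper e0; have [a2 a20 a2P] := returns_lower e0.
near=> d.
have d0 : 0 < d by near: d; exact: nbhs_right_gt.
have s0 : 0 < Num.sqrt d by rewrite sqrtr_gt0.
have sq (b : R) : 0 < b -> d < b ^+ 2 -> Num.sqrt d < b.
  by move=> b0 db; rewrite -(gtr0_norm b0) -sqrtr_sqr ltr_sqrt// exprn_gt0.
have s1 : Num.sqrt d < a1 by apply: sq => //; near: d; apply: nbhs_right_lt; rewrite exprn_gt0.
have s2 : Num.sqrt d < a2 by apply: sq => //; near: d; apply: nbhs_right_lt; rewrite exprn_gt0.
have := a1P _ s0 s1; have := a2P _ s0 s2; move: (alpha^-1 * _) (density T) => u v.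
by rewrite ler_norml => h1 h2; apply/andP; split; lra.
Unshelve. all: by end_near. Qed.

End Limit.

End Equidistribution.

(** * The limit distribution *)

Lemma uniform_prob_subset (R : realType) (a b : R) (ab : a < b) (S : set R) :
  measurable S -> S `<=` `[a, b]%classic ->
  uniform_prob ab S = ((b - a)^-1%:E * lebesgue_measure S)%E.
Proof.
move=> mS Sab; rewrite /uniform_prob (eq_integral (cst (b - a)^-1%:E)).
  by rewrite integral_cst.
by move=> x /set_mem/Sab; rewrite /= in_itv /uniform_pdf /= => ->.
Qed.

Section PsiLevels.
Context {R : realType} (w : translation_surface R).
Implicit Types (g : SL2 R) (T d : R).

Lemma at_mostP (Lam : set 'cV[R]_2) T g :
  at_most Lam T g <-> forall e : R, 0 < e -> hit Lam (T + e) g.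
Proof.
split=> [gT e e0|gT n _]; last by apply: gT; rewrite invr_gt0.
have [n] := ltr_add_invr e0; rewrite add0r => ne.
by apply: hit_le (gT n I); rewrite lerD2l ltW.
Qed.

Lemma Psi_leP g T d : (Psi (act g w) d <= T%:E)%E <->
  forall e : R, 0 < e -> exists2 z, holonomy_vectors w z &
    Cdelta d (\val g *m z) /\ (\val g *m z) 0 0 < T + e.
Proof.
split=> [gT e e0|h].
  have : (Psi (act g w) d < (T + e)%:E)%E by apply: le_lt_trans gT _; rewrite lte_fin ltrDl.
  move=> /ereal_inf_lt[_ [z [/holonomy_actE[v wv zE] zd] <-]]; rewrite lte_fin => zT.
  by exists v => //; rewrite -zE.
apply/lee_addgt0Pr => e e0; have [z wz [zd zT]] := h e e0.
apply: (@le_trans _ _ ((\val g *m z) 0 0)%:E); last by rewrite -EFinD lee_fin ltW.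
have Sz : [set (v 0 0)%:E | v in holonomy_vectors (act g w) `&` Cdelta d] ((\val g *m z) 0 0)%:E.
  by exists (\val g *m z); [split; [apply/holonomy_actE; exists z|exact: zd]|].
exact: (ge_ereal_inf (ex_intro2 _ _ _ Sz (lexx _))).
Qed.

Lemma Psi_at_most g T : (Psi (act g w) 1 <= T%:E)%E <-> at_most (holonomy_vectors w) T g.
Proof.
rewrite Psi_leP at_mostP; split=> h e e0.
  by have [z wz [[z0 z1] zT]] := h e e0; exists z => //; split=> //; rewrite mul1r in z1.
have [z wz [z1 zT]] := h e e0; exists z => //; split=> //; split; last by rewrite mul1r.
exact: le_lt_trans z1.
Qed.

(** With [r = Num.sqrt d], the condition [|y| < d x] reads [|y / r| < r x]. The diagonal matrix thus
    carries the cone of aperture [d] onto the one of aperture 1 and multiplies abscissas by [r]. *)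
Lemma Psi_rescale g T d : 0 < d ->
  ((Num.sqrt d)%:E * Psi (act g w) d <= T%:E)%E <->
  at_most (holonomy_vectors w) T (upper (Num.sqrt d) 0 * g)%g.
Proof.
move=> d0; have r0 : 0 < Num.sqrt d by rewrite sqrtr_gt0.
have dE : d = Num.sqrt d * Num.sqrt d by rewrite -expr2 sqr_sqrtr ?ltW.
rewrite muleC -lee_pdivlMr// -EFinM Psi_leP at_mostP; move: (Num.sqrt d) r0 dE => r r0 dE.
have rE z : \val (upper r 0 * g)%g *m z =
    \col_i (if i == 0 then r * (\val g *m z) 0 0 else r^-1 * (\val g *m z) 1 0).
  rewrite SL2_mulmx -mulmxA upperE ?gt_eqF//; move: (\val g *m z) => v.
  apply/matrixP => i j; rewrite ord1 !mxE sum_I2 !mxE /=; move: i; apply: forall_I2 => /=.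
    by rewrite mul0r addr0.
  by rewrite mul0r add0r.
split=> h e e0.
  have [z wz b] := h (e / r) (divr_gt0 e0 r0); exists z => //; move: b.
  rewrite rE; move: (\val g *m z) => v; rewrite /cone /Cdelta /= !mxE /= => -[[v0 v1] vT]; split.
    by rewrite normrM gtr0_norm ?invr_gt0// ltr_pdivrMl// mulrA -dE.
  by rewrite mulrC -ltr_pdivlMr// mulrDl.
have [z wz b] := h (e * r) (mulr_gt0 e0 r0); exists z => //; move: b.
rewrite rE; move: (\val g *m z) => v; rewrite /cone /Cdelta /= !mxE /= => -[v1 vT].
have v0 : 0 < v 0 0 by rewrite -(pmulr_rgt0 _ r0); exact: le_lt_trans v1.
split; last by move: vT; rewrite mulrC -ltr_pdivlMr// mulrDl mulfK ?gt_eqF.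
by split=> //; move: v1; rewrite normrM gtr0_norm ?invr_gt0// ltr_pdivrMl// mulrA -dE.
Qed.

End PsiLevels.

Theorem theorem1p4 (R : realType) (w : translation_surface R)
    (haar : {measure set (borel (SL2 R)) -> \bar R})
    (mu : {measure set (borel (SL2_quotient (veech_group w))) -> \bar R})
    (alpha : R) (alpha_gt0 : 0 < alpha) :
  haar_measure haar ->
  induced_measure haar mu ->
  veech_surface mu ->
  veech_group w (h_ alpha) ->
  forall T : R, 0 < T ->
    fine (uniform_prob alpha_gt0
            [set s | 0 <= s <= alpha /\
                     ((Num.sqrt delta)%:E * Psi (act (h_ s) w) delta <= T%:E)%E])
      @[delta --> 0^'+]
    --> fine (mu [set to_quotient (veech_group w) g | g in
                    [set g : SL2 R | (Psi (act g w) 1 <= T%:E)%E]])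
        / fine (mu setT).
Proof.
move=> haarP muP [isoG mu_fin] _ T T0.
have G1 := veech_group1 w; have GM := @veech_groupM R w; have GV := @veech_groupV R w.
have [D mD fdD] := ex_fundamental_domain G1 GM GV isoG.
pose Lam := holonomy_vectors w.
have LamP (g : SL2 R) z : veech_group w g -> Lam z -> Lam (\val g *m z).
  exact: veech_group_holonomy.
have -> : [set g : SL2 R | (Psi (act g w) 1 <= T%:E)%E] = at_most Lam T.
  by apply/seteqP; split=> g /Psi_at_most.
have rA : right_invariant (veech_group w) (at_most Lam T).
  by move=> x g Gg xA n _; apply: (rinv_hit GV LamP Gg); exact: xA.
(* Both terms of the quotient become measures inside the fundamental domain, and the closed event is
   replaced by the open one. *)
rewrite -(nu_quotient G1 GM GV mD fdD muP mu_fin (measurable_at_most Lam T) rA).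
rewrite (nu_at_most G1 GM GV haarP mD fdD muP mu_fin LamP T0).
rewrite -(nuT G1 GM GV mD fdD muP mu_fin).
have := @returns_cvg R _ haar G1 GM GV isoG haarP D mu mD fdD muP mu_fin Lam LamP alpha T alpha_gt0 T0.
apply: cvg_trans; apply: near_eq_cvg; near=> delta.
have d0 : 0 < delta by near: delta; exact: nbhs_right_gt.
have -> : [set s | 0 <= s <= alpha /\
    ((Num.sqrt delta)%:E * Psi (act (h_ s) w) delta <= T%:E)%E] =
    returns Lam alpha T (Num.sqrt delta).
  by apply/seteqP; split=> s [s0 /(Psi_rescale w _ _ d0)].
rewrite uniform_prob_subset; last 2 first.
- exact: measurable_returns.
- by move=> s [s0 _]; rewrite /= in_itv.
by rewrite subr0 returnsE// -EFinM.
Unshelve. all: by end_near. Qed.
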